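(* Let $\mathcal{A}$ be a finite-dimensional weak Hopf algebra over $\mathbb{C}$ with $\mathcal{A}^*$ semisimple, and let $d_a$, $g$, $l_a$ be as in the context. Define $\Lambda\in\mathcal{A}$ by $$f(\Lambda)=\sum_{a\in\mathrm{Irr}(\mathcal{A}^* )}\frac{d_a}{\sum_{x:\,l_x=l_a}d_x^2}\,\mathrm{Tr}\big(\psi_a(g)\psi_a(f)\big)\qquad\text{for all }f\in\mathcal{A}^*$$ (the denominators being nonzero). Then $\Lambda$ is a non-degenerate normalized left integral of $\mathcal{A}$ which is also a q-trace; that is: $\Lambda^2=\Lambda$; $\{(f\otimes\mathrm{Id})\Delta(\Lambda):f\in\mathcal{A}^*\}=\{(\mathrm{Id}\otimes f)\Delta(\Lambda):f\in\mathcal{A}^*\}=\mathcal{A}$; $(1\otimes x)\Delta(\Lambda)=(S(x)\otimes1)\Delta(\Lambda)$ for all $x\in\mathcal{A}$; and $\Delta_{\mathrm{op}}(\Lambda)=(S^{-2}\otimes\mathrm{Id})\Delta(\Lambda)$.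
   Context: Weak Hopf algebra: a finite-dimensional unital algebra $\mathcal{A}$ with coassociative counital coproduct $\Delta$ (Sweedler notation), counit $\epsilon$, $\Delta(xy)=\Delta(x)\Delta(y)$, $\Delta^2(1)=(1\otimes\Delta(1))(\Delta(1)\otimes1)=(\Delta(1)\otimes1)(1\otimes\Delta(1))$, $\epsilon(xyz)=\sum\epsilon(xy_{(1)})\epsilon(y_{(2)}z)=\sum\epsilon(xy_{(2)})\epsilon(y_{(1)}z)$, and antipode $S$ with $\sum S(x_{(1)})x_{(2)}=\sum 1_{(1)}\epsilon(x1_{(2)})$, $\sum x_{(1)}S(x_{(2)})=\sum\epsilon(1_{(1)}x)1_{(2)}$, $\sum S(x_{(1)})x_{(2)}S(x_{(3)})=S(x)$ ($S$ is bijective). $\Delta_{\mathrm{op}}(x)=\sum x_{(2)}\otimes x_{(1)}$. The dual $\mathcal{A}^*$ is a weak Hopf algebra with product $(fg)(x)=\sum f(x_{(1)})g(x_{(2)})$, unit $\epsilon$, coproduct $\Delta(f)(x\otimes y)=f(xy)$, antipode $S(f)=f\circ S$. Irreps: for $a\in\mathrm{Irr}(\mathcal{A}^* )$ fix $\psi_a:\mathcal{A}^*\to\mathrm{End}(W_a)$. $N_{ab}^c$ = multiplicity of $\psi_c$ in $f\mapsto(\psi_a\otimes\psi_b)(\Delta f)$ restricted to the range of the idempotent $(\psi_a\otimes\psi_b)(\Delta\epsilon)$. Fusion tensors $V^{c\mu}_{ab}:W_c\to W_a\otimes W_b$, $W^{c\mu}_{ab}:W_a\otimes W_b\to W_c$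 ($\mu=1..N_{ab}^c$) satisfy $(\psi_a\otimes\psi_b)(\Delta f)=\sum_{c,\mu}V^{c\mu}_{ab}\psi_c(f)W^{c\mu}_{ab}$ and $W^{c\mu}_{ab}V^{d\nu}_{ab}=\delta_{cd}\delta_{\mu\nu}\mathrm{id}$. Vacuum: let $b_a\in\mathrm{End}(W_a)$ be such that $f(1)=\sum_a\mathrm{Tr}(b_a\psi_a(f))$, $E=\{a:b_a\ne0\}$. It is known that each $b_e$, $e\in E$, is rank one, $b_e=v_eu_e$ with $v_e\in W_e$, $u_e\in W_e^*$, and for each $a$ there are unique $l_a,r_a\in E$ with $N_{ea}^b=\delta_{e,l_a}\delta_{ab}$, $N_{ae}^b=\delta_{e,r_a}\delta_{ab}$ for $e\in E$. Conjugation: $\bar a$ is the class of $f\mapsto\psi_a(S f)^T$ on $W_a^*$; fix invertible $Z_a:W_{\bar a}\to W_a^*$ with $\psi_a(S(f))^T=Z_a\psi_{\bar a}(f)Z_a^{-1}$ for all $f$. For each $c$ let $\zeta_c\in(W_{\bar c}\otimes W_c)^*$, $\zeta_c(\xi\otimes\eta)=(Z_c\xi)(\eta)$, and let $\theta_c\in W_{\bar c}\otimes W_c$ correspond to $Z_{\bar c}^{-1}:W_{\bar c}^*\to W_c$, i.e. $(\varphi\otimes\mathrm{id})\theta_c=Z_{\bar c}^{-1}(\varphi)$. Then $N^{r_c}_{\bar cc}=1$ and there is a nonzero $w_c\in\mathbb{C}$ with $\zeta_c\otimes\theta_c=w_c\,(u_{r_c}\circ W^{r_c}_{\bar cc})\otimes(V^{r_c}_{\bar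 cc}v_{r_c})$. Let $d_a\in\mathbb{C}$ with $d_a^2=w_aw_{\bar a}$ and $d_a=d_{\bar a}$. Define $g\in\mathcal{A}^*$ by $\psi_a(g)=\frac{d_a}{w_{\bar a}}(Z_a^{-1})^TZ_{\bar a}$ for all $a$, where $Z_{\bar a}:W_a\to W_{\bar a}^*$ and $(Z_a^{-1})^T:W_{\bar a}^*\to W_a$. *)

(* Defs.v *)
From mathcomp Require Import all_boot all_algebra.
From mathcomp Require Import complex mxtens.
From mathcomp Require Import Rstruct.

Set Implicit Arguments.
Unset Strict Implicit.
Unset Printing Implicit Defensive.

Import GRing.Theory Num.Theory.
Local Open Scope ring_scope.

Definition CC : numClosedFieldType := (Rdefinitions.R)[i].

(* A finite-dimensional algebra-with-coproduct A over CC, presented in a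
   fixed basis e_0..e_(n-1).  Elements of A are row vectors 'rV_n
   (coordinates).  Elements of A* are also row vectors 'rV_n (coordinates
   in the dual basis e^0..e^(n-1)), with f(x) = sum_i f_i x_i.
   Tensors in A (x) A are n x n matrices T, T = sum_ij T i j e_i (x) e_j.
   Tensors in A (x) A (x) A are functions on 'I_n * 'I_n * 'I_n.        *)
Record WHAdata (n : nat) := WHAData {
  wmul   : 'I_n -> 'I_n -> 'rV[CC]_n;
  wone   : 'rV[CC]_n;
  wcomul : 'I_n -> 'M[CC]_n;
  weps   : 'rV[CC]_n;
  wS     : 'M[CC]_n
}.

Section WHA.
Variables (n : nat) (H : WHAdata n).

Definition Abas (i : 'I_n) : 'rV[CC]_n := delta_mx 0 i.

Definition Aev (f x : 'rV[CC]_n) : CC := \sum_i f 0 i * x 0 i.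

Definition Amul (x y : 'rV[CC]_n) : 'rV[CC]_n :=
  \sum_i \sum_j (x 0 i * y 0 j) *: wmul H i j.

Definition Aeps (x : 'rV[CC]_n) : CC := Aev (weps H) x.

Definition Aanti (x : 'rV[CC]_n) : 'rV[CC]_n := x *m wS H.

Definition ADelta (x : 'rV[CC]_n) : 'M[CC]_n := \sum_k x 0 k *: wcomul H k.

Definition Atens (x y : 'rV[CC]_n) : 'M[CC]_n := x^T *m y.

Definition Atmul (T U : 'M[CC]_n) : 'M[CC]_n :=
  \sum_i \sum_j \sum_k \sum_l
    (T i j * U k l) *: Atens (Amul (Abas i) (Abas k)) (Amul (Abas j) (Abas l)).

Definition AT3 := {ffun 'I_n * 'I_n * 'I_n -> CC}.

Definition At3 (x y z : 'rV[CC]_n) : AT3 :=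
  [ffun p => x 0 p.1.1 * y 0 p.1.2 * z 0 p.2].

Definition At3mul (T U : AT3) : AT3 :=
  \sum_p \sum_q (T p * U q) *:
     At3 (Amul (Abas p.1.1) (Abas q.1.1)) (Amul (Abas p.1.2) (Abas q.1.2))
        (Amul (Abas p.2) (Abas q.2)).

Definition Delta2l (x : 'rV[CC]_n) : AT3 :=
  [ffun p => \sum_m ADelta x m p.2 * wcomul H m p.1.1 p.1.2].
Definition Delta2r (x : 'rV[CC]_n) : AT3 :=
  [ffun p => \sum_m ADelta x p.1.1 m * wcomul H m p.1.2 p.2].

Definition D1_1 : AT3 :=
  \sum_i \sum_j ADelta (wone H) i j *: At3 (Abas i) (Abas j) (wone H).
Definition one_D1 : AT3 :=
  \sum_i \sum_j ADelta (wone H) i j *: At3 (wone H) (Abas i) (Abas j).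

Definition is_weak_hopf : Prop :=
      (forall x y z, Amul (Amul x y) z = Amul x (Amul y z)) /\
      (forall x, Amul (wone H) x = x /\ Amul x (wone H) = x) /\
      (forall x, Delta2l x = Delta2r x) /\
      (forall x, weps H *m ADelta x = x /\ (ADelta x *m (weps H)^T)^T = x) /\
      (forall x y, ADelta (Amul x y) = Atmul (ADelta x) (ADelta y)) /\
      (Delta2l (wone H) = At3mul one_D1 D1_1 /\
       Delta2l (wone H) = At3mul D1_1 one_D1) /\
      (forall x y z,
         Aeps (Amul (Amul x y) z)
         = \sum_i \sum_j ADelta y i j * Aeps (Amul x (Abas i)) * Aeps (Amul (Abas j) z)
       /\ Aeps (Amul (Amul x y) z)
         = \sum_i \sum_j ADelta y i j * Aeps (Amul x (Abas j)) * Aeps (Amul (Abas i) z)) /\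
      (forall x,
         [/\ \sum_i \sum_j ADelta x i j *: Amul (Aanti (Abas i)) (Abas j)
             = \sum_i \sum_j (ADelta (wone H) i j * Aeps (Amul x (Abas j))) *: Abas i,
             \sum_i \sum_j ADelta x i j *: Amul (Abas i) (Aanti (Abas j))
             = \sum_i \sum_j (ADelta (wone H) i j * Aeps (Amul (Abas i) x)) *: Abas j &
             \sum_p Delta2l x p *: Amul (Amul (Aanti (Abas p.1.1)) (Abas p.1.2)) (Aanti (Abas p.2))
             = Aanti x])
    /\ (* S bijective *) wS H \in unitmx.

Definition Ddmul (f g : 'rV[CC]_n) : 'rV[CC]_n :=
  \row_k \sum_i \sum_j f 0 i * g 0 j * wcomul H k i j.

(* antipode S(f) = f o S *)
Definition Danti (f : 'rV[CC]_n) : 'rV[CC]_n := f *m (wS H)^T.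

(* semisimplicity of A*: every left ideal has a complementary left ideal
   (subspaces of A* are row spaces of n x n matrices) *)
Definition dleft_ideal (U : 'M[CC]_n) : Prop :=
  forall f g, (f <= U)%MS -> (Ddmul g f <= U)%MS.

Definition dual_semisimple : Prop :=
  forall U, dleft_ideal U ->
    exists U', dleft_ideal U' /\ (U :&: U' <= (0 : 'M[CC]_n))%MS /\
               (1%:M <= U + U')%MS.

Definition is_drep (d : nat) (rho : 'rV[CC]_n -> 'M[CC]_d) : Prop :=
  [/\ (forall k f g, rho (k *: f + g) = k *: rho f + rho g),
      rho (weps H) = 1%:M &
      (forall f g, rho (Ddmul f g) = rho f *m rho g)].

(* irreducible: nonzero and no invariant subspace but 0 and W.  A subspace
   of column vectors is given as the span of the transposed rows of U. *)
Definition dirreducible (d : nat) (rho : 'rV[CC]_n -> 'M[CC]_d) : Prop :=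
  (0 < d)%N /\
  forall U : 'M[CC]_d, (forall f, (U *m (rho f)^T <= U)%MS) ->
     U = 0 \/ row_full U.

Definition drep_equiv (d1 d2 : nat) (rho1 : 'rV[CC]_n -> 'M[CC]_d1)
    (rho2 : 'rV[CC]_n -> 'M[CC]_d2) : Prop :=
  exists (T : 'M[CC]_(d1, d2)) (T' : 'M[CC]_(d2, d1)),
    [/\ T *m T' = 1%:M, T' *m T = 1%:M &
        forall f, rho1 f *m T = T *m rho2 f].

(* (psi_a (x) psi_b)(Delta f), where Delta f = sum_ij f(e_i e_j) e^i (x) e^j *)
Definition drep_tens (da db : nat) (rhoa : 'rV[CC]_n -> 'M[CC]_da)
   (rhob : 'rV[CC]_n -> 'M[CC]_db) (f : 'rV[CC]_n) : 'M[CC]_(da * db) :=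
  \sum_i \sum_j Aev f (Amul (Abas i) (Abas j)) *: (rhoa (Abas i) *t rhob (Abas j)).

End WHA.

(* zeta_c in (W_cbar (x) W_c)^*, zeta_c(xi (x) eta) = (Z_c xi)(eta);
   Zc : W_cbar -> W_c^*  (W_c^* in dual-basis coordinates). *)
Definition zeta_of (dc dcb : nat) (Zc : 'M[CC]_(dc, dcb)) : 'rV[CC]_(dcb * dc) :=
  \sum_(i < dcb) \sum_(j < dc)
     Zc j i *: ((delta_mx 0 i : 'rV[CC]_dcb) *t (delta_mx 0 j : 'rV[CC]_dc)).

(* theta in W_cbar (x) W_c with (phi (x) id) theta = M phi, M : W_cbar^* -> W_c *)
Definition theta_of (dc dcb : nat) (M : 'M[CC]_(dc, dcb)) : 'cV[CC]_(dcb * dc) :=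
  \sum_(i < dcb) \sum_(j < dc)
     M j i *: ((delta_mx i 0 : 'cV[CC]_dcb) *t (delta_mx j 0 : 'cV[CC]_dc)).

(* Main.v *)
(* Work in the dual B of A. The element g implements S^2 in every irrep, so conjugation by
   g acts on each fusion space Hom(c, a (x) b). Contracting the theta graph in two ways
   shows that this action is an involution; hence its trace T_ab^c is an integer, and
   evaluating the products of the twisted characters Tr(g psi_a(-)) on the target
   subalgebra gives sum_c T_ab^c d_c = d_a d_b when r_a = l_b. On the other hand, for z in
   the source subalgebra, k |-> Tr_B(h |-> k S^2(h) z) is a left integral for purely
   Hopf-algebraic reasons, and it is a combination of the twisted characters with
   coefficients d_a times a scalar depending only on r_a; this yields the transposed
   identity sum_b T_ab^c d_b = d_a d_c when l_a = l_c. As T is real, pairing the two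
   identities gives d_a^2 > 0, so the denominators D_{l_a} do not vanish, and also
   D_{l_a} = D_{r_a}. Hence Lambda is one of the trace integrals above; its idempotence
   follows from the normalization, nondegeneracy from the linear independence of the
   matrix coefficients of the irreps, and the q-trace property from S^2 = Ad g. *)

Require Import Defs.
From mathcomp Require Import all_boot all_algebra.
From mathcomp Require Import complex mxtens ring.

Set Implicit Arguments.
Unset Strict Implicit.
Unset Printing Implicit Defensive.
Import GRing.Theory Num.Theory.
Local Open Scope ring_scope.
(* Otherwise simplification unfolds CC and its structures are no longer inferred. *)
Local Opaque CC.

(** * Sweedler calculus *)

(** No star structure or positivity is assumed, and each [d a] is only a complex square root, so
    nothing makes the denominators nonzero a priori; the only source of reality is that the action
    of [g] on fusion spaces squares to 1. Concretely, [alpha] is the matrix of that action, [alpha']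
    that of the inverse action, and the two contractions of the theta graph prove them equal. A
    second obstacle is that there may be several vacuum labels e, so a twisted trace gives a
    functional rather than a number. With beta_e(f) = Tr(b_e psi_e(f)), the trace Tr(g psi_a(-))
    restricts on the target subalgebra to d_a beta_{l_a}, and Tr(g^-1 psi_a(-)) restricts on the
    source subalgebra to d_a beta_{r_a}; the factor d_a / w_{bar a} in g is chosen so that both
    carry the same d_a. Numbers are then read off by evaluating at elements of these subalgebras
    dual to the beta_e. *)

Definition lin (U V : lmodType CC) (f : U -> V) : Prop :=
  forall k x y, f (k *: x + y) = k *: f x + f y.

Lemma sum_delta (R : nzRingType) (I : finType) (F : I -> R) i :
  \sum_k F k * (k == i)%:R = F i.
Proof.
rewrite (bigD1 i) //= eqxx mulr1 big1 ?addr0 // => k /negPf->.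
by rewrite mulr0.
Qed.

Section Linear.
Variables U V W : lmodType CC.

Lemma lin_id : lin (fun x : U => x). Proof. by []. Qed.

Lemma lin_comp (f : V -> W) (g : U -> V) :
  lin f -> lin g -> lin (fun x => f (g x)).
Proof. by move=> lf lg k x y; rewrite lg lf. Qed.

Lemma lin_scalel (f : U -> CC^o) (v : V) : lin f -> lin (fun x => f x *: v).
Proof. by move=> lf k x y; rewrite lf scalerDl scalerA. Qed.

Lemma lin_scaler (c : CC) (f : U -> V) : lin f -> lin (fun x => c *: f x).
Proof. by move=> lf k x y; rewrite lf scalerDr !scalerA mulrC. Qed.

Lemma lin_mull (f : U -> CC^o) (c : CC) : lin f -> lin (fun x => f x * c : CC^o).
Proof. by move=> lf k x y; rewrite lf mulrDl scalerAl. Qed.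

Lemma lin_mulr (c : CC) (f : U -> CC^o) : lin f -> lin (fun x => c * f x : CC^o).
Proof. by move=> lf k x y; rewrite lf mulrDr /GRing.scale /= mulrCA. Qed.

Lemma lin0 (f : U -> V) : lin f -> f 0 = 0.
Proof. by move=> lf; have := lf (-1) 0 0; rewrite scaler0 addr0 scaleN1r addNr. Qed.

Lemma linD (f : U -> V) x y : lin f -> f (x + y) = f x + f y.
Proof. by move=> lf; have := lf 1 x y; rewrite !scale1r. Qed.

Lemma linZ (f : U -> V) k x : lin f -> f (k *: x) = k *: f x.
Proof. by move=> lf; have := lf k x 0; rewrite lin0 // !addr0. Qed.

Lemma lin_sum (f : U -> V) (I : Type) (s : seq I) (P : pred I) (F : I -> U) :
  lin f -> f (\sum_(i <- s | P i) F i) = \sum_(i <- s | P i) f (F i).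
Proof.
move=> lf; elim/big_rec2: _ => [|i x y _ <-]; first exact: lin0.
exact: linD.
Qed.

Lemma lin_add (f g : U -> V) : lin f -> lin g -> lin (fun x => f x + g x).
Proof. by move=> lf lg k x y; rewrite lf lg scalerDr addrACA. Qed.

Lemma lin_bigsum (I : Type) (s : seq I) (P : pred I) (F : I -> U -> V) :
  (forall i, P i -> lin (F i)) -> lin (fun x => \sum_(i <- s | P i) F i x).
Proof.
move=> lF k x y; rewrite scaler_sumr -big_split /=.
by apply: eq_bigr => i Pi; rewrite lF.
Qed.

End Linear.

Section LinearMatrix.
Variable U : lmodType CC.

Lemma lin_mulmxl p q s (f : U -> 'M[CC]_(p, q)) (B : 'M_(q, s)) :
  lin f -> lin (fun x => f x *m B).
Proof. by move=> lf k x y; rewrite lf mulmxDl scalemxAl. Qed.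

Lemma lin_mulmxr p q s (B : 'M_(p, q)) (f : U -> 'M[CC]_(q, s)) :
  lin f -> lin (fun x => B *m f x).
Proof. by move=> lf k x y; rewrite lf mulmxDr scalemxAr. Qed.

Lemma lin_mxtrace p (f : U -> 'M[CC]_p) : lin f -> lin (fun x => \tr (f x) : CC^o).
Proof. by move=> lf k x y; rewrite lf mxtraceD mxtraceZ. Qed.

Lemma lin_coord p q (f : U -> 'M[CC]_(p, q)) i j :
  lin f -> lin (fun x => f x i j : CC^o).
Proof. by move=> lf k x y; rewrite lf !mxE. Qed.

Lemma lin_tensl p q s t (f : U -> 'M[CC]_(p, q)) (B : 'M_(s, t)) :
  lin f -> lin (fun x => f x *t B).
Proof. by move=> lf k x y; rewrite lf; apply/matrixP=> i j; rewrite !mxE mulrDl mulrA. Qed.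

Lemma lin_tensr p q s t (B : 'M_(p, q)) (f : U -> 'M[CC]_(s, t)) :
  lin f -> lin (fun x => B *t f x).
Proof. by move=> lf k x y; rewrite lf; apply/matrixP=> i j; rewrite !mxE mulrDr mulrCA. Qed.

End LinearMatrix.

Definition bilin (U V W : lmodType CC) (f : U -> V -> W) : Prop :=
  (forall y, lin (fun x => f x y)) /\ (forall x, lin (f x)).

Definition trilin (U1 U2 U3 V : lmodType CC) (f : U1 -> U2 -> U3 -> V) : Prop :=
  (forall b c, lin (fun a => f a b c)) /\
  (forall a c, lin (fun b => f a b c)) /\ (forall a b, lin (f a b)).

Section Basis.
Variable n : nat.
Implicit Types f x y : 'rV[CC]_n.

Lemma row_Abas x : x = \sum_i x 0 i *: Abas i.
Proof. exact: row_sum_delta. Qed.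

Lemma lin_basis (V : lmodType CC) (f : 'rV[CC]_n -> V) x :
  lin f -> f x = \sum_i x 0 i *: f (Abas i).
Proof.
by move=> lf; rewrite {1}[x]row_Abas lin_sum //; apply: eq_bigr => i _; rewrite linZ.
Qed.

Lemma AbasE (i j : 'I_n) : Abas i 0 j = (i == j)%:R.
Proof. by rewrite !mxE eqxx eq_sym. Qed.

Lemma sum_Abasl (V : lmodType CC) (i : 'I_n) (F : 'I_n -> V) :
  \sum_j Abas i 0 j *: F j = F i.
Proof.
rewrite (bigD1 i) //= big1 ?addr0 => [|j ji]; first by rewrite AbasE eqxx scale1r.
by rewrite AbasE eq_sym (negPf ji) scale0r.
Qed.

Lemma AevC f x : Aev f x = Aev x f.
Proof. by apply: eq_bigr => i _; rewrite mulrC. Qed.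

Lemma Aev_lin f : lin (Aev f : _ -> CC^o).
Proof.
move=> k x y; rewrite /Aev /GRing.scale /= mulr_sumr -big_split /=.
by apply: eq_bigr => i _; rewrite !mxE mulrDr mulrCA.
Qed.

Lemma lin_Aevr (U : lmodType CC) f (h : U -> 'rV[CC]_n) :
  lin h -> lin (fun u => Aev f (h u) : CC^o).
Proof. by move=> lh; apply: (lin_comp (Aev_lin f) lh). Qed.

Lemma lin_Aevl (U : lmodType CC) (h : U -> 'rV[CC]_n) x :
  lin h -> lin (fun u => Aev (h u) x : CC^o).
Proof. by move=> lh k u v; rewrite !(AevC _ x); apply: lin_Aevr. Qed.

Lemma Aev_basl i x : Aev (Abas i) x = x 0 i.
Proof. exact: (sum_Abasl i (fun j => x 0 j : CC^o)). Qed.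

Lemma Aev_basr f i : Aev f (Abas i) = f 0 i.
Proof. by rewrite AevC Aev_basl. Qed.

Lemma Aev_inj f h : (forall x, Aev f x = Aev h x) -> f = h.
Proof. by move=> fh; apply/rowP=> i; rewrite -!Aev_basr fh. Qed.

End Basis.

Section Sweedler.
Variables (n : nat) (H : WHAdata n).
Local Notation "x ** y" := (Amul H x y) (at level 40, left associativity).
Local Notation S := (Aanti H).
Local Notation eps := (Aeps H).
Local Notation one := (wone H).

Lemma Amul_bilin : bilin (Amul H).
Proof.
split=> [y|x] k a b; rewrite /Amul scaler_sumr -big_split /=; apply: eq_bigr => i _;
  rewrite scaler_sumr -big_split /=; apply: eq_bigr => j _; rewrite !mxE.
  by rewrite mulrDl scalerDl -mulrA scalerA.
by rewrite mulrDr scalerDl mulrCA scalerA.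
Qed.

Lemma ADelta_lin : lin (ADelta H).
Proof.
move=> k x y; rewrite /ADelta scaler_sumr -big_split /=.
by apply: eq_bigr => i _; rewrite !mxE scalerDl scalerA.
Qed.

Lemma ADelta_bas i : ADelta H (Abas i) = wcomul H i.
Proof. exact: sum_Abasl. Qed.

Section Sw.
Variable V : lmodType CC.
Implicit Types phi : 'rV[CC]_n -> 'rV[CC]_n -> V.

(* phi(x_(1), x_(2)) in Sweedler notation. *)
Definition sw x phi : V := \sum_i \sum_j ADelta H x i j *: phi (Abas i) (Abas j).

Lemma eq_sw x phi phi' : (forall a b, phi a b = phi' a b) -> sw x phi = sw x phi'.
Proof. by move=> e; apply: eq_bigr => i _; apply: eq_bigr => j _; rewrite e. Qed.

Lemma sw_lin phi : lin (fun x => sw x phi).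
Proof.
move=> k x y; rewrite /sw scaler_sumr -big_split /=; apply: eq_bigr => i _.
rewrite scaler_sumr -big_split /=; apply: eq_bigr => j _.
by rewrite ADelta_lin !mxE scalerDl scalerA.
Qed.

End Sw.

Lemma lin_mulL (U : lmodType CC) (f : U -> 'rV[CC]_n) c : lin f -> lin (fun x => f x ** c).
Proof. by move=> lf k x y; rewrite lf (Amul_bilin.1 c). Qed.

Lemma lin_mulR (U : lmodType CC) c (f : U -> 'rV[CC]_n) : lin f -> lin (fun x => c ** f x).
Proof. by move=> lf k x y; rewrite lf (Amul_bilin.2 c). Qed.

Lemma lin_S (U : lmodType CC) (f : U -> 'rV[CC]_n) : lin f -> lin (fun x => S (f x)).
Proof. exact: lin_mulmxl. Qed.

Lemma lin_eps (U : lmodType CC) (f : U -> 'rV[CC]_n) : lin f -> lin (fun x => eps (f x) : CC^o).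
Proof. exact: lin_Aevr. Qed.

Lemma lin_sw (U V : lmodType CC) (f : U -> 'rV[CC]_n) (phi : _ -> _ -> V) :
  lin f -> lin (fun x => sw (f x) phi).
Proof. by move=> lf k x y; rewrite lf sw_lin. Qed.

Lemma lin_in_sw (U V : lmodType CC) x (phi : U -> 'rV[CC]_n -> 'rV[CC]_n -> V) :
  (forall a b, lin (fun u => phi u a b)) -> lin (fun u => sw x (phi u)).
Proof.
by move=> lp; apply: lin_bigsum => i _; apply: lin_bigsum => j _; apply: lin_scaler.
Qed.

Lemma sw_app (V W : lmodType CC) (F : V -> W) x phi :
  lin F -> F (sw x phi) = sw x (fun a b => F (phi a b)).
Proof.
move=> lF; rewrite /sw lin_sum //; apply: eq_bigr => i _; rewrite lin_sum //.
by apply: eq_bigr => j _; rewrite linZ.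
Qed.

Lemma ADelta_sw x i j : ADelta H x i j = sw x (fun a b => a 0 i * b 0 j : CC^o).
Proof.
transitivity (\sum_k (\sum_l ADelta H x k l * (l == j)%:R) * (k == i)%:R : CC).
  by rewrite (sum_delta (fun k => \sum_l ADelta H x k l * (l == j)%:R)) sum_delta.
apply: eq_bigr => k _; rewrite mulr_suml; apply: eq_bigr => l _.
by rewrite !AbasE /GRing.scale /= -mulrA [X in _ * X]mulrC.
Qed.

Lemma bilin_coord (V : lmodType CC) (phi : 'rV[CC]_n -> 'rV[CC]_n -> V) a b :
  bilin phi -> phi a b = \sum_i \sum_j (a 0 i * b 0 j) *: phi (Abas i) (Abas j).
Proof.
move=> [l1 l2]; rewrite (lin_basis _ (l1 b)); apply: eq_bigr => i _.
by rewrite (lin_basis _ (l2 _)) scaler_sumr; apply: eq_bigr => j _; rewrite scalerA.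
Qed.

(** The target counital map and, next, the source one: weak substitutes for x |-> eps(x) 1. The
    antipode axioms identify them with x_(1) S(x_(2)) and S(x_(1)) x_(2). *)
Definition epst x : 'rV[CC]_n := sw one (fun a b => eps (a ** x) *: b).
Definition epss x : 'rV[CC]_n := sw one (fun a b => eps (x ** b) *: a).

Lemma epst_lin : lin epst.
Proof.
apply: lin_in_sw => a b; apply: lin_scalel; apply: lin_eps; apply: lin_mulR; exact: lin_id.
Qed.

Lemma epss_lin : lin epss.
Proof.
apply: lin_in_sw => a b; apply: lin_scalel; apply: lin_eps; apply: lin_mulL; exact: lin_id.
Qed.

Lemma lin_epst (U : lmodType CC) (f : U -> 'rV[CC]_n) : lin f -> lin (fun u => epst (f u)).
Proof. exact: lin_comp epst_lin. Qed.

Lemma lin_epss (U : lmodType CC) (f : U -> 'rV[CC]_n) : lin f -> lin (fun u => epss (f u)).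
Proof. exact: lin_comp epss_lin. Qed.

End Sweedler.

(** Two algebras are allowed because pairings mix Sweedler sums over A with Sweedler sums over its
    dual. *)
Lemma sw_exch n n' (H : WHAdata n) (H' : WHAdata n') (V : lmodType CC) x y (phi : _ -> _ -> _ -> _ -> V) :
  sw H x (fun a b => sw H' y (fun c d => phi a b c d))
  = sw H' y (fun c d => sw H x (fun a b => phi a b c d)).
Proof.
rewrite /sw.
under eq_bigr do under eq_bigr do (rewrite scaler_sumr; under eq_bigr do rewrite scaler_sumr).
under [RHS]eq_bigr do under eq_bigr do (rewrite scaler_sumr; under eq_bigr do rewrite scaler_sumr).
under eq_bigr => i _ do rewrite exchange_big.
rewrite exchange_big; apply: eq_bigr => k _.
under eq_bigr do rewrite exchange_big.
rewrite exchange_big; apply: eq_bigr => l _.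
by apply: eq_bigr => i _; apply: eq_bigr => j _; rewrite !scalerA mulrC.
Qed.


Lemma bilin_lin1 (U V W X : lmodType CC) (phi : V -> W -> X) (f : U -> V) w :
  bilin phi -> lin f -> lin (fun u => phi (f u) w).
Proof. by move=> [l _]; apply: lin_comp (l w). Qed.

Lemma bilin_lin2 (U V W X : lmodType CC) (phi : V -> W -> X) v (f : U -> W) :
  bilin phi -> lin f -> lin (fun u => phi v (f u)).
Proof. by move=> [_ l]; apply: lin_comp (l v). Qed.

(** Linearity is a predicate on plain functions so that anonymous Sweedler expressions qualify; it
    is proved by recursion on the head symbol. In a product, the branch that unifies is the one
    whose other factor is free of the variable. *)
Ltac lin1 := cbv beta; lazymatch goal with
  | |- lin (fun x => x) => exact: lin_id
  | |- lin (fun x => Amul _ (@?f x) (@?g x)) => first [apply: lin_mulL | apply: lin_mulR]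
  | |- lin (fun x => Aanti _ (@?f x)) => apply: lin_S
  | |- lin (fun x => Aeps _ (@?f x)) => apply: lin_eps
  | |- lin (fun x => epst _ (@?f x)) => apply: lin_epst
  | |- lin (fun x => epss _ (@?f x)) => apply: lin_epss
  | |- lin (fun x => sw _ (@?f x) (@?g x)) => first [apply: lin_in_sw => ? ? | apply: lin_sw]
  | |- lin (fun x => GRing.mul (@?f x) (@?g x)) => first [apply: lin_mull | apply: lin_mulr]
  | |- lin (fun x => GRing.scale (@?f x) (@?g x)) => first [apply: lin_scaler | apply: lin_scalel]
  | |- lin (fun x => GRing.add (@?f x) (@?g x)) => apply: lin_add
  | |- lin (fun x => mxtrace (@?f x)) => apply: lin_mxtrace
  | |- lin (fun x => mulmx (@?f x) (@?g x)) => first [apply: lin_mulmxl | apply: lin_mulmxr]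
  | |- lin (fun x => tensmx (@?f x) (@?g x)) => first [apply: lin_tensl | apply: lin_tensr]
  | |- lin (fun x => fun_of_matrix (@?f x) _ _) => apply: lin_coord
  | |- lin (fun x => Aev (@?f x) (@?g x)) => first [apply: lin_Aevr | apply: lin_Aevl]
  | |- lin (fun x => bigop.body _ _ (@?f x)) => apply: lin_bigsum => ? ?
  | |- lin (Amul _ _) => apply: (Amul_bilin _).2
  | |- lin (Aanti _) => apply: lin_S
  | |- lin (Aeps _) => apply: lin_eps
  | |- lin (epst _) => apply: epst_lin
  | |- lin (epss _) => apply: epss_lin
  | |- lin (mulmx _) => apply: lin_mulmxr
  | |- lin (tensmx _) => apply: lin_tensr
  | |- lin (GRing.scale _) => apply: lin_scaler
  | |- lin (GRing.mul _) => apply: lin_mulr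
  | |- lin (Aev _) => apply: Aev_lin
  | |- lin (ADelta _) => apply: ADelta_lin
  | |- _ => first [assumption | apply: bilin_lin1; [assumption|] | apply: bilin_lin2; [assumption|]
                   | solve [auto] ]
  end.
Ltac linear := repeat lin1.
Ltac bilinear := split=> ?; linear.
Ltac trilinear := split; [|split]; move=> ? ?; linear.

(* A form of [is_weak_hopf] in which the axioms are visibly self-dual. *)
Record whopf (n : nat) (H : WHAdata n) : Prop := WHopf {
  wh_mulA : forall x y z, Amul H (Amul H x y) z = Amul H x (Amul H y z);
  wh_mul1l : forall x, Amul H (wone H) x = x;
  wh_mul1r : forall x, Amul H x (wone H) = x;
  wh_coassoc : forall x i j k,
    \sum_m ADelta H x m k * wcomul H m i j = \sum_m ADelta H x i m * wcomul H m j k;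
  wh_counitl : forall x, weps H *m ADelta H x = x;
  wh_counitr : forall x, ADelta H x *m (weps H)^T = x^T;
  wh_DeltaM : forall x y i j, ADelta H (Amul H x y) i j
    = sw H x (fun a b => sw H y (fun c d => Amul H a c 0 i * Amul H b d 0 j : CC^o));
  wh_Delta2l : forall i j k, \sum_m ADelta H (wone H) m k * wcomul H m i j
    = sw H (wone H) (fun a b => sw H (wone H) (fun c d =>
        a 0 i * Amul H b c 0 j * d 0 k : CC^o));
  wh_Delta2r : forall i j k, \sum_m ADelta H (wone H) m k * wcomul H m i j
    = sw H (wone H) (fun a b => sw H (wone H) (fun c d =>
        a 0 i * Amul H c b 0 j * d 0 k : CC^o));
  wh_epsl : forall x y z, Aeps H (Amul H (Amul H x y) z)
    = sw H y (fun a b => Aeps H (Amul H x a) * Aeps H (Amul H b z) : CC^o);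
  wh_epsr : forall x y z, Aeps H (Amul H (Amul H x y) z)
    = sw H y (fun a b => Aeps H (Amul H x b) * Aeps H (Amul H a z) : CC^o);
  wh_Sl : forall x, sw H x (fun a b => Amul H (Aanti H a) b)
    = sw H (wone H) (fun a b => Aeps H (Amul H x b) *: a);
  wh_Sr : forall x, sw H x (fun a b => Amul H a (Aanti H b))
    = sw H (wone H) (fun a b => Aeps H (Amul H a x) *: b);
  wh_S3 : forall x, sw H x (fun a b => sw H a (fun c d =>
      Amul H (Amul H (Aanti H c) d) (Aanti H b))) = Aanti H x;
  wh_Sunit : wS H \in unitmx
}.

(** * From the coordinate axioms to Sweedler form *)

Section Monomials.
Variables (R : comNzRingType) (a b c d e f g : R).

Lemma mulr7_rearrange1 :
  a * b * (c * d) * (e * f * g) = a * (d * (c * e * f * (b * g))).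
Proof. by ring. Qed.

Lemma mulr7_rearrange2 :
  a * b * (c * d) * (e * f * g) = b * (c * (a * e * f * (d * g))).
Proof. by ring. Qed.

Lemma mulr6_rearrange : a * b * c * (d * e) = c * (a * d * (b * e)).
Proof. by ring. Qed.

End Monomials.

Section Convert.
Variables (n : nat) (H : WHAdata n).

Lemma At3mulE (T U : AT3 n) i j k :
  At3mul H T U (i, j, k) = \sum_p \sum_q T p * U q *
    (Amul H (Abas p.1.1) (Abas q.1.1) 0 i * Amul H (Abas p.1.2) (Abas q.1.2) 0 j
     * Amul H (Abas p.2) (Abas q.2) 0 k).
Proof.
rewrite /At3mul sum_ffunE; apply: eq_bigr => p _.
by rewrite sum_ffunE; apply: eq_bigr => q _; rewrite !ffunE.
Qed.

Lemma D1_1E p : D1_1 H p = ADelta H (wone H) p.1.1 p.1.2 * wone H 0 p.2.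
Proof.
rewrite /D1_1 sum_ffunE ADelta_sw /sw mulr_suml; apply: eq_bigr => i _.
rewrite sum_ffunE mulr_suml; apply: eq_bigr => j _.
by rewrite !ffunE /GRing.scale /= !mulrA.
Qed.

Lemma one_D1E p : one_D1 H p = wone H 0 p.1.1 * ADelta H (wone H) p.1.2 p.2.
Proof.
rewrite /one_D1 sum_ffunE ADelta_sw /sw mulr_sumr; apply: eq_bigr => i _.
rewrite sum_ffunE mulr_sumr; apply: eq_bigr => j _.
by rewrite !ffunE /GRing.scale /= -!mulrA mulrCA.
Qed.

Lemma sum_triple (F : 'I_n * 'I_n * 'I_n -> CC) :
  \sum_p F p = \sum_i \sum_j \sum_k F (i, j, k).
Proof.
transitivity (\sum_q \sum_k F (q, k)).
  by rewrite pair_bigA; apply: eq_bigr => -[].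
by rewrite [RHS]pair_bigA; apply: eq_bigr => -[].
Qed.

Lemma exchange_big4 (F : 'I_n -> 'I_n -> 'I_n -> 'I_n -> CC) :
  \sum_a \sum_b \sum_c \sum_d F a b c d = \sum_c \sum_d \sum_b \sum_a F a b c d.
Proof.
rewrite exchange_big; under eq_bigr do rewrite exchange_big.
rewrite exchange_big; apply: eq_bigr => c _.
by under eq_bigr do rewrite exchange_big; rewrite exchange_big.
Qed.

Lemma exchange_big3 (F : 'I_n -> 'I_n -> 'I_n -> CC) :
  \sum_a \sum_b \sum_c F a b c = \sum_b \sum_c \sum_a F a b c.
Proof. by rewrite exchange_big; apply: eq_bigr => b _; rewrite exchange_big. Qed.

Hypothesis mul1l : forall x, Amul H (wone H) x = x.
Hypothesis mul1r : forall x, Amul H x (wone H) = x.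

Lemma coord_mul1l q k :
  (Abas q : 'rV[CC]_n) 0 k = \sum_p wone H 0 p * Amul H (Abas p) (Abas q) 0 k.
Proof.
rewrite -{1}[Abas q]mul1l.
exact: (@lin_basis _ CC^o (fun x => Amul H x (Abas q) 0 k) _ (lin_coord _ _ (lin_mulL _ _ (@lin_id _)))).
Qed.

Lemma coord_mul1r q k :
  (Abas q : 'rV[CC]_n) 0 k = \sum_p wone H 0 p * Amul H (Abas q) (Abas p) 0 k.
Proof.
rewrite -{1}[Abas q]mul1r.
exact: (@lin_basis _ CC^o (fun x => Amul H (Abas q) x 0 k) _ (lin_coord _ _ (lin_mulR _ _ (@lin_id _)))).
Qed.

(** The outer legs are multiplied by the unit, so the coordinates of the outer basis vectors are
    expanded with [coord_mul1r] and [coord_mul1l]; both sides then become sums over the same six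
    indices. *)
Lemma At3mul_D1_1_one_D1 i j k : At3mul H (D1_1 H) (one_D1 H) (i, j, k) =
  sw H (wone H) (fun a b => sw H (wone H) (fun c d =>
    a 0 i * Amul H b c 0 j * d 0 k : CC^o)).
Proof.
rewrite At3mulE sum_triple; apply: eq_bigr => p1 _; apply: eq_bigr => p2 _.
under eq_bigr do rewrite sum_triple.
rewrite exchange_big4 /sw /GRing.scale /= mulr_sumr; apply: eq_bigr => q2 _.
rewrite mulr_sumr; apply: eq_bigr => q3 _ /=.
rewrite (coord_mul1r p1) (coord_mul1l q3) !mulr_suml !mulr_sumr.
apply: eq_bigr => q1 _; rewrite mulr_sumr !mulr_sumr; apply: eq_bigr => p3 _.
rewrite D1_1E one_D1E /=; exact: (@mulr7_rearrange1 CC).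
Qed.

Lemma At3mul_one_D1_D1_1 i j k : At3mul H (one_D1 H) (D1_1 H) (i, j, k) =
  sw H (wone H) (fun a b => sw H (wone H) (fun c d =>
    a 0 i * Amul H c b 0 j * d 0 k : CC^o)).
Proof.
rewrite sw_exch At3mulE sum_triple.
rewrite exchange_big3; apply: eq_bigr => p2 _; apply: eq_bigr => p3 _.
under eq_bigr do rewrite sum_triple.
rewrite exchange_big3 /sw /GRing.scale /= mulr_sumr; apply: eq_bigr => q1 _.
rewrite mulr_sumr; apply: eq_bigr => q2 _.
rewrite (coord_mul1l q1) (coord_mul1r p3) !mulr_suml !mulr_sumr.
apply: eq_bigr => p1 _; rewrite mulr_sumr !mulr_sumr; apply: eq_bigr => q3 _.
rewrite D1_1E one_D1E /=; exact: (@mulr7_rearrange2 CC).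
Qed.

Lemma exchange_big4_rev (V : nmodType) (F : 'I_n -> 'I_n -> 'I_n -> 'I_n -> V) :
  \sum_a \sum_b \sum_c \sum_d F a b c d = \sum_d \sum_c \sum_a \sum_b F a b c d.
Proof.
under eq_bigr do under eq_bigr do rewrite exchange_big.
under eq_bigr do rewrite exchange_big.
rewrite exchange_big; apply: eq_bigr => d _.
under eq_bigr do rewrite exchange_big.
by rewrite exchange_big.
Qed.

Lemma Delta2lE x i j k :
  Delta2l H x (i, j, k) = \sum_m ADelta H x m k * wcomul H m i j.
Proof. by rewrite ffunE. Qed.

Lemma Delta2l_sw x (F : 'I_n * 'I_n * 'I_n -> 'rV[CC]_n) (phi : 'rV[CC]_n -> 'rV[CC]_n -> 'rV[CC]_n -> 'rV[CC]_n) :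
  (forall p, F p = phi (Abas p.1.1) (Abas p.1.2) (Abas p.2)) ->
  \sum_p Delta2l H x p *: F p = sw H x (fun a b => sw H a (fun c d => phi c d b)).
Proof.
move=> FE.
have -> : \sum_p Delta2l H x p *: F p = \sum_i \sum_j \sum_k Delta2l H x (i, j, k) *: F (i, j, k).
  transitivity (\sum_q \sum_k Delta2l H x (q, k) *: F (q, k)).
    by rewrite pair_bigA; apply: eq_bigr => -[].
  by rewrite [RHS]pair_bigA; apply: eq_bigr => -[].
rewrite /sw.
under eq_bigr do under eq_bigr do under eq_bigr do rewrite ffunE FE scaler_suml /=.
rewrite exchange_big4_rev; apply: eq_bigr => m _; apply: eq_bigr => k _.
rewrite scaler_sumr; apply: eq_bigr => i _; rewrite scaler_sumr; apply: eq_bigr => j _.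
by rewrite ADelta_bas scalerA.
Qed.

End Convert.

Lemma is_weak_hopf_whopf (n : nat) (H : WHAdata n) : is_weak_hopf H -> whopf H.
Proof.
case=> [mA [m1 [cA [cu [DM [[D2l D2r] [ep [an Su]]]]]]]].
have m1l x : Amul H (wone H) x = x by case: (m1 x).
have m1r x : Amul H x (wone H) = x by case: (m1 x).
split=> //.
- move=> x i j k; have /ffunP/(_ (i, j, k)) := cA x; by rewrite !ffunE.
- by move=> x; case: (cu x).
- by move=> x; case: (cu x) => _ /(congr1 trmx); rewrite trmxK.
- move=> x y i j; rewrite DM /Atmul /sw summxE; apply: eq_bigr => a _.
  rewrite summxE; apply: eq_bigr => b _; rewrite summxE scaler_sumr.
  apply: eq_bigr => c _; rewrite summxE scaler_sumr; apply: eq_bigr => d _.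
  by rewrite mxE [X in _ * X]mxE big_ord1 mxE /GRing.scale /= -!mulrA.
- move=> i j k; rewrite -Delta2lE D2r; exact: At3mul_D1_1_one_D1.
- move=> i j k; rewrite -Delta2lE D2l; exact: At3mul_one_D1_D1_1.
- move=> x y z; rewrite (ep x y z).1 /sw; apply: eq_bigr => i _; apply: eq_bigr => j _.
  by rewrite -mulrA.
- move=> x y z; rewrite (ep x y z).2 /sw; apply: eq_bigr => i _; apply: eq_bigr => j _.
  by rewrite -mulrA.
- move=> x; rewrite /sw; case: (an x) => -> _ _; apply: eq_bigr => i _; apply: eq_bigr => j _.
  by rewrite scalerA.
- move=> x; rewrite /sw; case: (an x) => _ -> _; apply: eq_bigr => i _; apply: eq_bigr => j _.
  by rewrite scalerA.
- move=> x; case: (an x) => _ _ <-; symmetry.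
  exact: (@Delta2l_sw _ H x _ (fun c d b => Amul H (Amul H (Aanti H c) d) (Aanti H b)) (fun p => erefl)).
Qed.

(** * Weak Hopf algebra identities *)

Lemma sw_sum n (H : WHAdata n) (V : lmodType CC) (I : Type) (s : seq I) x (F : I -> _ -> _ -> V) :
  sw H x (fun a b => \sum_(i <- s) F i a b) = \sum_(i <- s) sw H x (F i).
Proof.
rewrite /sw [RHS]exchange_big; apply: eq_bigr => i _.
by rewrite [RHS]exchange_big; apply: eq_bigr => j _; rewrite scaler_sumr.
Qed.

Lemma sw_scale n (H : WHAdata n) (V : lmodType CC) x (F : _ -> _ -> CC^o) (v : V) :
  sw H x (fun a b => F a b *: v) = sw H x F *: v.
Proof. by rewrite (@sw_app _ _ CC^o _ (fun c : CC => c *: v)) //; linear. Qed.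

Lemma sw_scaler n (H : WHAdata n) (V : lmodType CC) x (c : CC) (F : _ -> _ -> V) :
  sw H x (fun a b => c *: F a b) = c *: sw H x F.
Proof. by rewrite (@sw_app _ _ _ _ (fun v => c *: v)) //; linear. Qed.

Section Theory.
Variables (n : nat) (H : WHAdata n).
Hypothesis wh : whopf H.
Local Notation "x ** y" := (Amul H x y) (at level 40, left associativity).
Local Notation S := (Aanti H).
Local Notation eps := (Aeps H).
Local Notation one := (wone H).
Local Notation "\sw_ ( a , b <- x ) E" := (sw H x (fun a b => E))
  (at level 36, a name, b name, E at level 36).

Let mulA := wh_mulA wh.

Lemma trilin_coord (V : lmodType CC) (phi : _ -> _ -> _ -> V) (a b c : 'rV[CC]_n) :
  trilin phi -> phi a b c = \sum_i \sum_j \sum_k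
    (a 0 i * b 0 j * c 0 k) *: phi (Abas i) (Abas j) (Abas k).
Proof.
move=> [l1 [l2 l3]]; rewrite (lin_basis _ (l1 b c)); apply: eq_bigr => i _.
rewrite (lin_basis _ (l2 _ c)) scaler_sumr; apply: eq_bigr => j _.
by rewrite (lin_basis _ (l3 _ _)) !scaler_sumr; apply: eq_bigr => k _; rewrite !scalerA.
Qed.

Lemma sw3_coord (V : lmodType CC) x (phi : _ -> _ -> _ -> V) :
  \sw_(a, b <- x) \sw_(c, d <- a) phi c d b
  = \sum_i \sum_j \sum_k (\sum_m ADelta H x m k * wcomul H m i j)
      *: phi (Abas i) (Abas j) (Abas k).
Proof.
under [RHS]eq_bigr do under eq_bigr do under eq_bigr do rewrite scaler_suml.
rewrite exchange_big4_rev; apply: eq_bigr => m _; apply: eq_bigr => k _.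
rewrite scaler_sumr; apply: eq_bigr => i _; rewrite scaler_sumr; apply: eq_bigr => j _.
by rewrite scalerA ADelta_bas.
Qed.

Lemma sw_coassoc (V : lmodType CC) x (phi : _ -> _ -> _ -> V) :
  \sw_(a, b <- x) \sw_(c, d <- a) phi c d b = \sw_(a, b <- x) \sw_(c, d <- b) phi a c d.
Proof.
rewrite sw3_coord; apply: eq_bigr => i _.
under eq_bigr do under eq_bigr do rewrite wh_coassoc // scaler_suml.
under eq_bigr do rewrite exchange_big /=.
rewrite exchange_big; apply: eq_bigr => m _; rewrite scaler_sumr; apply: eq_bigr => j _.
by rewrite scaler_sumr; apply: eq_bigr => k _; rewrite scalerA ADelta_bas.
Qed.

Lemma sw_counitl (V : lmodType CC) x (phi : _ -> V) :
  lin phi -> \sw_(a, b <- x) (eps a *: phi b) = phi x.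
Proof.
move=> lp; rewrite [in RHS](lin_basis _ lp) -{2}(wh_counitl wh x).
rewrite /sw exchange_big; apply: eq_bigr => j _.
by rewrite mxE scaler_suml; apply: eq_bigr => i _; rewrite scalerA mulrC /Aeps Aev_basr.
Qed.

Lemma sw_counitr (V : lmodType CC) x (phi : _ -> V) :
  lin phi -> \sw_(a, b <- x) (eps b *: phi a) = phi x.
Proof.
move=> lp; rewrite [in RHS](lin_basis _ lp) -{2}[x]trmxK -(wh_counitr wh x).
apply: eq_bigr => j _.
rewrite !mxE scaler_suml; apply: eq_bigr => i _.
by rewrite scalerA mxE /Aeps Aev_basr.
Qed.

Lemma sw_mul (V : lmodType CC) x y (phi : _ -> _ -> V) : bilin phi ->
  sw H (x ** y) phi = \sw_(a, b <- x) \sw_(c, d <- y) phi (a ** c) (b ** d).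
Proof.
move=> bp.
under [RHS]eq_sw => a b do under eq_sw => c d do rewrite (bilin_coord _ _ bp).
under [RHS]eq_sw => a b do
  (rewrite sw_sum; under eq_bigr do rewrite sw_sum; under eq_bigr do under eq_bigr do rewrite sw_scale).
rewrite sw_sum; apply: eq_bigr => i _; rewrite sw_sum; apply: eq_bigr => j _.
by rewrite sw_scale wh_DeltaM.
Qed.

(** [F] stands for multiplication in either order: the two axioms on the double coproduct of 1
    differ only in the middle leg. *)
Lemma sw_one3 (V : lmodType CC) (phi : _ -> _ -> _ -> V) (F : _ -> _ -> 'rV[CC]_n) :
  trilin phi ->
  (forall i j k, \sum_m ADelta H one m k * wcomul H m i j
    = \sw_(a, b <- one) \sw_(c, d <- one) (a 0 i * F b c 0 j * d 0 k : CC^o)) ->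
  \sw_(a, b <- one) \sw_(c, d <- a) phi c d b
  = \sw_(a, b <- one) \sw_(c, d <- one) phi a (F b c) d.
Proof.
move=> tp FE; rewrite sw3_coord.
under [RHS]eq_sw => a b do under eq_sw => c d do rewrite (trilin_coord _ _ _ tp).
under [RHS]eq_sw => a b do
  (rewrite sw_sum; under eq_bigr do (rewrite sw_sum; under eq_bigr do
   (rewrite sw_sum; under eq_bigr do rewrite sw_scale))).
rewrite sw_sum; apply: eq_bigr => i _; rewrite sw_sum; apply: eq_bigr => j _.
rewrite sw_sum; apply: eq_bigr => k _.
by rewrite sw_scale FE.
Qed.

Lemma sw_one3l (V : lmodType CC) (phi : _ -> _ -> _ -> V) : trilin phi ->
  \sw_(a, b <- one) \sw_(c, d <- a) phi c d b
  = \sw_(a, b <- one) \sw_(c, d <- one) phi a (b ** c) d.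
Proof. by move=> tp; apply: sw_one3 => //; apply: wh_Delta2l. Qed.

Lemma sw_one3r (V : lmodType CC) (phi : _ -> _ -> _ -> V) : trilin phi ->
  \sw_(a, b <- one) \sw_(c, d <- a) phi c d b
  = \sw_(a, b <- one) \sw_(c, d <- one) phi a (c ** b) d.
Proof.
by move=> tp; apply: (@sw_one3 _ _ (fun b c => c ** b)) => //; apply: wh_Delta2r.
Qed.

Lemma sw_mul1l (V : lmodType CC) x (phi : _ -> _ -> V) : bilin phi ->
  \sw_(a, b <- x) \sw_(c, d <- one) phi (c ** a) (d ** b) = sw H x phi.
Proof. by move=> bp; rewrite sw_exch -sw_mul // wh_mul1l. Qed.

Lemma sw_mul1r (V : lmodType CC) x (phi : _ -> _ -> V) : bilin phi ->
  \sw_(a, b <- x) \sw_(c, d <- one) phi (a ** c) (b ** d) = sw H x phi.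
Proof. by move=> bp; rewrite -sw_mul // wh_mul1r. Qed.

Lemma epstE x : epst H x = \sw_(a, b <- x) (a ** S b).
Proof. by rewrite wh_Sr. Qed.
Lemma epssE x : epss H x = \sw_(a, b <- x) (S a ** b).
Proof. by rewrite wh_Sl. Qed.

End Theory.

(** * Counital maps and antimultiplicativity of the antipode *)

Section Identities.
Variables (n : nat) (H : WHAdata n).
Hypothesis wh : whopf H.
Local Notation "x ** y" := (Amul H x y) (at level 40, left associativity).
Local Notation S := (Aanti H).
Local Notation eps := (Aeps H).
Local Notation one := (wone H).
Local Notation epst := (epst H).
Local Notation epss := (epss H).
Local Notation "\sw_ ( a , b <- x ) E" := (sw H x (fun a b => E))
  (at level 36, a name, b name, E at level 36).

Let mulA := wh_mulA wh.

(** Delta(x) = Delta(1) Delta(x) gives 1_(1) x_(1) (x) eps(1'_(1) 1_(2) x_(2)) 1'_(2); the two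
    copies of 1 fuse into the double coproduct of 1, and the counit axiom applied to 1_(1) x removes
    eps. *)
Lemma sw_epstr (V : lmodType CC) x (phi : _ -> _ -> V) : bilin phi ->
  \sw_(a, b <- x) phi a (epst b) = \sw_(a, b <- one) phi (a ** x) b.
Proof.
move=> bp.
transitivity (\sw_(p, q <- x) \sw_(a, b <- one)
    (\sw_(c, d <- one) (eps (c ** (b ** q)) *: phi (a ** p) d))).
  rewrite (sw_mul1l wh _ (phi := fun u v => \sw_(c, d <- one) (eps (c ** v) *: phi u d))).
    by apply: eq_sw => a b; rewrite /epst (sw_app _ (F := phi a)) //; first apply: eq_sw => c d; rewrite ?linZ //; apply bp.
  by bilinear.
transitivity (\sw_(p, q <- x) \sw_(a, b <- one) \sw_(c, d <- a)
    (eps (d ** q) *: phi (c ** p) b)).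
  apply: eq_sw => p q; rewrite (sw_one3r wh (phi := fun c d b => eps (d ** q) *: phi (c ** p) b)); last by trilinear.
  by apply: eq_sw => a b; apply: eq_sw => c d; rewrite mulA.
rewrite sw_exch; apply: eq_sw => a b.
rewrite -[RHS](sw_counitr wh _ (phi := fun u => phi u b)); last by linear.
rewrite (sw_mul wh); last by bilinear.
by rewrite sw_exch.
Qed.

Lemma sw_epssl (V : lmodType CC) x (phi : _ -> _ -> V) : bilin phi ->
  \sw_(a, b <- x) phi (epss a) b = \sw_(a, b <- one) phi a (x ** b).
Proof.
move=> bp.
transitivity (\sw_(p, q <- x) \sw_(c, d <- one)
    (\sw_(a, b <- one) (eps ((p ** c) ** b) *: phi a (q ** d)))).
  rewrite (sw_mul1r wh _ (phi := fun u v => \sw_(a, b <- one) (eps (u ** b) *: phi a v))).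
    by apply: eq_sw => a b; rewrite /epss (sw_app _ (F := phi^~ b)) //; first apply: eq_sw => c d; rewrite ?(linZ (f := phi^~ b)) //; apply bp.
  by bilinear.
transitivity (\sw_(p, q <- x) \sw_(a, b <- one) \sw_(c, d <- a)
    (eps (p ** d) *: phi c (q ** b))).
  apply: eq_sw => p q; rewrite (sw_one3r wh (phi := fun c d b => eps (p ** d) *: phi c (q ** b))); last by trilinear.
  by rewrite sw_exch; apply: eq_sw => a b; apply: eq_sw => c d; rewrite mulA.
transitivity (\sw_(p, q <- x) \sw_(a, b <- one) \sw_(c, d <- b)
    (eps (p ** c) *: phi a (q ** d))).
  by apply: eq_sw => p q; rewrite (sw_coassoc wh).
rewrite sw_exch; apply: eq_sw => a b.
rewrite -[RHS](sw_counitl wh _ (phi := fun u => phi a u)); last by linear.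
by rewrite (sw_mul wh); last by bilinear.
Qed.

(** After Delta(x) = Delta(1) Delta(x), weak multiplicativity splits eps(z 1_(1) x_(1)) as eps(z
    1_(1)) eps(1_(2) x_(1)), and the counit axiom recombines what remains. *)
Lemma sw_epsl (V : lmodType CC) z x (phi : _ -> V) : lin phi ->
  \sw_(a, b <- x) (eps (z ** a) *: phi b) = \sw_(a, b <- one) (eps (z ** a) *: phi (b ** x)).
Proof.
move=> lp.
transitivity (\sw_(a, b <- one) \sw_(p, q <- b) \sw_(c, d <- x)
   (eps (z ** a) *: (eps (p ** c) *: phi (q ** d)))); last first.
  apply: eq_sw => a b.
  rewrite -[in RHS](sw_counitl wh _ (phi := fun u => phi u)) //.
  rewrite (sw_mul wh); last by bilinear.
  by rewrite -sw_scaler; apply: eq_sw => p q; rewrite -sw_scaler.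
rewrite -(sw_coassoc wh _ (fun a p q => \sw_(c, d <- x)
   (eps (z ** a) *: (eps (p ** c) *: phi (q ** d))))).
transitivity (\sw_(a, b <- one) \sw_(c, d <- x) (eps (z ** (a ** c)) *: phi (b ** d))).
  rewrite -(sw_mul wh _ _ (phi := fun u v => eps (z ** u) *: phi v)).
    by rewrite wh_mul1l.
  by bilinear.
apply: eq_sw => a b; rewrite sw_exch; apply: eq_sw => c d.
rewrite -mulA (wh_epsl wh) -sw_scale; apply: eq_sw => p q.
by rewrite scalerA.
Qed.

Lemma sw_epsr (V : lmodType CC) z x (phi : _ -> V) : lin phi ->
  \sw_(a, b <- x) (eps (b ** z) *: phi a) = \sw_(a, b <- one) (eps (b ** z) *: phi (x ** a)).
Proof.
move=> lp.
transitivity (\sw_(a, b <- one) \sw_(p, q <- a) \sw_(c, d <- x)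
   (eps (b ** z) *: (eps (d ** q) *: phi (c ** p)))); last first.
  apply: eq_sw => a b.
  rewrite -[in RHS](sw_counitr wh _ (phi := fun u => phi u)) //.
  rewrite (sw_mul wh); last by bilinear.
  by rewrite sw_exch -sw_scaler; apply: eq_sw => p q; rewrite -sw_scaler.
rewrite (sw_coassoc wh _ (fun p q b => \sw_(c, d <- x)
   (eps (b ** z) *: (eps (d ** q) *: phi (c ** p))))).
transitivity (\sw_(a, b <- one) \sw_(c, d <- x) (eps (d ** b ** z) *: phi (c ** a))).
  rewrite sw_exch -(sw_mul wh _ _ (phi := fun u v => eps (v ** z) *: phi u)).
    by rewrite wh_mul1r.
  by bilinear.
apply: eq_sw => a b; rewrite sw_exch; apply: eq_sw => c d.
rewrite (wh_epsl wh) -sw_scale; apply: eq_sw => p q.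
by rewrite scalerA mulrC.
Qed.

Lemma S_epss x : S x = \sw_(a, b <- x) (epss a ** S b).
Proof.
rewrite -(wh_S3 wh); apply: eq_sw => a b; rewrite (epssE wh).
by rewrite (sw_app _ (F := fun u => u ** S b)) //; linear.
Qed.

Lemma S_epst x : S x = \sw_(a, b <- x) (S a ** epst b).
Proof.
rewrite -(wh_S3 wh) (sw_coassoc wh _ (fun c d b => S c ** d ** S b)).
apply: eq_sw => a b; rewrite (epstE wh) (sw_app _ (F := fun u => S a ** u)); last by linear.
by apply: eq_sw => c d; rewrite mulA.
Qed.

(** In S = eps_s * S (convolution), [sw_epssl] trades the source map for a second copy of 1; fusing
    the two copies leaves a_(1) S(a_(2)) on the first leg, which is the target map. *)
Lemma sw_one_S1 (V : lmodType CC) (phi : _ -> _ -> V) : bilin phi ->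
  \sw_(a, b <- one) phi (S a) b = \sw_(a, b <- one) phi (epst a) b.
Proof.
move=> bp.
transitivity (\sw_(a, b <- one) \sw_(c, d <- a) phi (epss c ** S d) b).
  apply: eq_sw => a b; rewrite S_epss (sw_app _ (F := phi^~ b)) //; apply bp.
transitivity (\sw_(a, b <- one) \sw_(c, d <- one) phi (c ** S (a ** d)) b).
  apply: eq_sw => a b.
  by rewrite (sw_epssl _ (phi := fun u v => phi (u ** S v) b)) //; bilinear.
rewrite sw_exch.
rewrite -(sw_one3r wh (phi := fun a m d => phi (a ** S m) d)); last by trilinear.
apply: eq_sw => a b; rewrite (epstE wh) (sw_app _ (F := phi^~ b)) //; apply bp.
Qed.

Lemma sw_one_S2 (V : lmodType CC) (phi : _ -> _ -> V) : bilin phi ->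
  \sw_(a, b <- one) phi a (S b) = \sw_(a, b <- one) phi a (epss b).
Proof.
move=> bp.
transitivity (\sw_(a, b <- one) \sw_(c, d <- b) phi a (S c ** epst d)).
  apply: eq_sw => a b; rewrite S_epst (sw_app _ (F := phi a)) //; apply bp.
transitivity (\sw_(a, b <- one) \sw_(c, d <- one) phi a (S (c ** b) ** d)).
  apply: eq_sw => a b.
  by rewrite (sw_epstr _ (phi := fun u v => phi a (S u ** v))) //; bilinear.
rewrite -(sw_one3r wh (phi := fun a m d => phi a (S m ** d))); last by trilinear.
rewrite (sw_coassoc wh _ (fun a m d => phi a (S m ** d))).
apply: eq_sw => a b; rewrite (epssE wh) (sw_app _ (F := phi a)) //; apply bp.
Qed.

(** [sw_epsl] moves x out of the counit, which reduces the claim to x = 1, where S and the target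
    map agree on the first leg. *)
Lemma sw_epstl (V : lmodType CC) x (phi : _ -> _ -> V) : bilin phi ->
  \sw_(a, b <- x) phi (epst a) b = \sw_(a, b <- one) phi (S a) (b ** x).
Proof.
move=> bp; rewrite (sw_one_S1 (phi := fun u v => phi u (v ** x))); last by bilinear.
have E a b : phi (epst a) b = \sw_(c, d <- one) (eps (c ** a) *: phi d b).
  rewrite /epst (sw_app _ (F := phi^~ b)); last apply bp.
  by apply: eq_sw => c d; rewrite (linZ (f := phi^~ b)) //; apply bp.
under eq_sw do rewrite E.
under [RHS]eq_sw do rewrite E.
rewrite sw_exch [RHS]sw_exch; apply: eq_sw => c d.
by rewrite (sw_epsl _ _ (phi := phi d)) //; apply bp.
Qed.

Lemma sw_epssr (V : lmodType CC) x (phi : _ -> _ -> V) : bilin phi ->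
  \sw_(a, b <- x) phi a (epss b) = \sw_(a, b <- one) phi (x ** a) (S b).
Proof.
move=> bp; rewrite (sw_one_S2 (phi := fun u v => phi (x ** u) v)); last by bilinear.
have E a b : phi a (epss b) = \sw_(c, d <- one) (eps (b ** d) *: phi a c).
  rewrite /epss (sw_app _ (F := phi a)); last apply bp.
  by apply: eq_sw => c d; rewrite (linZ (f := phi a)) //; apply bp.
under eq_sw do rewrite E.
under [RHS]eq_sw do rewrite E.
rewrite sw_exch [RHS]sw_exch; apply: eq_sw => c d.
by rewrite (sw_epsr _ _ (phi := phi^~ c)) //; apply bp.
Qed.

Lemma eps_mul_epst x y : eps (x ** y) = eps (x ** epst y).
Proof.
rewrite -{1}(wh_mul1r wh x) (wh_epsr wh) /epst.
rewrite (sw_app _ (F := fun u => eps (x ** u) : CC^o)); last by linear.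
by apply: eq_sw => a b; rewrite (linZ (f := fun u => eps (x ** u) : CC^o)) 1?mulrC //; linear.
Qed.

Lemma eps_mul_epss x y : eps (x ** y) = eps (epss x ** y).
Proof.
rewrite -{1}(wh_mul1r wh x) (wh_epsr wh) /epss.
rewrite (sw_app _ (F := fun u => eps (u ** y) : CC^o)); last by linear.
by apply: eq_sw => a b; rewrite (linZ (f := fun u => eps (u ** y) : CC^o)) //; linear.
Qed.

(** Values of the target map are combinations of second legs of Delta(1), so their coproduct is read
    off the double coproduct of 1; its two forms put the element on the left of 1_(1) here and on
    the right in [sw_epst_r]. *)
Lemma sw_epst_l (V : lmodType CC) x (phi : _ -> _ -> V) : bilin phi ->
  sw H (epst x) phi = \sw_(a, b <- one) phi (epst x ** a) b.
Proof.
move=> bp; rewrite {1}/epst (sw_app _ (F := fun u => sw H u phi)); last by linear.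
transitivity (\sw_(a, b <- one) \sw_(c, d <- b) (eps (a ** x) *: phi c d)).
  by apply: eq_sw => a b; rewrite (linZ (f := fun u => sw H u phi)) -?sw_scaler //; linear.
rewrite -(sw_coassoc wh _ (fun a c d => eps (a ** x) *: phi c d)).
rewrite (sw_one3l wh (phi := fun a c d => eps (a ** x) *: phi c d)); last by trilinear.
rewrite sw_exch; apply: eq_sw => c d; rewrite /epst.
rewrite (sw_app _ (F := fun u => phi (u ** c) d)); last by linear.
by apply: eq_sw => a b; rewrite (linZ (f := fun u => phi (u ** c) d)) //; linear.
Qed.

Lemma sw_epst_r (V : lmodType CC) x (phi : _ -> _ -> V) : bilin phi ->
  sw H (epst x) phi = \sw_(a, b <- one) phi (a ** epst x) b.
Proof.
move=> bp; rewrite {1}/epst (sw_app _ (F := fun u => sw H u phi)); last by linear.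
transitivity (\sw_(a, b <- one) \sw_(c, d <- b) (eps (a ** x) *: phi c d)).
  by apply: eq_sw => a b; rewrite (linZ (f := fun u => sw H u phi)) -?sw_scaler //; linear.
rewrite -(sw_coassoc wh _ (fun a c d => eps (a ** x) *: phi c d)).
rewrite (sw_one3r wh (phi := fun a c d => eps (a ** x) *: phi c d)); last by trilinear.
rewrite sw_exch; apply: eq_sw => c d; rewrite /epst.
rewrite (sw_app _ (F := fun u => phi (c ** u) d)); last by linear.
by apply: eq_sw => a b; rewrite (linZ (f := fun u => phi (c ** u) d)) //; linear.
Qed.

Lemma sw_epss_l (V : lmodType CC) x (phi : _ -> _ -> V) : bilin phi ->
  sw H (epss x) phi = \sw_(a, b <- one) phi a (epss x ** b).
Proof.
move=> bp; rewrite {1}/epss (sw_app _ (F := fun u => sw H u phi)); last by linear.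
transitivity (\sw_(a, b <- one) \sw_(c, d <- a) (eps (x ** b) *: phi c d)).
  by apply: eq_sw => a b; rewrite (linZ (f := fun u => sw H u phi)) -?sw_scaler //; linear.
rewrite (sw_one3r wh (phi := fun c d b => eps (x ** b) *: phi c d)); last by trilinear.
apply: eq_sw => c d; rewrite /epss.
rewrite (sw_app _ (F := fun u => phi c (u ** d))); last by linear.
by apply: eq_sw => a b; rewrite (linZ (f := fun u => phi c (u ** d))) //; linear.
Qed.

Lemma sw_epss_r (V : lmodType CC) x (phi : _ -> _ -> V) : bilin phi ->
  sw H (epss x) phi = \sw_(a, b <- one) phi a (b ** epss x).
Proof.
move=> bp; rewrite {1}/epss (sw_app _ (F := fun u => sw H u phi)); last by linear.
transitivity (\sw_(a, b <- one) \sw_(c, d <- a) (eps (x ** b) *: phi c d)).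
  by apply: eq_sw => a b; rewrite (linZ (f := fun u => sw H u phi)) -?sw_scaler //; linear.
rewrite (sw_one3l wh (phi := fun c d b => eps (x ** b) *: phi c d)); last by trilinear.
apply: eq_sw => c d; rewrite /epss.
rewrite (sw_app _ (F := fun u => phi c (d ** u))); last by linear.
by apply: eq_sw => a b; rewrite (linZ (f := fun u => phi c (d ** u))) //; linear.
Qed.

(** The counit of a product x y depends on y only through eps_t(y), and Delta(x eps_t(y)) = x_(1)
    eps_t(y) (x) x_(2). *)
Lemma epst_mul x y : epst (x ** y) = \sw_(a, b <- x) (a ** epst y ** S b).
Proof.
have -> : epst (x ** y) = epst (x ** epst y).
  rewrite /epst; apply: eq_sw => a b.
  by rewrite -mulA eps_mul_epst mulA.
rewrite (epstE wh (x ** epst y)) (sw_mul wh); last by bilinear.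
transitivity (\sw_(a, b <- x) \sw_(c, d <- one) (a ** c ** epst y ** S (b ** d))).
  apply: eq_sw => a b; rewrite (sw_epst_r _ (phi := fun c d => a ** c ** S (b ** d))).
    by apply: eq_sw => c d; rewrite !mulA.
  by bilinear.
by rewrite (sw_mul1r wh _ (phi := fun u v => u ** epst y ** S v)) //; bilinear.
Qed.

Lemma epss_mul x y : epss (x ** y) = \sw_(a, b <- y) (S a ** epss x ** b).
Proof.
have -> : epss (x ** y) = epss (epss x ** y).
  by rewrite /epss; apply: eq_sw => a b; rewrite !mulA eps_mul_epss.
rewrite (epssE wh (epss x ** y)) (sw_mul wh); last by bilinear.
transitivity (\sw_(a, b <- y) \sw_(c, d <- one) (S (c ** a) ** epss x ** (d ** b))).
  rewrite sw_exch; apply: eq_sw => a b; rewrite (sw_epss_l _ (phi := fun c d => S (c ** a) ** (d ** b))).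
    by apply: eq_sw => c d; rewrite !mulA.
  by bilinear.
by rewrite (sw_mul1l wh _ (phi := fun u v => S u ** epss x ** v)) //; bilinear.
Qed.

(** Each counital map supplies one factor of the middle leg of the double coproduct of 1, whose two
    forms differ exactly in the order of those factors. *)
Lemma epss_epst_comm x y : epss x ** epst y = epst y ** epss x.
Proof.
have trl : trilin (fun a m d : 'rV[CC]_n => eps (x ** d) *: (eps (a ** y) *: m)).
  by trilinear.
transitivity (\sw_(c, d <- one) \sw_(a, b <- one) (eps (x ** d) *: (eps (a ** y) *: (c ** b)))).
  rewrite {1}/epss (sw_app _ (F := fun u => u ** epst y)); last by linear.
  apply: eq_sw => c d; rewrite (linZ (f := fun u => u ** epst y)); last by linear.
  rewrite sw_scaler; congr (_ *: _); rewrite /epst (sw_app _ (F := fun u => c ** u)); last by linear.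
  by apply: eq_sw => a b; rewrite (linZ (f := fun u => c ** u)) //; linear.
rewrite sw_exch -(sw_one3r wh trl) (sw_one3l wh trl) sw_exch.
rewrite /epss (sw_app _ (F := fun u => epst y ** u)); last by linear.
apply: eq_sw => c d; rewrite (linZ (f := fun u => epst y ** u)); last by linear.
rewrite sw_scaler; congr (_ *: _); rewrite /epst (sw_app _ (F := fun u => u ** c)); last by linear.
by apply: eq_sw => a b; rewrite (linZ (f := fun u => u ** c)) //; linear.
Qed.

(** S is a convolution inverse of the identity only up to the counital maps, so uniqueness of
    inverses is replaced by a chain: S(xy) = S(x_(1) y_(1)) eps_t(x_(2) y_(2)) = eps_s(x_(1) y_(1))
    S(y_(2)) S(x_(2)) = S(y_(1)) eps_s(x_(1)) eps_t(y_(2)) S(x_(2)), where the two counital factors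
    commute. *)
Lemma S_mul x y : S (x ** y) = S y ** S x.
Proof.
transitivity (\sw_(a, b <- x) \sw_(c, d <- y) (S (a ** c) ** epst (b ** d))).
  by rewrite S_epst (sw_mul wh) //; bilinear.
transitivity (\sw_(a, b <- x) \sw_(a', a'' <- a) \sw_(c, d <- y) \sw_(c', c'' <- c)
     (S (a' ** c') ** (a'' ** c'') ** S d ** S b)).
  transitivity (\sw_(a, b <- x) \sw_(c, d <- y) \sw_(b', b'' <- b) \sw_(d', d'' <- d)
     (S (a ** c) ** (b' ** d') ** S d'' ** S b'')).
    apply: eq_sw => a b; apply: eq_sw => c d; rewrite epst_mul.
    rewrite (sw_app _ (F := fun u => S (a ** c) ** u)); last by linear.
    apply: eq_sw => b' b''; rewrite (epstE wh d).
    rewrite (sw_app _ (F := fun u => S (a ** c) ** (b' ** u ** S b''))); last by linear.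
    by apply: eq_sw => d' d''; rewrite !mulA.
  transitivity (\sw_(a, b <- x) \sw_(b', b'' <- b) \sw_(c, d <- y) \sw_(d', d'' <- d)
     (S (a ** c) ** (b' ** d') ** S d'' ** S b'')).
    by apply: eq_sw => a b; rewrite sw_exch.
  apply: (etrans (esym (sw_coassoc wh x (fun a b' b'' => \sw_(c, d <- y) \sw_(d', d'' <- d)
     (S (a ** c) ** (b' ** d') ** S d'' ** S b''))))).
  apply: eq_sw => a b; apply: eq_sw => a' a''.
  exact: (esym (sw_coassoc wh y (fun c d' d'' => S (a' ** c) ** (a'' ** d') ** S d'' ** S b))).
transitivity (\sw_(a, b <- x) \sw_(c, d <- y) (epss (a ** c) ** S d ** S b)).
  apply: eq_sw => a b; rewrite sw_exch; apply: eq_sw => c d.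
  rewrite (epssE wh (a ** c)) (sw_mul wh); last by bilinear.
  rewrite (sw_app _ (F := fun u => u ** S d ** S b)); last by linear.
  by apply: eq_sw => a' a''; rewrite (sw_app _ (F := fun u => u ** S d ** S b)) //; linear.
transitivity (\sw_(a, b <- x) \sw_(c, d <- y) (S c ** epst d ** (epss a ** S b))).
  apply: eq_sw => a b.
  transitivity (\sw_(c, d <- y) \sw_(c', c'' <- c) (S c' ** epss a ** c'' ** S d ** S b)).
    apply: eq_sw => c d; rewrite epss_mul.
    by rewrite (sw_app _ (F := fun u => u ** S d ** S b)) //; linear.
  rewrite (sw_coassoc wh _ (fun c' c'' d => S c' ** epss a ** c'' ** S d ** S b)).
  apply: eq_sw => c d.
  transitivity (S c ** (epss a ** epst d) ** S b).
    rewrite (epstE wh d) (sw_app _ (F := fun u => S c ** (epss a ** u) ** S b)); last by linear.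
    by apply: eq_sw => d' d''; rewrite !mulA.
  by rewrite epss_epst_comm !mulA.
rewrite sw_exch [S y]S_epst (sw_app _ (F := fun u => u ** S x)); last by linear.
apply: eq_sw => c d; rewrite [S x]S_epss (sw_app _ (F := fun u => S c ** epst d ** u)) //.
by linear.
Qed.

Definition Sinv (x : 'rV[CC]_n) := x *m invmx (wS H).

Lemma SinvK x : S (Sinv x) = x.
Proof. by rewrite /Aanti /Sinv mulmxKV // (wh_Sunit wh). Qed.

(** By bijectivity, 1 S(1) = S(S^-1(1)) S(1) = S(1 S^-1(1)) = 1. *)
Lemma S_one : S one = one.
Proof.
by rewrite -[LHS](wh_mul1l wh) -{1}(SinvK one) -S_mul (wh_mul1l wh) SinvK.
Qed.

Lemma sw_one_epss (V : lmodType CC) (phi : _ -> _ -> V) : bilin phi ->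
  \sw_(a, b <- one) phi (epss a) b = sw H one phi.
Proof.
move=> bp; rewrite sw_epssl //; apply: eq_sw => a b; by rewrite wh_mul1l.
Qed.

Lemma sw_one_epst (V : lmodType CC) (phi : _ -> _ -> V) : bilin phi ->
  \sw_(a, b <- one) phi a (epst b) = sw H one phi.
Proof.
move=> bp; rewrite sw_epstr //; apply: eq_sw => a b; by rewrite wh_mul1r.
Qed.

(** Both sides equal eps_s(t_(1)) (x) t_(2) with t = eps_t(x): expanding the source map and using
    Delta(t) = 1_(1) t (x) 1_(2) brings out S(t). *)
Lemma sw_one_target (V : lmodType CC) x (phi : _ -> _ -> V) : bilin phi ->
  \sw_(a, b <- one) phi a (epst x ** b) = \sw_(a, b <- one) phi (S (epst x) ** a) b.
Proof.
move=> bp; rewrite -sw_epssl //.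
transitivity (\sw_(a, b <- epst x) \sw_(c, d <- b) phi (S a ** c) d).
  rewrite -(sw_coassoc wh _ (fun a c d => phi (S a ** c) d)).
  apply: eq_sw => a b; rewrite (epssE wh a) (sw_app _ (F := phi^~ b)) //; apply bp.
rewrite sw_epst_r; last by bilinear.
transitivity (\sw_(a, b <- one) \sw_(c, d <- b) phi (S (epst x) ** (S a ** c)) d).
  by apply: eq_sw => a b; apply: eq_sw => c d; rewrite S_mul mulA.
rewrite -(sw_coassoc wh _ (fun a c d => phi (S (epst x) ** (S a ** c)) d)).
rewrite -[RHS](sw_one_epss (phi := fun u v => phi (S (epst x) ** u) v)); last by bilinear.
apply: eq_sw => a b.
by rewrite (epssE wh a) (sw_app _ (F := fun u => phi (S (epst x) ** u) b)) //; linear.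
Qed.

End Identities.

(** * The dual weak Hopf algebra *)

Lemma scaleCC (k : CC) (x : CC^o) : k *: x = k * x :> CC.
Proof. by []. Qed.

Lemma AtensE n (x y : 'rV[CC]_n) i j : Atens x y i j = x 0 i * y 0 j.
Proof. by rewrite /Atens mxE big_ord1 mxE. Qed.

Lemma lin_ext n (V : lmodType CC) (f g : 'rV[CC]_n -> V) :
  lin f -> lin g -> (forall i, f (Abas i) = g (Abas i)) -> f =1 g.
Proof.
by move=> lf lg e x; rewrite (lin_basis _ lf) (lin_basis _ lg); apply: eq_bigr => i _; rewrite e.
Qed.

Lemma sw_mulCl n (H : WHAdata n) x (c : CC) (F : _ -> _ -> CC^o) :
  c * sw H x F = sw H x (fun a b => c * F a b : CC^o).
Proof. exact: esym (sw_scaler H x c F). Qed.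

Lemma sw_mulCr n (H : WHAdata n) x (c : CC) (F : _ -> _ -> CC^o) :
  sw H x F * c = sw H x (fun a b => F a b * c : CC^o).
Proof. by rewrite mulrC sw_mulCl; apply: eq_sw => a b; rewrite mulrC. Qed.

Section Dual.
Variables (n : nat) (H : WHAdata n).
Implicit Types (f g h : 'rV[CC]_n) (x y z : 'rV[CC]_n).

Definition dualW : WHAdata n := {|
  wmul := fun i j => \row_k wcomul H k i j;
  wone := weps H;
  wcomul := fun k => \matrix_(i, j) wmul H i j 0 k;
  weps := wone H;
  wS := (wS H)^T |}.
Local Notation D := dualW.
Local Notation "x ** y" := (Amul H x y) (at level 40, left associativity).
Local Notation "\sw_ ( a , b <- x ) E" := (sw H x (fun a b => E))
  (at level 36, a name, b name, E at level 36).

Lemma Amul_bas i j : Abas i ** Abas j = wmul H i j.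
Proof.
rewrite /Amul -[RHS](sum_Abasl i (fun k => wmul H k j)); apply: eq_bigr => k _.
rewrite -[in RHS](sum_Abasl j (fun l => wmul H k l)) scaler_sumr.
by apply: eq_bigr => l _; rewrite scalerA.
Qed.

Lemma Amul_dual f g : Amul D f g = Ddmul H f g.
Proof.
apply/rowP=> k; rewrite /Amul mxE summxE; apply: eq_bigr => i _.
by rewrite summxE; apply: eq_bigr => j _; rewrite !mxE.
Qed.

Lemma Aev_dual_mul f g x :
  Aev (Amul D f g) x = \sw_(a, b <- x) (Aev f a * Aev g b : CC^o).
Proof.
move: x; apply: (lin_ext (V := CC^o)) => [||k]; try by linear.
rewrite Aev_basr Amul_dual mxE /sw ADelta_bas; apply: eq_bigr => i _; apply: eq_bigr => j _.
by rewrite !Aev_basr scaleCC [RHS]mulrC.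
Qed.

Lemma ADelta_dual f i j : ADelta D f i j = Aev f (Abas i ** Abas j).
Proof.
rewrite Amul_bas /ADelta summxE; apply: eq_bigr => k _; by rewrite !mxE.
Qed.

Lemma Aev_dual_sw f x y : sw D f (fun p q => Aev p x * Aev q y : CC^o) = Aev f (x ** y).
Proof.
rewrite [RHS](@bilin_coord _ CC^o (fun x y => Aev f (x ** y))); last by bilinear.
apply: eq_bigr => i _; apply: eq_bigr => j _.
by rewrite ADelta_dual !Aev_basl !scaleCC [LHS]mulrC.
Qed.

Lemma Aeps_dual f : Aeps D f = Aev f (wone H).
Proof. exact: AevC. Qed.

Lemma Aev_dual_S f x : Aev (Aanti D f) x = Aev f (Aanti H x).
Proof.
have E (p q : 'rV[CC]_n) : Aev p q = (p *m q^T) 0 0.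
  by rewrite mxE; apply: eq_bigr => i _; rewrite mxE.
by rewrite !E /Aanti trmx_mul mulmxA.
Qed.

Hypothesis wh : whopf H.
Let mulA := wh_mulA wh.

Lemma dual_coassoc_coord f i j k :
  \sum_m ADelta D f m k * wcomul D m i j = Aev f (Abas i ** Abas j ** Abas k).
Proof.
rewrite Amul_bas (@lin_basis _ CC^o (fun x => Aev f (x ** Abas k))); last by linear.
by apply: eq_bigr => m _; rewrite ADelta_dual mxE mulrC.
Qed.

Lemma dual_mulA f g h : Amul D (Amul D f g) h = Amul D f (Amul D g h).
Proof.
apply: Aev_inj => x; rewrite !Aev_dual_mul.
under eq_sw do rewrite Aev_dual_mul sw_mulCr.
under [RHS]eq_sw do rewrite Aev_dual_mul sw_mulCl.
rewrite (sw_coassoc wh _ (fun c d b => Aev f c * Aev g d * Aev h b : CC^o)).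
by apply: eq_sw => a b; apply: eq_sw => c d; rewrite mulrA.
Qed.

(** Paired with elements of A, each axiom becomes one of A: associativity and coassociativity
    exchange roles, and the two forms of Delta^2(1) trade places with the two forms of weak
    multiplicativity of the counit. Multiplicativity of Delta and the antipode axioms are
    self-dual. *)
Lemma dual_whopf : whopf D.
Proof.
split.
- exact: dual_mulA.
- move=> f; apply: Aev_inj => x; rewrite Aev_dual_mul.
  by apply: (sw_counitl wh x (phi := Aev f : _ -> CC^o)); linear.
- move=> f; apply: Aev_inj => x; rewrite Aev_dual_mul.
  rewrite -(sw_counitr wh x (phi := Aev f : _ -> CC^o)); last by linear.
  by apply: eq_sw => a b; rewrite mulrC.
- move=> f i j k; rewrite dual_coassoc_coord mulA (Amul_bas j).
  rewrite (@lin_basis _ CC^o (fun x => Aev f (Abas i ** x))); last by linear.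
  by apply: eq_bigr => m _; rewrite ADelta_dual mxE mulrC.
- move=> f; apply/rowP=> j; rewrite mxE -[RHS]Aev_basr -(wh_mul1l wh (Abas j)).
  rewrite (@lin_basis _ CC^o (fun x => Aev f (x ** Abas j))); last by linear.
  by apply: eq_bigr => i _; rewrite ADelta_dual.
- move=> f; apply/colP=> j; rewrite !mxE -[RHS]Aev_basr -(wh_mul1r wh (Abas j)).
  rewrite (@lin_basis _ CC^o (fun x => Aev f (Abas j ** x))); last by linear.
  by apply: eq_bigr => i _; rewrite ADelta_dual mxE mulrC.
- move=> f g i j; rewrite ADelta_dual Aev_dual_mul (sw_mul wh); last by bilinear.
  transitivity (\sw_(a, b <- Abas i) \sw_(c, d <- Abas j)
     (sw D f (fun p q => sw D g (fun r s => (Aev p a * Aev r b) * (Aev q c * Aev s d) : CC^o)))).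
    apply: eq_sw => a b; apply: eq_sw => c d.
    rewrite -!Aev_dual_sw sw_mulCr; apply: eq_sw => p q.
    by rewrite sw_mulCl; apply: eq_sw => r s; rewrite mulrACA.
  under eq_sw do rewrite sw_exch.
  rewrite sw_exch; apply: eq_sw => p q.
  under eq_sw do rewrite sw_exch.
  rewrite sw_exch; apply: eq_sw => r s.
  rewrite -[Amul D p r 0 i]Aev_basr -[Amul D q s 0 j]Aev_basr !Aev_dual_mul sw_mulCr.
  by apply: eq_sw => a b; rewrite sw_mulCl.
- move=> i j k; rewrite dual_coassoc_coord [LHS](wh_epsl wh).
  transitivity (\sw_(a, b <- Abas j) (sw D (weps H) (fun p q => sw D (weps H) (fun r s =>
     Aev p (Abas i) * Aev q a * (Aev r b * Aev s (Abas k)) : CC^o)))).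
    apply: eq_sw => a b; rewrite /Aeps -!Aev_dual_sw sw_mulCr; apply: eq_sw => p q.
    by rewrite sw_mulCl.
  rewrite sw_exch; apply: eq_sw => p q; rewrite sw_exch; apply: eq_sw => r s.
  rewrite -[Amul D q r 0 j]Aev_basr Aev_dual_mul sw_mulCl sw_mulCr.
  by apply: eq_sw => a b; rewrite !Aev_basr !mulrA.
- move=> i j k; rewrite dual_coassoc_coord [LHS](wh_epsr wh).
  transitivity (\sw_(a, b <- Abas j) (sw D (weps H) (fun p q => sw D (weps H) (fun r s =>
     Aev p (Abas i) * Aev q b * (Aev r a * Aev s (Abas k)) : CC^o)))).
    apply: eq_sw => a b; rewrite /Aeps -!Aev_dual_sw sw_mulCr; apply: eq_sw => p q.
    by rewrite sw_mulCl.
  rewrite sw_exch; apply: eq_sw => p q; rewrite sw_exch; apply: eq_sw => r s.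
  rewrite -[Amul D r q 0 j]Aev_basr Aev_dual_mul sw_mulCl sw_mulCr.
  by apply: eq_sw => a b; rewrite !Aev_basr -!mulrA; congr (_ * _); rewrite mulrCA.
- move=> f g h; rewrite Aeps_dual Aev_dual_mul.
  under eq_sw do rewrite Aev_dual_mul sw_mulCr.
  rewrite (sw_one3l wh (phi := fun c d b => Aev f c * Aev g d * Aev h b : CC^o)); last by trilinear.
  transitivity (\sw_(a, b <- wone H) \sw_(c, d <- wone H) (sw D g (fun p q =>
      Aev f a * Aev p b * (Aev q c * Aev h d) : CC^o))).
    apply: eq_sw => a b; apply: eq_sw => c d; rewrite -Aev_dual_sw sw_mulCl sw_mulCr.
    by apply: eq_sw => p q; rewrite !mulrA.
  under eq_sw do rewrite sw_exch.
  rewrite sw_exch; apply: eq_sw => p q.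
  rewrite !Aeps_dual !Aev_dual_mul sw_mulCr.
  by apply: eq_sw => a b; rewrite sw_mulCl.
- move=> f g h; rewrite Aeps_dual Aev_dual_mul.
  under eq_sw do rewrite Aev_dual_mul sw_mulCr.
  rewrite (sw_one3r wh (phi := fun c d b => Aev f c * Aev g d * Aev h b : CC^o)); last by trilinear.
  transitivity (\sw_(a, b <- wone H) \sw_(c, d <- wone H) (sw D g (fun p q =>
      Aev f a * Aev q b * (Aev p c * Aev h d) : CC^o))).
    apply: eq_sw => a b; apply: eq_sw => c d; rewrite -Aev_dual_sw sw_mulCl sw_mulCr.
    apply: eq_sw => p q; rewrite -!mulrA; congr (_ * _); exact: mulrCA.
  under eq_sw do rewrite sw_exch.
  rewrite sw_exch; apply: eq_sw => p q.
  rewrite !Aeps_dual !Aev_dual_mul sw_mulCr.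
  by apply: eq_sw => a b; rewrite sw_mulCl.
- move=> f; apply: Aev_inj => x.
  transitivity (Aev f (epss H x)).
    rewrite (epssE wh) (sw_app _ (F := fun p => Aev p x : CC^o)); last by linear.
    rewrite (sw_app _ (F := Aev f : _ -> CC^o)); last by linear.
    under eq_sw do rewrite Aev_dual_mul.
    rewrite sw_exch; apply: eq_sw => a b; rewrite -Aev_dual_sw; apply: eq_sw => p q.
    by rewrite Aev_dual_S.
  rewrite (sw_app _ (F := fun p => Aev p x : CC^o)); last by linear.
  rewrite /epss (sw_app _ (F := Aev f : _ -> CC^o)); last by linear.
  transitivity (sw D (weps H) (fun p q => \sw_(a, b <- wone H) (Aev f a * Aev q b * Aev p x : CC^o))).
    rewrite sw_exch; apply: eq_sw => a b.
    rewrite (linZ (f := Aev f : _ -> CC^o)) /Aeps -?Aev_dual_sw; last by linear.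
    rewrite -sw_scale; apply: eq_sw => p q.
    by rewrite scaleCC [RHS]mulrC -[LHS]mulrA; congr (_ * _); exact: mulrC.
  apply: eq_sw => p q; rewrite (linZ (f := fun p => Aev p x : CC^o)); last by linear.
  by rewrite Aeps_dual Aev_dual_mul -sw_scale.
- move=> f; apply: Aev_inj => x.
  transitivity (Aev f (epst H x)).
    rewrite (epstE wh) (sw_app _ (F := fun p => Aev p x : CC^o)); last by linear.
    rewrite (sw_app _ (F := Aev f : _ -> CC^o)); last by linear.
    under eq_sw do rewrite Aev_dual_mul.
    rewrite sw_exch; apply: eq_sw => a b; rewrite -Aev_dual_sw; apply: eq_sw => p q.
    by rewrite Aev_dual_S.
  rewrite (sw_app _ (F := fun p => Aev p x : CC^o)); last by linear.
  rewrite /epst (sw_app _ (F := Aev f : _ -> CC^o)); last by linear.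
  transitivity (sw D (weps H) (fun p q => \sw_(a, b <- wone H) (Aev p a * Aev f b * Aev q x : CC^o))).
    rewrite sw_exch; apply: eq_sw => a b.
    rewrite (linZ (f := Aev f : _ -> CC^o)) /Aeps -?Aev_dual_sw; last by linear.
    rewrite -sw_scale; apply: eq_sw => p q.
    by rewrite scaleCC [LHS]mulrAC.
  apply: eq_sw => p q; rewrite (linZ (f := fun p => Aev p x : CC^o)); last by linear.
  by rewrite Aeps_dual Aev_dual_mul -sw_scale.
- move=> f; apply: Aev_inj => x; rewrite Aev_dual_S -(wh_S3 wh).
  rewrite (sw_app _ (F := fun p => Aev p x : CC^o)); last by linear.
  rewrite (sw_app _ (F := Aev f : _ -> CC^o)); last by linear.
  transitivity (sw D f (fun p q => \sw_(a, b <- x) \sw_(c, d <- a) sw D p (fun r s =>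
     Aev r (Aanti H c) * Aev s d * Aev q (Aanti H b) : CC^o))).
    apply: eq_sw => p q; rewrite (sw_app _ (F := fun p => Aev p x : CC^o)); last by linear.
    under [RHS]eq_sw do rewrite sw_exch.
    rewrite [RHS]sw_exch; apply: eq_sw => r s; rewrite Aev_dual_mul; apply: eq_sw => a b.
    by rewrite !Aev_dual_mul Aev_dual_S sw_mulCr; apply: eq_sw => c d; rewrite Aev_dual_S.
  rewrite sw_exch; apply: eq_sw => a b.
  rewrite (sw_app _ (F := Aev f : _ -> CC^o)); last by linear.
  rewrite sw_exch; apply: eq_sw => c d.
  rewrite -[RHS]Aev_dual_sw; apply: eq_sw => p q.
  by rewrite -Aev_dual_sw sw_mulCr.
- by rewrite unitmx_tr (wh_Sunit wh).
Qed.

Lemma Aev_dual_sw_bilin (V : lmodType CC) f (phi : _ -> _ -> V) :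
  sw D f phi = \sum_i \sum_j Aev f (Abas i ** Abas j) *: phi (Abas i) (Abas j).
Proof. by apply: eq_bigr => i _; apply: eq_bigr => j _; rewrite ADelta_dual. Qed.

(** Evaluated on a pair of elements of A, this is antimultiplicativity of the antipode of A. *)
Lemma dual_sw_S (V : lmodType CC) f (phi : _ -> _ -> V) : bilin phi ->
  sw D (Aanti D f) phi = sw D f (fun a b => phi (Aanti D b) (Aanti D a)).
Proof.
move=> bp.
have E : ADelta D (Aanti D f) = sw D f (fun a b => Atens (Aanti D b) (Aanti D a)).
  apply/matrixP=> i j; rewrite ADelta_dual Aev_dual_S (S_mul wh) -Aev_dual_sw.
  rewrite [RHS](sw_app _ (F := fun M : 'M_n => M i j : CC^o)); last by linear.
  apply: eq_sw => p q; rewrite -!Aev_dual_S !Aev_basr.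
  by rewrite AtensE mulrC.
rewrite {1}/sw E.
transitivity (sw D f (fun a b => \sum_i \sum_j
   (Aanti D b 0 i * Aanti D a 0 j) *: phi (Abas i) (Abas j))); last first.
  by apply: eq_sw => a b; rewrite [RHS](bilin_coord _ _ bp).
rewrite sw_sum; apply: eq_bigr => i _; rewrite sw_sum; apply: eq_bigr => j _.
rewrite sw_scale (sw_app _ (F := fun M : 'M_n => M i j : CC^o)); last by linear.
by congr (_ *: _); apply: eq_sw => a b; rewrite AtensE.
Qed.

End Dual.

(** * Representations of the semisimple dual *)

Lemma genmx_eq0 (F : fieldType) m n (A : 'M[F]_(m, n)) : (<<A>>%MS == 0) = (A == 0).
Proof. by rewrite -!mxrank_eq0 genmxE. Qed.

Lemma submx0_eq (F : fieldType) m n (A : 'M[F]_(m, n)) : (A <= (0 : 'M_n))%MS -> A = 0.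
Proof. by rewrite submx0 => /eqP. Qed.

(** * Schur's lemma *)

Section Schur.
Variable n : nat.

(** Invariant subspaces are row spaces of transposed vectors, so the image and the kernel of [T] are
    taken through [T^T]. *)
Lemma schur (da db : nat) (ra : 'rV[CC]_n -> 'M[CC]_da) (rb : 'rV[CC]_n -> 'M[CC]_db)
    (T : 'M[CC]_(da, db)) :
  dirreducible ra -> dirreducible rb -> (forall f, ra f *m T = T *m rb f) ->
  T = 0 \/ exists2 T' : 'M[CC]_(db, da), T *m T' = 1%:M & T' *m T = 1%:M.
Proof.
move=> [_ irra] [_ irrb] comm.
have [|Tim|] := irra <<T^T>>%MS.
- move=> f; rewrite genmxE; apply: submx_trans (submxMr _ _) _; first by rewrite genmxE.
  by rewrite -trmx_mul comm trmx_mul submxMl.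
- by left; apply: trmx_inj; rewrite trmx0; apply/eqP; rewrite -genmx_eq0 Tim.
rewrite /row_full genmxE => fullT.
have [|Tker|] := irrb (kermx T^T).
- move=> f; apply/sub_kermxP.
  by rewrite -mulmxA -trmx_mul -comm trmx_mul mulmxA mulmx_ker mul0mx.
- right.
  have /row_freeP[B TB] : row_free T^T by rewrite -kermx_eq0 Tker.
  have /row_fullP[C CT] : row_full T^T by [].
  have BC : B = C by rewrite -[B]mul1mx -CT -mulmxA TB mulmx1.
  exists B^T; apply: trmx_inj; rewrite trmx_mul trmxK trmx1 //.
  by rewrite BC.
rewrite -sub1mx => /sub_kermxP; rewrite mul1mx => T0; left.
by apply: trmx_inj; rewrite T0 trmx0.
Qed.

Lemma schur_scalar (da : nat) (ra : 'rV[CC]_n -> 'M[CC]_da) (T : 'M[CC]_da) :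
  dirreducible ra -> (forall f, ra f *m T = T *m ra f) -> exists k, T = k%:M.
Proof.
move=> irra comm.
have dapos : (0 < da)%N by case: irra.
have [k /eqP rk] : exists k, root (char_poly T) k.
  apply/(@closed_rootP CC); by rewrite size_char_poly eqSS -lt0n.
have ek : eigenvalue T k by rewrite eigenvalue_root_char; apply/eqP.
exists k; apply/eqP; rewrite -subr_eq0; apply/eqP.
have [|//|[T' TT' _]] := @schur _ _ ra ra (T - k%:M) irra irra.
  by move=> f; rewrite mulmxBl mulmxBr comm scalar_mxC.
case/eigenvalueP: ek => x xT x0.
have : x *m (T - k%:M) *m T' = 0 by rewrite mulmxBr xT mul_mx_scalar subrr mul0mx.
by rewrite -mulmxA TT' mulmx1 => x00; rewrite x00 eqxx in x0.
Qed.

End Schur.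

Section Semisimple.
Variables (n : nat) (H : WHAdata n).
Hypothesis wh : whopf H.
Hypothesis Hss : dual_semisimple H.
Local Notation D := (dualW H).
Local Notation "f ** g" := (Amul D f g) (at level 40, left associativity).
Local Notation one := (weps H).

Let dwh := dual_whopf wh.
Let mulA := wh_mulA dwh.
Let mul1l : forall f, one ** f = f := wh_mul1l dwh.
Let mul1r : forall f, f ** one = f := wh_mul1r dwh.

Lemma drep_lin d (rho : 'rV[CC]_n -> 'M[CC]_d) : is_drep H rho -> lin rho.
Proof. by case. Qed.

Lemma drep1 d (rho : 'rV[CC]_n -> 'M[CC]_d) : is_drep H rho -> rho one = 1%:M.
Proof. by case. Qed.

Lemma drepM d (rho : 'rV[CC]_n -> 'M[CC]_d) f g :
  is_drep H rho -> rho (f ** g) = rho f *m rho g.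
Proof. by case=> _ _ m; rewrite Amul_dual m. Qed.

Lemma left_idealM U f g : dleft_ideal H U -> (f <= U)%MS -> (g ** f <= U)%MS.
Proof. by move=> iU fU; rewrite Amul_dual; apply: iU. Qed.

(** e and e' are the components of the unit along U and its complement U'. For f in U, f e' = f - f
    e lies in both ideals and vanishes, so e is a right unit of U. *)
Lemma left_ideal_split U : dleft_ideal H U ->
  exists (U' : 'M[CC]_n) e e', [/\ dleft_ideal H U', (e <= U)%MS, (e' <= U')%MS, one = e + e' &
     forall f, (f <= U)%MS -> f ** e' = 0].
Proof.
move=> iU; have [U' [iU' [cap add]]] := Hss iU.
have : (one <= U + U')%MS by apply: submx_trans add; rewrite submx1.
case/sub_addsmxP=> -[x y] /= E; exists U', (x *m U), (y *m U'); split=> //; try exact: submxMl.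
move=> f fU; apply: submx0_eq; apply: submx_trans cap; rewrite sub_capmx.
rewrite [X in _ && X](left_idealM _ iU') ?submxMl // andbT.
have -> : f ** (y *m U') = f - f ** (x *m U).
  by rewrite -{2}[f]mul1r E (linD _ _ ((Amul_bilin D).2 f)) addrC addKr.
by rewrite addmx_sub // eqmx_opp (left_idealM _ iU) ?submxMl.
Qed.

Definition lmul_mx f : 'M[CC]_n := \matrix_i (f ** Abas i).

Lemma mul_lmul_mx f h : h *m lmul_mx f = f ** h.
Proof.
rewrite (lin_basis h ((Amul_bilin D).2 f)) mulmx_sum_row.
by apply: eq_bigr => i _; rewrite rowK.
Qed.

Section Restriction.
Variable U : 'M[CC]_n.
Hypothesis iU : dleft_ideal H U.
Let B := row_base U.

Definition ideal_rep f : 'M[CC]_(\rank U) := (B *m lmul_mx f *m pinvmx B)^T.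

Let BL f : (B *m lmul_mx f <= B)%MS.
Proof.
apply/row_subP=> i; rewrite row_mul mul_lmul_mx eq_row_base left_idealM //.
by rewrite -(eq_row_base U) row_sub.
Qed.

Let freeB : row_free B. Proof. exact: row_base_free. Qed.

Lemma ideal_repP f y : f ** (y *m B) = y *m (ideal_rep f)^T *m B.
Proof. by rewrite /ideal_rep trmxK -mul_lmul_mx -!(mulmxA y) (mulmxKpV (BL f)). Qed.

Lemma ideal_rep_drep : is_drep H ideal_rep.
Proof.
have inj (M N : 'M[CC]_(\rank U)) : (forall y : 'rV_(\rank U), y *m M^T *m B = y *m N^T *m B) -> M = N.
  move=> e; apply: trmx_inj; apply/row_matrixP=> i; rewrite !rowE.
  by apply: (row_free_inj freeB); rewrite e.
split=> [k f g||f g]; apply: inj => y.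
- rewrite -ideal_repP ((Amul_bilin D).1 _) !ideal_repP.
  by rewrite linearD linearZ /= mulmxDr mulmxDl -!(scalemxAl, scalemxAr).
- by rewrite -ideal_repP mul1l trmx1 mulmx1.
- by rewrite -ideal_repP -Amul_dual mulA !ideal_repP trmx_mul !mulmxA.
Qed.

Hypothesis minU : forall U' : 'M[CC]_n, dleft_ideal H U' -> (U' <= U)%MS ->
  (\rank U' < \rank U)%N -> U' = 0.
Hypothesis Unz : U != 0.

Lemma ideal_rep_irr : dirreducible ideal_rep.
Proof.
split; first by rewrite lt0n mxrank_eq0.
move=> U0 sU0; have [full|nfull] := boolP (row_full U0); first by right.
left; have : <<U0 *m B>>%MS = 0 :> 'M_n.
  apply: minU.
  - move=> f g; rewrite !genmxE => /submxP[y ->]; rewrite -Amul_dual.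
    rewrite mulmxA ideal_repP; apply: submxMr; rewrite -mulmxA.
    by apply: submx_trans (sU0 g); apply: submxMl.
  - by rewrite genmxE; apply: submx_trans (submxMl _ _) _; rewrite eq_row_base.
  - rewrite genmxE mxrankMfree // ltn_neqAle rank_leq_col andbT.
    exact: nfull.
move/eqP; rewrite genmx_eq0 => /eqP U0B.
by apply: (row_free_inj freeB); rewrite U0B mul0mx.
Qed.

End Restriction.

Variables (I : finType) (dim : I -> nat) (psi : forall a : I, 'rV[CC]_n -> 'M[CC]_(dim a)).
Hypothesis Hpsi : forall a, is_drep H (psi a) /\ dirreducible (psi a).
Hypothesis Hinj : forall a b, drep_equiv (psi a) (psi b) -> a = b.
Hypothesis Hcompl : forall (k : nat) (rho : 'rV[CC]_n -> 'M[CC]_k),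
  is_drep H rho -> dirreducible rho -> exists a, drep_equiv (psi a) rho.

(** Induction on the rank makes a nonzero U minimal, hence irreducible and equivalent to some
    [psi a]. Its right unit e then acts on U like psi_a(e) = 0, so e = e e = 0 and U = U e = 0. *)
Lemma radical_ideal0 k (U : 'M[CC]_n) : (\rank U <= k)%N -> dleft_ideal H U ->
  (forall f a, (f <= U)%MS -> psi a f = 0) -> U = 0.
Proof.
elim: k U => [|k IH] U rk iU U0; first by apply/eqP; rewrite -mxrank_eq0 -leqn0.
apply/eqP; apply: contraT => Unz.
have minU U' : dleft_ideal H U' -> (U' <= U)%MS -> (\rank U' < \rank U)%N -> U' = 0.
  move=> iU' sU' lt; apply: IH => //; first by rewrite -ltnS (leq_trans lt).
  by move=> f a fU'; apply: U0; apply: submx_trans sU'.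
have [a [T [T' [TT' T'T TE]]]] := Hcompl (ideal_rep_drep iU) (ideal_rep_irr iU minU Unz).
have [U' [e [e' [_ eU _ E ann]]]] := left_ideal_split iU.
have ue f : (f <= U)%MS -> f = f ** e.
  by move=> fU; rewrite -{1}[f]mul1r E (linD _ _ ((Amul_bilin D).2 f)) ann // addr0.
have e0 : e = 0.
  move: (eU); rewrite -(eq_row_base U) => /submxP[y ey].
  rewrite (ue e eU) {2}ey ideal_repP // .
  have -> : ideal_rep U e = 0.
    by rewrite -[ideal_rep U e]mul1mx -T'T -mulmxA -TE (U0 _ _ eU) mul0mx mulmx0.
  by rewrite trmx0 mulmx0 mul0mx.
case/negP: Unz; rewrite -submx0; apply/row_subP=> i.
by rewrite (ue _ (row_sub i U)) e0 (lin0 ((Amul_bilin D).2 _)) sub0mx.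
Qed.

Lemma psi_faithful f : (forall a, psi a f = 0) -> f = 0.
Proof.
move=> f0; pose U : 'M[CC]_n := \matrix_i (Abas i ** f).
have UE x : x *m U = x ** f.
  rewrite (lin_basis x ((Amul_bilin D).1 f)) mulmx_sum_row.
  by apply: eq_bigr => i _; rewrite rowK.
suff U0 : U = 0 by rewrite -[f]mul1l -UE U0 mulmx0.
apply: (@radical_ideal0 (\rank U)) => //.
  by move=> h g /submxP[x ->]; rewrite -Amul_dual UE -mulA -UE submxMl.
move=> h a /submxP[x ->]; rewrite UE drepM ?f0 ?mulmx0 //; by case: (Hpsi a).
Qed.

Lemma psi_inj f g : (forall a, psi a f = psi a g) -> f = g.
Proof.
move=> fg; apply/eqP; rewrite -subr_eq0; apply/eqP/psi_faithful => a.
have [r _] := Hpsi a; have L := drep_lin r.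
by rewrite addrC -scaleN1r L fg scaleN1r addNr.
Qed.

(** * Linear independence of matrix coefficients and matrix units *)

Definition orbit_mx a (xi : 'cV[CC]_(dim a)) : 'M[CC]_(n, dim a) :=
  \matrix_i (psi a (Abas i) *m xi)^T.

Lemma mul_orbit_mx a (xi : 'cV[CC]_(dim a)) f : f *m orbit_mx xi = (psi a f *m xi)^T.
Proof.
have [[L _ _] _] := Hpsi a.
rewrite (lin_basis f (L : lin (psi a))) mulmx_suml linear_sum mulmx_sum_row.
by apply: eq_bigr => i _; rewrite rowK -scalemxAl linearZ.
Qed.

Lemma orbit_mx_full a (xi : 'cV[CC]_(dim a)) : xi != 0 -> row_full (orbit_mx xi).
Proof.
move=> xi0; have [rep [_ irr]] := Hpsi a.
have [||] := irr <<orbit_mx xi>>%MS.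
- move=> f; rewrite genmxE; apply: submx_trans (submxMr _ _) _; first by rewrite genmxE.
  apply/row_subP=> i; rewrite row_mul [row i _]rowE mul_orbit_mx -trmx_mul mulmxA -drepM //.
  by rewrite -mul_orbit_mx submxMl.
- move/eqP; rewrite genmx_eq0 => /eqP R0.
  have /(congr1 trmx) : one *m orbit_mx xi = 0 by rewrite R0 mulmx0.
  by rewrite mul_orbit_mx drep1 // mul1mx trmxK trmx0 => /eqP; rewrite (negPf xi0).
by rewrite /row_full genmxE.
Qed.

Lemma delta_cV_neq0 k (i0 : 'I_k) : (delta_mx i0 0 : 'cV[CC]_k) != 0.
Proof.
by apply/eqP=> /matrixP/(_ i0 0); rewrite !mxE !eqxx => /eqP; rewrite oner_eq0.
Qed.

Section RankOne.
Variables (a : I) (i0 : 'I_(dim a)).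
Let xi : 'cV[CC]_(dim a) := delta_mx i0 0.
Let R := orbit_mx xi.
Let RE f : f *m R = (psi a f *m xi)^T := mul_orbit_mx xi f.
Let fullR : row_full R := orbit_mx_full (delta_cV_neq0 i0).

(** Split the unit along the annihilator of [xi], and let e be the component outside it. Then f xi
    |-> f e eta is an intertwiner W_a -> W_b for every eta in W_b; Schur makes it 0 for b different
    from a and a scalar for b = a, so psi_a(e) maps everything into the line of [xi]. *)
Lemma rank_one_element : exists e,
  (forall b, b != a -> psi b e = 0) /\
  exists phi : 'rV[CC]_(dim a), phi 0 i0 = 1 /\ psi a e = (delta_mx i0 0 : 'cV_(dim a)) *m phi.
Proof.
have iAnn : dleft_ideal H (kermx R).
  move=> f g /sub_kermxP fR; apply/sub_kermxP; rewrite -Amul_dual RE drepM; last by case: (Hpsi a).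
  by move: fR; rewrite RE -mulmxA => /(congr1 trmx); rewrite trmxK => ->; rewrite trmx0 mulmx0 trmx0.
have [U' [e1 [e [_ e1A _ E ann]]]] := left_ideal_split iAnn.
have e1xi : psi a e1 *m xi = 0.
  by apply: trmx_inj; rewrite -RE trmx0; apply/sub_kermxP.
have exi : psi a e *m xi = xi.
  have [rep _] := Hpsi a.
  by rewrite -{2}[xi]mul1mx -(drep1 rep) E (linD _ _ (drep_lin rep)) mulmxDl e1xi add0r.
have key b (eta : 'cV[CC]_(dim b)) : exists T : 'M[CC]_(dim b, dim a),
    (forall f, psi b f *m T = T *m psi a f) /\ T *m xi = psi b e *m eta.
  have [repb _] := Hpsi b; have [repa _] := Hpsi a.
  pose Q : 'M[CC]_(n, dim b) := \matrix_i (psi b (Abas i ** e) *m eta)^T.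
  have QE f : f *m Q = (psi b (f ** e) *m eta)^T.
    have lp : lin (fun f => (psi b (f ** e) *m eta)^T).
      move=> k f1 f2; rewrite ((Amul_bilin D).1 e) (drep_lin repb) mulmxDl -scalemxAl.
      by rewrite linearD linearZ.
    by rewrite (lin_basis f lp) mulmx_sum_row; apply: eq_bigr => i _; rewrite rowK.
  (* Well-definedness: f R = 0 puts f in the annihilator of [xi], where f e = 0 by [ann]; [pinvmx R]
     merely picks preimages. *)
  have [T RT] : exists T : 'M_(dim a, dim b), R *m T = Q.
    exists (pinvmx R *m Q); apply/eqP; rewrite -subr_eq0 mulmxA -[X in _ - X]mul1mx -mulmxBl; apply/eqP.
    apply/row_matrixP=> i; rewrite row_mul row0 QE ann; first by rewrite (lin0 (drep_lin repb)) mul0mx trmx0.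
    apply/sub_kermxP; rewrite -row_mul mulmxBl mul1mx mulmxKpV ?submx_refl //.
    by rewrite subrr row0.
  have TE f : T^T *m (psi a f *m xi) = psi b (f ** e) *m eta.
    by apply: trmx_inj; rewrite trmx_mul trmxK -RE -mulmxA RT QE.
  exists T^T; split; last by rewrite -[xi]mul1mx -(drep1 repa) TE mul1l.
  have tr1 (z : 'cV_(dim a)) (X : 'M_(dim b)) : z^T *m (T *m X^T) = (X *m (T^T *m z))^T.
    by rewrite !trmx_mul trmxK mulmxA.
  have tr2 (z : 'cV_(dim a)) (Y : 'M_(dim a)) : z^T *m (Y^T *m T) = (T^T *m (Y *m z))^T.
    by rewrite !trmx_mul trmxK mulmxA.
  move=> f; apply: trmx_inj; rewrite !trmx_mul trmxK.
  have /row_fullP[C CR] := fullR.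
  rewrite -[LHS]mul1mx -[RHS]mul1mx -CR -!(mulmxA C); congr (_ *m _).
  apply/row_matrixP=> i; rewrite !(row_mul i R) rowE RE tr1 tr2; congr (_^T).
  by rewrite TE mulmxA -(drepM _ _ repb) [psi a f *m _]mulmxA -(drepM _ _ repa) TE mulA.
exists e; split.
  move=> b ba; apply/row_matrixP=> i; apply/rowP=> j.
  have [T [comm Txi]] := key b (delta_mx j 0).
  have [_ irb] := Hpsi b; have [_ ira] := Hpsi a.
  have [T0|[T' TT' T'T]] := schur irb ira comm; last first.
    by case/negP: ba; apply/eqP; apply: Hinj; exists T, T'.
  have /matrixP/(_ i 0) : psi b e *m delta_mx j 0 = 0 :> 'cV_(dim b) by rewrite -Txi T0 mul0mx.
  by rewrite -colE !mxE.
exists (row i0 (psi a e)); split.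
  by have /matrixP/(_ i0 0) := exi; rewrite -colE !mxE !eqxx.
apply/matrixP=> i j; rewrite mxE big_ord1 !mxE eqxx andbT.
have [T [comm Txi]] := key a (delta_mx j 0).
have [_ ira] := Hpsi a; have [k Tk] := schur_scalar ira comm.
have Eij i' : psi a e i' j = k * (i' == i0)%:R.
  have /matrixP/(_ i' 0) := Txi; rewrite Tk mul_scalar_mx -colE !mxE eqxx andbT => <-.
  by [].
rewrite !Eij eqxx mulr1; exact: mulrC.
Qed.

End RankOne.

(** At f e h, with e the rank-one element of [a], only the term of [a] survives, and it equals phi
    psi_a(h) X_a psi_a(f) xi. By irreducibility the vectors psi_a(f) xi span, and so do the
    covectors phi psi_a(h). *)
Lemma coef_indep (X : forall a, 'M[CC]_(dim a)) :
  (forall f, \sum_a \tr (X a *m psi a f) = 0) -> forall a, X a = 0.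
Proof.
move=> X0 a; have [rep irr] := Hpsi a; have [dpos irr'] := irr.
pose i0 := Ordinal dpos.
have [e [e0 [phi [phi1 ea]]]] := rank_one_element i0.
pose xi : 'cV[CC]_(dim a) := delta_mx i0 0.
have E f h : phi *m psi a h *m X a *m (psi a f *m xi) = 0.
  have := X0 (f ** e ** h); rewrite (bigD1 a) //= big1 => [|b ba]; last first.
    have [repb _] := Hpsi b.
    by rewrite !drepM // e0 // mulmx0 mul0mx mulmx0 mxtrace0.
  rewrite addr0 !drepM // ea => tr0.
  rewrite [LHS]mx11_scalar; move: tr0; rewrite mulmxA mxtrace_mulC !mulmxA mxtrace_mulC.
  rewrite /mxtrace big_ord1 !mulmxA => ->.
  by rewrite raddf0.
have E1 h : phi *m psi a h *m X a = 0.
  have /row_fullP[C CR] := orbit_mx_full (delta_cV_neq0 i0).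
  apply: trmx_inj; rewrite trmx0 -[LHS]mul1mx -CR -(mulmxA C).
  suff -> : orbit_mx xi *m (phi *m psi a h *m X a)^T = 0 by rewrite mulmx0.
  apply/row_matrixP=> i; rewrite row_mul rowE mul_orbit_mx -trmx_mul E.
  by rewrite trmx0 row0.
pose Ph : 'M[CC]_(n, dim a) := \matrix_i (phi *m psi a (Abas i)).
have PhE f : f *m Ph = phi *m psi a f.
  rewrite (lin_basis f (drep_lin rep)) mulmx_sumr mulmx_sum_row.
  by apply: eq_bigr => i _; rewrite rowK -scalemxAr.
(* The common kernel of the covectors phi psi_a(h) is invariant; it cannot be everything because phi
   has entry 1 at [i0]. *)
have [||] := irr' (kermx Ph^T).
- move=> f; apply/sub_kermxP; rewrite -mulmxA -trmx_mul.
  suff [C ->] : exists C, Ph *m psi a f = C *m Ph by rewrite trmx_mul mulmxA mulmx_ker mul0mx.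
  exists (\matrix_i (Abas i ** f)); apply/row_matrixP=> i.
  by rewrite !row_mul !rowK PhE drepM // mulmxA.
- move=> K0; apply: trmx_inj; rewrite trmx0; apply/eqP; rewrite -submx0 -K0.
  apply/sub_kermxP; rewrite -trmx_mul.
  suff -> : Ph *m X a = 0 by rewrite trmx0.
  by apply/row_matrixP=> i; rewrite row_mul rowE PhE E1 row0.
rewrite -sub1mx => /sub_kermxP; rewrite mul1mx => Ph0.
have : one *m Ph = 0 by rewrite -[Ph]trmxK Ph0 trmx0 mulmx0.
rewrite PhE drep1 // mulmx1 => phi0; move: phi1; rewrite phi0 mxE => /eqP.
by rewrite eq_sym oner_eq0.
Qed.

Definition coef_idx := {a : I & ('I_(dim a) * 'I_(dim a))%type}.

Definition coef (k : coef_idx) f : CC := psi (tag k) f (tagged k).1 (tagged k).2.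

Definition mk_idx a (p : 'I_(dim a) * 'I_(dim a)) : coef_idx :=
  existT (fun a => ('I_(dim a) * 'I_(dim a))%type) a p.

Lemma sum_coef_idx (V : nmodType) (F : coef_idx -> V) :
  \sum_k F k = \sum_a \sum_i \sum_j F (mk_idx (a := a) (i, j)).
Proof.
transitivity (\sum_a \sum_(p : 'I_(dim a) * 'I_(dim a)) F (mk_idx p)).
  by rewrite sig_big_dep; apply: eq_bigr => -[].
by apply: eq_bigr => a _; rewrite pair_bigA; apply: eq_bigr => -[].
Qed.

(** Independence of the matrix coefficients gives their table of values on the basis full column
    rank; a one-sided inverse of it provides the dual elements. *)
Lemma matrix_units : exists E : coef_idx -> 'rV[CC]_n,
  forall k k', coef k' (E k) = (k == k')%:R.
Proof.
pose M : 'M[CC]_(n, #|{: coef_idx}|) := \matrix_(i, k) coef (enum_val k) (Abas i).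
have ME f k : (f *m M) 0 k = coef (enum_val k) f.
  rewrite mxE /coef; have [r _] := Hpsi (tag (enum_val k)).
  rewrite (lin_basis f (drep_lin r)) summxE; apply: eq_bigr => i _.
  by rewrite !mxE.
have /row_freeP[B MB] : row_free M^T.
  rewrite -kermx_eq0; apply/eqP/row_matrixP=> i; rewrite row0.
  set x := row i _.
  have xM : x *m M^T = 0 by apply/sub_kermxP; rewrite row_sub.
  pose X a : 'M[CC]_(dim a) :=
    \matrix_(p, q) x 0 (enum_rank (mk_idx (a := a) (q, p))).
  have X0 : forall a, X a = 0.
    apply: coef_indep => f.
    have : (x *m M^T *m f^T) 0 0 = 0 by rewrite xM mul0mx mxE.
    rewrite -mulmxA -trmx_mul mxE.
    rewrite (reindex_onto enum_rank enum_val) /=; last by move=> k _; rewrite enum_valK.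
    rewrite (eq_bigl predT) => [|k]; last by rewrite enum_rankK eqxx.
    rewrite sum_coef_idx => e; rewrite -[RHS]e; apply: eq_bigr => a _.
    rewrite /mxtrace [RHS]exchange_big; apply: eq_bigr => p _; rewrite mxE; apply: eq_bigr => q _.
    rewrite [X in X * _ = _]mxE; congr (_ * _).
    by rewrite (mxE _ _ (enum_rank _)) ME enum_rankK.
  apply/rowP=> k; rewrite [RHS]mxE.
  have := X0 (tag (enum_val k)) => /matrixP/(_ (tagged (enum_val k)).2 (tagged (enum_val k)).1).
  rewrite [X _ _ _]mxE [(0 : 'M_(_)) _ _]mxE => e; rewrite -[RHS]e -{1}[k]enum_valK.
  congr (x 0 (enum_rank _)).
  by case: (enum_val k) => a [].
exists (fun k => row (enum_rank k) B^T) => k k'.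
have := ME (row (enum_rank k) B^T) (enum_rank k'); rewrite enum_rankK => <-.
rewrite -row_mul -[M]trmxK -trmx_mul MB trmx1 !mxE.
by rewrite (inj_eq enum_rank_inj).
Qed.

Lemma coef_expand E f : (forall k k', coef k' (E k) = (k == k')%:R) ->
  f = \sum_k coef k f *: E k.
Proof.
move=> EE; apply: psi_inj => a; have [r _] := Hpsi a.
rewrite (lin_sum _ _ _ (drep_lin r)); apply/matrixP=> i j.
pose k0 : coef_idx := mk_idx (a := a) (i, j).
rewrite -[LHS]/(coef k0 f) -(sum_delta (coef^~ f) k0) summxE.
apply: eq_bigr => k _; rewrite (linZ _ _ (drep_lin r)) mxE; congr (_ * _).
by rewrite -(EE k k0).
Qed.

(** The [E k] span by faithfulness of the irreps, with coordinates [coef k], so this is the trace of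
    [O] computed on matrix units. *)
Lemma trace_coef E (O : 'rV[CC]_n -> 'rV[CC]_n) :
  (forall k k', coef k' (E k) = (k == k')%:R) -> lin O ->
  \sum_i O (Abas i) 0 i = \sum_k coef k (O (E k)).
Proof.
move=> EE lO.
transitivity (\sum_i \sum_k coef k (O (Abas i)) * E k 0 i).
  apply: eq_bigr => i _; rewrite {1}(coef_expand (O (Abas i)) EE) summxE.
  by apply: eq_bigr => k _; rewrite mxE.
rewrite exchange_big; apply: eq_bigr => k _; rewrite /coef.
have [r _] := Hpsi (tag k); have L := drep_lin r.
rewrite [in RHS](lin_basis (E k) lO) (lin_sum _ _ _ L) summxE; apply: eq_bigr => i _.
by rewrite (linZ _ _ L) mxE mulrC.
Qed.

End Semisimple.

(** * The vacuum *)

Section TraceTensor.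

Lemma sum_single (V : nmodType) (J : finType) (j : J) (F : J -> V) :
  (forall k, k != j -> F k = 0) -> \sum_k F k = F j.
Proof. by move=> F0; rewrite (bigD1 j) //= big1 ?addr0. Qed.

Lemma mxtrace_sum p (J : finType) (F : J -> 'M[CC]_p) :
  \tr (\sum_j F j) = \sum_j \tr (F j).
Proof. exact: raddf_sum. Qed.

Lemma mxtrace_tens p q (A : 'M[CC]_p) (B : 'M[CC]_q) : \tr (A *t B) = \tr A * \tr B.
Proof.
rewrite /mxtrace (reindex (@mxtens_index p q)) /=; last first.
  by exists (@mxtens_unindex p q) => i _; rewrite (mxtens_indexK, mxtens_unindexK).
transitivity (\sum_i \sum_j A i i * B j j).
  by rewrite pair_bigA; apply: eq_bigr => -[i j] _; rewrite tensmxE.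
by rewrite mulr_suml; apply: eq_bigr => i _; rewrite mulr_sumr.
Qed.

Lemma mxtrace_delta p q (i : 'I_p) (j : 'I_q) (X : 'M[CC]_(q, p)) :
  \tr (delta_mx i j *m X) = X j i.
Proof.
rewrite /mxtrace (bigD1 i) //= big1 => [|k ki].
  rewrite addr0 mxE (bigD1 j) //= big1 => [|l lj]; first by rewrite mxE !eqxx mul1r addr0.
  by rewrite mxE (negPf lj) andbF mul0r.
by rewrite mxE big1 // => l _; rewrite mxE (negPf ki) mul0r.
Qed.

Lemma mxtrace_inj p q (X Y : 'M[CC]_(p, q)) :
  (forall M : 'M_(q, p), \tr (M *m X) = \tr (M *m Y)) -> X = Y.
Proof. by move=> e; apply/matrixP=> i j; rewrite -!mxtrace_delta e. Qed.

Lemma delta_tens p q (i j : 'I_p) (k l : 'I_q) :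
  delta_mx i j *t delta_mx k l
  = delta_mx (mxtens_index (i, k)) (mxtens_index (j, l)) :> 'M[CC]_(p * q).
Proof.
apply/matrixP=> x y; rewrite -[x]mxtens_unindexK -[y]mxtens_unindexK.
case: (mxtens_unindex x) (mxtens_unindex y) => [x1 x2] [y1 y2].
rewrite tensmxE !mxE !(inj_eq (can_inj (@mxtens_indexK _ _))) !xpair_eqE -natrM mulnb.
by congr (_%:R); rewrite andbACA.
Qed.

Lemma tensmx1 p q : (1%:M : 'M[CC]_p) *t (1%:M : 'M[CC]_q) = 1%:M.
Proof.
apply/matrixP=> x y; rewrite -[x]mxtens_unindexK -[y]mxtens_unindexK.
case: (mxtens_unindex x) (mxtens_unindex y) => [x1 x2] [y1 y2].
by rewrite tensmxE !mxE !(inj_eq (can_inj (@mxtens_indexK _ _))) !xpair_eqE -natrM mulnb.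
Qed.

Lemma mxtrace_tens_inj p q (X Y : 'M[CC]_(p * q)) :
  (forall A B, \tr ((A *t B) *m X) = \tr ((A *t B) *m Y)) -> X = Y.
Proof.
move=> e; apply/matrixP=> x y.
rewrite -[x]mxtens_unindexK -[y]mxtens_unindexK.
case: (mxtens_unindex x) (mxtens_unindex y) => [i1 i2] [j1 j2].
by rewrite -!mxtrace_delta -delta_tens e.
Qed.

End TraceTensor.

Lemma sw_eq0 n (H : WHAdata n) (V : lmodType CC) x (phi : _ -> _ -> V) :
  (forall a b, phi a b = 0) -> sw H x phi = 0.
Proof.
by move=> p0; rewrite /sw big1 // => i _; rewrite big1 // => j _; rewrite p0 scaler0.
Qed.

Section Vacuum.
Variables (n : nat) (H : WHAdata n).
Hypothesis wh : whopf H.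
Hypothesis Hss : dual_semisimple H.
Variables (I : finType) (dim : I -> nat) (psi : forall a : I, 'rV[CC]_n -> 'M[CC]_(dim a)).
Hypothesis Hpsi : forall a, is_drep H (psi a) /\ dirreducible (psi a).
Hypothesis Hinj : forall a b, drep_equiv (psi a) (psi b) -> a = b.
Variable N : I -> I -> I -> nat.
Variable V : forall a b c, 'I_(N a b c) -> 'M[CC]_(dim a * dim b, dim c).
Variable W : forall a b c, 'I_(N a b c) -> 'M[CC]_(dim c, dim a * dim b).
Hypothesis HVW1 : forall a b f, drep_tens H (psi a) (psi b) f
            = \sum_c \sum_(mu < N a b c) V mu *m psi c f *m W mu.
Hypothesis HVW2 : forall a b c (mu : 'I_(N a b c)), W mu *m V mu = 1%:M.
Hypothesis HVW3 : forall a b c c' (mu : 'I_(N a b c)) (mu' : 'I_(N a b c')),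
            (c, nat_of_ord mu) != (c', nat_of_ord mu') -> W mu *m V mu' = 0.
Variable bv : forall a, 'M[CC]_(dim a).
Hypothesis Hb : forall f, Aev f (wone H) = \sum_a \tr (bv a *m psi a f).
Variables l r : I -> I.
Hypothesis Hl : forall a, bv (l a) != 0 /\
          forall e c, bv e != 0 -> N e a c = ((e == l a) && (a == c)) :> nat.
Hypothesis Hr : forall a, bv (r a) != 0 /\
          forall e c, bv e != 0 -> N a e c = ((e == r a) && (a == c)) :> nat.

Local Notation D := (dualW H).
Local Notation "f ** g" := (Amul D f g) (at level 40, left associativity).
Local Notation one := (wone D).
Local Notation S := (Aanti D).
Local Notation eps := (Aeps D).
Local Notation epst := (epst D).
Local Notation epss := (epss D).
Local Notation "\sw_ ( a , b <- x ) E" := (sw D x (fun a b => E))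
  (at level 36, a name, b name, E at level 36).

Let dwh := dual_whopf wh.
Let mulA := wh_mulA dwh.

Lemma psi_lin a : lin (psi a). Proof. by case: (Hpsi a) => -[]. Qed.
Lemma psi1 a : psi a one = 1%:M. Proof. by case: (Hpsi a) => -[]. Qed.
Lemma psiM a f g : psi a (f ** g) = psi a f *m psi a g.
Proof. by case: (Hpsi a) => rep _; apply: drepM. Qed.

Lemma lin_psi (U : lmodType CC) a (f : U -> 'rV[CC]_n) : lin f -> lin (fun x => psi a (f x)).
Proof. exact: lin_comp (psi_lin a). Qed.

(** The component at e of f |-> f(1), the counit of the dual; it is zero unless e is a vacuum
    label. *)
Definition beta e f : CC := \tr (bv e *m psi e f).

Lemma beta_lin e : lin (beta e : _ -> CC^o).
Proof. apply: lin_mxtrace; apply: lin_mulmxr; exact: psi_lin. Qed.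

Lemma lin_beta (U : lmodType CC) e (f : U -> 'rV[CC]_n) :
  lin f -> lin (fun x => beta e (f x) : CC^o).
Proof. exact: lin_comp (beta_lin e). Qed.

Ltac plin := repeat first [ apply: lin_psi | apply: lin_beta | lin1 ].
Ltac pbilin := split=> ?; plin.
Ltac ptrilin := split; [|split]; move=> ? ?; plin.

Lemma beta0 e f : bv e = 0 -> beta e f = 0.
Proof. by rewrite /beta => ->; rewrite mul0mx mxtrace0. Qed.

Lemma epsE f : eps f = \sum_e beta e f.
Proof. by rewrite Aeps_dual Hb. Qed.

Lemma drep_tensE a b f : drep_tens H (psi a) (psi b) f = \sw_(x, y <- f) (psi a x *t psi b y).
Proof. by rewrite Aev_dual_sw_bilin. Qed.

Lemma drep_tens_tr a b (X : 'M_(dim a)) (Y : 'M_(dim b)) f :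
  \tr ((X *t Y) *m drep_tens H (psi a) (psi b) f)
  = \sw_(x, y <- f) (\tr (X *m psi a x) * \tr (Y *m psi b y) : CC^o).
Proof.
rewrite drep_tensE (sw_app _ (F := fun M => \tr ((X *t Y) *m M) : CC^o)); last by linear.
by apply: eq_sw => x y; rewrite tensmx_mul mxtrace_tens.
Qed.

Lemma drep_tens_V a b c (mu : 'I_(N a b c)) f :
  drep_tens H (psi a) (psi b) f *m V mu = V mu *m psi c f.
Proof.
rewrite HVW1 mulmx_suml (bigD1 c) //= [X in _ + X]big1 => [|c' c'c]; last first.
  rewrite mulmx_suml big1 // => mu' _; rewrite -mulmxA HVW3 ?mulmx0 //.
  by rewrite xpair_eqE (negPf c'c).
rewrite addr0 mulmx_suml (bigD1 mu) //= big1 => [|mu' m]; last first.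
  by rewrite -mulmxA HVW3 ?mulmx0 // xpair_eqE eqxx.
by rewrite addr0 -mulmxA HVW2 mulmx1.
Qed.

Lemma W_drep_tens a b c (mu : 'I_(N a b c)) f :
  W mu *m drep_tens H (psi a) (psi b) f = psi c f *m W mu.
Proof.
rewrite HVW1 mulmx_sumr (bigD1 c) //= [X in _ + X]big1 => [|c' c'c]; last first.
  rewrite mulmx_sumr big1 // => mu' _; rewrite !mulmxA HVW3 ?mul0mx //.
  by rewrite xpair_eqE eq_sym (negPf c'c).
rewrite addr0 mulmx_sumr (bigD1 mu) //= big1 => [|mu' m]; last first.
  by rewrite !mulmxA HVW3 ?mul0mx // xpair_eqE eqxx eq_sym.
by rewrite addr0 !mulmxA HVW2 mul1mx.
Qed.

Lemma drep_tens1_V a b c (mu : 'I_(N a b c)) : drep_tens H (psi a) (psi b) one *m V mu = V mu.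
Proof. by rewrite drep_tens_V psi1 mulmx1. Qed.

Lemma W_drep_tens1 a b c (mu : 'I_(N a b c)) : W mu *m drep_tens H (psi a) (psi b) one = W mu.
Proof. by rewrite W_drep_tens psi1 mul1mx. Qed.

Lemma drep_tens_N0 a b f : (forall c, N a b c = 0%N) -> drep_tens H (psi a) (psi b) f = 0.
Proof.
move=> N0; rewrite HVW1 big1 // => c _; rewrite big1 // => mu.
by move: (ltn_ord mu); rewrite {2}N0.
Qed.

Lemma drep_tens_vacl e a f : bv e != 0 -> e != l a -> drep_tens H (psi e) (psi a) f = 0.
Proof.
move=> be ela; apply: drep_tens_N0 => c; have [_ ->] := Hl a => //.
by rewrite (negPf ela).
Qed.

Lemma drep_tens_vacr a e f : bv e != 0 -> e != r a -> drep_tens H (psi a) (psi e) f = 0.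
Proof.
move=> be era; apply: drep_tens_N0 => c; have [_ ->] := Hr a => //.
by rewrite (negPf era).
Qed.

(** For a vacuum e other than l_a, the tensor product W_e (x) W_a carries the zero representation.
    As the beta_e sum to the counit, the one remaining term has to give psi_a(1). *)
Lemma sw_beta_l e a : \sw_(x, y <- one) (beta e x *: psi a y) = ((e == l a)%:R)%:M.
Proof.
have Z e' : e' != l a -> \sw_(x, y <- one) (beta e' x *: psi a y) = 0.
  move=> ne; have [be|be] := eqVneq (bv e') 0.
    by apply: sw_eq0 => x y; rewrite beta0 // scale0r.
  apply: mxtrace_inj => M; rewrite mulmx0 mxtrace0.
  rewrite (sw_app _ (F := fun X => \tr (M *m X) : CC^o)); last by linear.
  transitivity (\tr ((bv e' *t M) *m drep_tens H (psi e') (psi a) one)).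
    rewrite drep_tens_tr; apply: eq_sw => x y; by rewrite -scalemxAr mxtraceZ.
  by rewrite drep_tens_vacl // mulmx0 mxtrace0.
have [->|/Z ->] := eqVneq e (l a); last by rewrite raddf0.
rewrite -[RHS](psi1 a) -[RHS](sw_counitl dwh _ (phi := psi a)); last exact: psi_lin.
transitivity (\sum_e' \sw_(x, y <- one) (beta e' x *: psi a y)).
  by rewrite (bigD1 (l a)) //= big1 ?addr0.
rewrite -sw_sum; apply: eq_sw => x y; by rewrite epsE scaler_suml.
Qed.

Lemma sw_beta_r e a : \sw_(x, y <- one) (beta e y *: psi a x) = ((e == r a)%:R)%:M.
Proof.
have Z e' : e' != r a -> \sw_(x, y <- one) (beta e' y *: psi a x) = 0.
  move=> ne; have [be|be] := eqVneq (bv e') 0.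
    by apply: sw_eq0 => x y; rewrite beta0 // scale0r.
  apply: mxtrace_inj => M; rewrite mulmx0 mxtrace0.
  rewrite (sw_app _ (F := fun X => \tr (M *m X) : CC^o)); last by linear.
  transitivity (\tr ((M *t bv e') *m drep_tens H (psi a) (psi e') one)).
    rewrite drep_tens_tr; apply: eq_sw => x y; by rewrite -scalemxAr mxtraceZ mulrC.
  by rewrite drep_tens_vacr // mulmx0 mxtrace0.
have [->|/Z ->] := eqVneq e (r a); last by rewrite raddf0.
rewrite -[RHS](psi1 a) -[RHS](sw_counitr dwh _ (phi := psi a)); last exact: psi_lin.
transitivity (\sum_e' \sw_(x, y <- one) (beta e' y *: psi a x)).
  by rewrite (bigD1 (r a)) //= big1 ?addr0.
rewrite -sw_sum; apply: eq_sw => x y; by rewrite epsE scaler_suml.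
Qed.

Lemma sw_beta_l_app (U : lmodType CC) e a (F : 'M[CC]_(dim a) -> U) : lin F ->
  \sw_(x, y <- one) (beta e x *: F (psi a y)) = (e == l a)%:R *: F 1%:M.
Proof.
move=> lF; rewrite -(linZ _ _ lF) scale_scalar_mx mulr1 -sw_beta_l (sw_app _ (F := F)) //.
by apply: eq_sw => x y; rewrite linZ.
Qed.

Lemma sw_beta_r_app (U : lmodType CC) e a (F : 'M[CC]_(dim a) -> U) : lin F ->
  \sw_(x, y <- one) (beta e y *: F (psi a x)) = (e == r a)%:R *: F 1%:M.
Proof.
move=> lF; rewrite -(linZ _ _ lF) scale_scalar_mx mulr1 -sw_beta_r (sw_app _ (F := F)) //.
by apply: eq_sw => x y; rewrite linZ.
Qed.

(** The multiplicity N(l_e, e, e) is read twice, by the left and by the right vacuum rule. *)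
Lemma vac_l e : bv e != 0 -> l e = e.
Proof.
move=> be; have [bl /(_ _ e bl) N1] := Hl e; have [_ /(_ _ e be)] := Hr (l e).
by rewrite N1 !eqxx => /esym/eqP; rewrite eqb1 => /andP[_ /eqP].
Qed.

Lemma vac_r e : bv e != 0 -> r e = e.
Proof.
move=> be; have [br /(_ _ e br) N1] := Hr e; have [_ /(_ _ e be)] := Hl (r e).
by rewrite N1 !eqxx => /esym/eqP; rewrite eqb1 => /andP[_ /eqP].
Qed.

Lemma l_vac a : bv (l a) != 0. Proof. by case: (Hl a). Qed.
Lemma r_vac a : bv (r a) != 0. Proof. by case: (Hr a). Qed.

(** The double coproduct of 1 lets a counit be inserted between the two legs, where it splits into
    the beta_e. A vacuum e different from r_a is killed against the left strand, and e = r_a, being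
    different from l_b, against the right one. *)
Lemma drep_tens1_eq0 a b : r a != l b -> drep_tens H (psi a) (psi b) one = 0.
Proof.
move=> rl; apply: mxtrace_tens_inj => X Y; rewrite mulmx0 mxtrace0 drep_tens_tr.
transitivity (\sw_(x, y <- one) \sw_(c, d <- x)
    (eps d *: (\tr (X *m psi a c) * \tr (Y *m psi b y)) : CC^o)).
  apply: eq_sw => x y.
  by rewrite (sw_counitr dwh _ (phi := fun u => \tr (X *m psi a u) * \tr (Y *m psi b y) : CC^o)) //; plin.
rewrite (sw_one3l dwh (phi := fun c d y =>
  (eps d *: (\tr (X *m psi a c) * \tr (Y *m psi b y)) : CC^o))); last by ptrilin.
transitivity (\sum_e \sw_(x, y <- one) \sw_(c, d <- one)
   (beta e (y ** c) * (\tr (X *m psi a x) * \tr (Y *m psi b d)) : CC^o)).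
  rewrite -sw_sum; apply: eq_sw => x y; rewrite -sw_sum; apply: eq_sw => c d.
  by rewrite epsE scaleCC mulr_suml.
apply: big1 => e _; have [be|be] := eqVneq (bv e) 0.
  by apply: sw_eq0 => x y; apply: sw_eq0 => c d; rewrite beta0 // mul0r.
have [er|er] := eqVneq e (r a).
  have el : e != l b by rewrite er.
  apply: sw_eq0 => x y.
  transitivity (\tr (X *m psi a x) * \tr (((bv e *m psi e y) *t Y) *m drep_tens H (psi e) (psi b) one)).
    rewrite drep_tens_tr sw_mulCl; apply: eq_sw => c d.
    by rewrite /beta psiM mulmxA mulrCA.
  by rewrite drep_tens_vacl // mulmx0 mxtrace0 mulr0.
rewrite sw_exch.
apply: sw_eq0 => c d.
transitivity (\tr (Y *m psi b d) * \tr ((X *t (psi e c *m bv e)) *m drep_tens H (psi a) (psi e) one)).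
  rewrite drep_tens_tr sw_mulCl; apply: eq_sw => x y.
  by rewrite /beta psiM mulmxA [\tr (_ *m psi e c)]mxtrace_mulC mulmxA mulrCA mulrC -mulrA mulrC mulrA.
by rewrite drep_tens_vacr // mulmx0 mxtrace0 mulr0.
Qed.

Lemma dim_gt0 a : (0 < dim a)%N. Proof. by case: (Hpsi a) => _ []. Qed.

Lemma mx1_neq0 a : (1%:M : 'M[CC]_(dim a)) != 0.
Proof.
apply/eqP=> /matrixP/(_ (Ordinal (dim_gt0 a)) (Ordinal (dim_gt0 a))).
by rewrite !mxE eqxx => /eqP; rewrite oner_eq0.
Qed.

Lemma V_neq0 a b c (mu : 'I_(N a b c)) : V mu != 0.
Proof.
apply: contraNneq (mx1_neq0 c) => V0; by rewrite -(HVW2 mu) V0 mulmx0.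
Qed.

Lemma fusion_rl a b c (mu : 'I_(N a b c)) : r a = l b.
Proof.
apply/eqP; apply: contraNT (V_neq0 mu) => rl.
by rewrite -(drep_tens1_V mu) drep_tens1_eq0 // mul0mx.
Qed.

(** Let beta_{l_c}(1_(1)) 1_(2) act on the range of V: seen in W_c it is the identity, while seen in
    W_a (x) W_b it touches only W_a and vanishes unless l_c = l_a. *)
Lemma fusion_l a b c (mu : 'I_(N a b c)) : l c = l a.
Proof.
apply/eqP; apply: contraNT (V_neq0 mu) => la; apply/eqP.
transitivity (\sw_(x, y <- one) (beta (l c) x *: (V mu *m psi c y))).
  by rewrite (sw_beta_l_app _ (F := fun M => V mu *m M)) ?eqxx ?scale1r ?mulmx1 //; linear.
transitivity ((\sw_(x, y <- one) \sw_(p, q <- y) (beta (l c) x *: (psi a p *t psi b q))) *m V mu).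
  rewrite (sw_app _ (F := fun M => M *m V mu)); last by linear.
  apply: eq_sw => x y; rewrite sw_scaler -drep_tensE -scalemxAl; by rewrite drep_tens_V.
rewrite -(sw_coassoc dwh _ (fun x p q => beta (l c) x *: (psi a p *t psi b q))).
rewrite (sw_one3l dwh (phi := fun x p q => beta (l c) x *: (psi a p *t psi b q))); last by ptrilin.
rewrite sw_exch.
suff -> : \sw_(p, q <- one) \sw_(x, y <- one) (beta (l c) x *: (psi a (y ** p) *t psi b q)) = 0.
  by rewrite mul0mx.
apply: sw_eq0 => p q.
transitivity (\sw_(x, y <- one) (beta (l c) x *: ((psi a y *m psi a p) *t psi b q))).
  by apply: eq_sw => x y; rewrite psiM.
rewrite (sw_beta_l_app _ (F := fun M => (M *m psi a p) *t psi b q)); last by linear.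
by rewrite (negPf la) scale0r.
Qed.

Lemma fusion_r a b c (mu : 'I_(N a b c)) : r c = r b.
Proof.
apply/eqP; apply: contraNT (V_neq0 mu) => rb; apply/eqP.
transitivity (\sw_(x, y <- one) (beta (r c) y *: (V mu *m psi c x))).
  by rewrite (sw_beta_r_app _ (F := fun M => V mu *m M)) ?eqxx ?scale1r ?mulmx1 //; linear.
transitivity ((\sw_(x, y <- one) \sw_(p, q <- x) (beta (r c) y *: (psi a p *t psi b q))) *m V mu).
  rewrite (sw_app _ (F := fun M => M *m V mu)); last by linear.
  apply: eq_sw => x y; rewrite sw_scaler -drep_tensE -scalemxAl; by rewrite drep_tens_V.
rewrite (sw_one3l dwh (phi := fun p q y => beta (r c) y *: (psi a p *t psi b q))); last by ptrilin.
suff -> : \sw_(p, q <- one) \sw_(x, y <- one) (beta (r c) y *: (psi a p *t psi b (q ** x))) = 0.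
  by rewrite mul0mx.
apply: sw_eq0 => p q.
transitivity (\sw_(x, y <- one) (beta (r c) y *: (psi a p *t (psi b q *m psi b x)))).
  by apply: eq_sw => x y; rewrite psiM.
rewrite (sw_beta_r_app _ (F := fun M => psi a p *t (psi b q *m M))); last by linear.
by rewrite (negPf rb) scale0r.
Qed.

(** Apply beta_e to both legs of [sw_one_target]; since l_e = e = r_e, the leg without the target
    element is absorbed by [sw_beta_l] on one side and [sw_beta_r] on the other. *)
Lemma beta_S_epst e x : beta e (S (epst x)) = beta e (epst x).
Proof.
have [be|be] := eqVneq (bv e) 0; first by rewrite !beta0.
have := sw_one_target dwh x (phi := fun u v => beta e u * beta e v : CC^o).
have -> : \sw_(a, b <- one) (beta e a * beta e (epst x ** b) : CC^o) = beta e (epst x).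
  transitivity (\sw_(a, b <- one) (beta e a *: (\tr (bv e *m psi e (epst x) *m psi e b) : CC^o))).
    by apply: eq_sw => a b; rewrite {2}/beta psiM mulmxA.
  rewrite (sw_beta_l_app _ (F := fun M => \tr (bv e *m psi e (epst x) *m M) : CC^o)); last by linear.
  by rewrite vac_l // eqxx scale1r mulmx1.
have -> : \sw_(a, b <- one) (beta e (S (epst x) ** a) * beta e b : CC^o) = beta e (S (epst x)).
  transitivity (\sw_(a, b <- one) (beta e b *: (\tr (bv e *m psi e (S (epst x)) *m psi e a) : CC^o))).
    by apply: eq_sw => a b; rewrite {1}/beta psiM mulmxA mulrC.
  rewrite (sw_beta_r_app _ (F := fun M => \tr (bv e *m psi e (S (epst x)) *m M) : CC^o)); last by linear.
  by rewrite vac_r // eqxx scale1r mulmx1.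
by move=> -> //; pbilin.
Qed.

Lemma beta_neq0 e : bv e != 0 -> exists f, beta e f != 0.
Proof.
move=> be; pose X a : 'M[CC]_(dim a) := if a == e then bv a else 0.
pose P f := beta e f != 0.
have [|none] := boolP [exists i, P (Abas i)]; first by case/existsP=> i Pi; exists (Abas i).
case/negP: be; apply/eqP.
have XE f : \sum_a \tr (X a *m psi a f) = beta e f.
  rewrite (bigD1 e) //= big1 => [|a ae]; first by rewrite /X eqxx addr0.
  by rewrite /X (negPf ae) mul0mx mxtrace0.
have X0 f : \sum_a \tr (X a *m psi a f) = 0.
  rewrite XE (lin_basis f (beta_lin e)) big1 // => i _.
  by move/existsPn/(_ i): none; rewrite negbK => /eqP ->; rewrite scaler0.
by have := coef_indep wh Hss Hpsi Hinj X0 e; rewrite /X eqxx.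
Qed.

(** A probe: evaluating a combination of the beta_e' there returns the coefficient at e. The witness
    is beta_e(f 1_(1)) / beta_e(f) 1_(2) for any f with beta_e(f) nonzero. *)
Lemma target_dual e : bv e != 0 -> exists x, forall e', beta e' (epst x) = (e' == e)%:R.
Proof.
move=> be; have [f bf] := beta_neq0 be.
exists (\sw_(a, b <- one) ((beta e (f ** a) / beta e f) *: b)) => e'.
rewrite (sw_app _ (F := fun u => beta e' (epst u) : CC^o)); last by plin.
transitivity (\sw_(a, b <- one) (beta e (f ** a) / beta e f * beta e' (epst b) : CC^o)).
  by apply: eq_sw => a b; rewrite (linZ (f := fun u => beta e' (epst u) : CC^o)) //; plin.
rewrite (sw_one_epst dwh (phi := fun a b => beta e (f ** a) / beta e f * beta e' b : CC^o)); last by pbilin.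
transitivity (\sw_(a, b <- one) (beta e' b *: (\tr (bv e *m psi e f *m psi e a) / beta e f : CC^o))).
  by apply: eq_sw => a b; rewrite {1}/beta psiM mulmxA mulrC.
rewrite (sw_beta_r_app _ (F := fun M => \tr (bv e *m psi e f *m M) / beta e f : CC^o)); last by linear.
by rewrite vac_r // mulmx1 -/(beta e f) divff // scaleCC mulr1.
Qed.

Lemma source_dual e : bv e != 0 -> exists x, forall e', beta e' (epss x) = (e' == e)%:R.
Proof.
move=> be; have [f bf] := beta_neq0 be.
exists (\sw_(a, b <- one) ((beta e (f ** b) / beta e f) *: a)) => e'.
rewrite (sw_app _ (F := fun u => beta e' (epss u) : CC^o)); last by plin.
transitivity (\sw_(a, b <- one) (beta e (f ** b) / beta e f * beta e' (epss a) : CC^o)).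
  by apply: eq_sw => a b; rewrite (linZ (f := fun u => beta e' (epss u) : CC^o)) //; plin.
rewrite (sw_one_epss dwh (phi := fun a b => beta e (f ** b) / beta e f * beta e' a : CC^o)); last by pbilin.
transitivity (\sw_(a, b <- one) (beta e' a *: (\tr (bv e *m psi e f *m psi e b) / beta e f : CC^o))).
  by apply: eq_sw => a b; rewrite {1}/beta psiM mulmxA mulrC.
rewrite (sw_beta_l_app _ (F := fun M => \tr (bv e *m psi e f *m M) / beta e f : CC^o)); last by linear.
by rewrite vac_l // mulmx1 -/(beta e f) divff // scaleCC mulr1.
Qed.

(** * Conjugation and the action of g on the fusion spaces *)

Variables (u : forall a, 'rV[CC]_(dim a)) (v : forall a, 'cV[CC]_(dim a)).
Hypothesis Huv : forall e, bv e != 0 -> bv e = v e *m u e.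
Variables (bar : I -> I) (bb : forall a, bar (bar a) = a).
Variable Z : forall a, 'M[CC]_(dim a, dim (bar a)).
Variable Zi : forall a, 'M[CC]_(dim (bar a), dim a).
Hypothesis HZ : forall a, Z a *m Zi a = 1%:M /\ Zi a *m Z a = 1%:M /\
          forall f, (psi a (Danti H f))^T = Z a *m psi (bar a) f *m Zi a.
Variable w : I -> CC.
Hypothesis Hw : forall c, N (bar c) c (r c) = 1%N /\ w c != 0 /\
          forall mu : 'I_(N (bar c) c (r c)),
            theta_of (castmx (congr1 dim (bb c), erefl) (Zi (bar c)))
              *m zeta_of (Z c)
            = w c *: ((V mu *m v (r c)) *m (u (r c) *m W mu)).
Variable d : I -> CC.
Hypothesis Hd : forall a, d a ^+ 2 = w a * w (bar a) /\ d a = d (bar a).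
Variable g : 'rV[CC]_n.
Hypothesis Hg : forall a, psi a g = (d a / w (bar a)) *:
          ((Zi a)^T *m castmx (erefl, congr1 dim (bb a)) (Z (bar a))).

Section Cast.
Variables (a a' : I) (E : bar a = a').

(* [Z a] and [Zi a] with [bar a] replaced by an equal index, so that statements
   about a pair of conjugate indices become symmetric. *)
Definition Zc : 'M[CC]_(dim a, dim a') := castmx (erefl, congr1 dim E) (Z a).
Definition Zic : 'M[CC]_(dim a', dim a) := castmx (congr1 dim E, erefl) (Zi a).

Lemma ZcK : Zc *m Zic = 1%:M.
Proof. by rewrite /Zc /Zic; case: a' / E; rewrite !castmx_id; case: (HZ a). Qed.

Lemma ZicK : Zic *m Zc = 1%:M.
Proof. by rewrite /Zc /Zic; case: a' / E; rewrite !castmx_id; case: (HZ a) => _ []. Qed.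

Lemma psi_S f : (psi a (S f))^T = Zc *m psi a' f *m Zic.
Proof. by rewrite /Zc /Zic; case: a' / E; rewrite !castmx_id; exact: (HZ a).2.2. Qed.

End Cast.

Lemma conj_fusion c c' (E : bar c = c') (E' : bar c' = c) :
  exists mu : 'I_(N c' c (r c)),
    theta_of (Zic E') *m zeta_of (Zc E) = w c *: ((V mu *m v (r c)) *m (u (r c) *m W mu)).
Proof.
(* Equality proofs on [I] are unique, so the transport agrees with the one in the hypothesis on [w];
   the multiplicity being 1, the channel is [ord0]. *)
case: c' / E E' => E'; rewrite (eq_irrelevance E' (bb c)).
have [N1 [_ eq]] := Hw c.
exists (cast_ord (esym N1) ord0); rewrite -eq /Zic /Zc castmx_id; by [].
Qed.

Lemma w_neq0 a : w a != 0. Proof. by case: (Hw a) => _ []. Qed.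

Lemma d_neq0 a : d a != 0.
Proof.
have [d2 _] := Hd a; apply/eqP=> d0; move: d2; rewrite d0 expr0n /= => /esym/eqP.
by rewrite mulf_eq0 !(negPf (w_neq0 _)).
Qed.

Lemma d_divK a b : d a / d b * d b = d a.
Proof. by rewrite divfK // d_neq0. Qed.

Lemma zeta_ofE dc dcb (M : 'M[CC]_(dc, dcb)) i j : zeta_of M 0 (mxtens_index (i, j)) = M j i.
Proof.
rewrite /zeta_of summxE -(sum_delta (fun k => M j k) i); apply: eq_bigr => k _.
rewrite summxE -(sum_delta (fun q => M q k * (k == i)%:R) j); apply: eq_bigr => q _.
rewrite [LHS]mxE -mulrA; congr (_ * _); rewrite mxE mxtens_indexK !mxE !ord1 !eqxx /=.
by rewrite -natrM mulnb (eq_sym i) (eq_sym j) -natrM mulnb.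
Qed.

Lemma theta_ofE dc dcb (M : 'M[CC]_(dc, dcb)) i j : theta_of M (mxtens_index (i, j)) 0 = M j i.
Proof.
rewrite /theta_of summxE -(sum_delta (fun k => M j k) i); apply: eq_bigr => k _.
rewrite summxE -(sum_delta (fun q => M q k * (k == i)%:R) j); apply: eq_bigr => q _.
rewrite [LHS]mxE -mulrA; congr (_ * _); rewrite mxE mxtens_indexK !mxE !ord1 !eqxx !andbT /=.
by rewrite -natrM mulnb (eq_sym i) (eq_sym j) -natrM mulnb.
Qed.

Lemma sum_mxtens p q (F : 'I_(p * q) -> CC) :
  \sum_k F k = \sum_i \sum_j F (mxtens_index (i, j)).
Proof.
rewrite (reindex (@mxtens_index p q)) /=; last first.
  by exists (@mxtens_unindex p q) => i _; rewrite (mxtens_indexK, mxtens_unindexK).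
by rewrite pair_bigA; apply: eq_bigr => -[].
Qed.

(** The cup theta and the cap zeta bend one strand back, so a trace over two strands becomes a
    single loop, with the operator of the bent strand transposed. *)
Lemma tr_theta_zeta dc dcb (M Y : 'M[CC]_(dc, dcb)) (P : 'M_dcb) (Q : 'M_dc) :
  \tr ((P *t Q) *m (theta_of M *m zeta_of Y)) = \tr (Y *m (P *m M^T *m Q^T)).
Proof.
rewrite mulmxA mxtrace_mulC /mxtrace big_ord1 mxE sum_mxtens exchange_big.
apply: eq_bigr => j _; rewrite mxE; apply: eq_bigr => i _.
rewrite zeta_ofE; congr (_ * _); rewrite mxE sum_mxtens exchange_big mxE.
apply: eq_bigr => l0 _; rewrite !mxE mulr_suml; apply: eq_bigr => k _.
by rewrite theta_ofE tensmxE !mxE mulrAC.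
Qed.

(** * Twisted traces on the target and source subalgebras *)

Lemma drep_tens_epst a b x :
  drep_tens H (psi a) (psi b) (epst x)
  = (psi a (epst x) *t 1%:M) *m drep_tens H (psi a) (psi b) one.
Proof.
rewrite !drep_tensE (sw_epst_l dwh); last by pbilin.
rewrite (sw_app _ (F := fun M => (psi a (epst x) *t 1%:M) *m M)); last by linear.
by apply: eq_sw => p q; rewrite psiM tensmx_mul mul1mx.
Qed.

Lemma epst_V a b c (mu : 'I_(N a b c)) x :
  (psi a (epst x) *t 1%:M) *m V mu = V mu *m psi c (epst x).
Proof. by rewrite -drep_tens_V drep_tens_epst -mulmxA drep_tens1_V. Qed.

(** Only the rule Delta(z) = 1_(1) (x) z 1_(2), seen through pairs of irreps, matters below; stated
    as a predicate it covers values of the source map as well as S of values of the target map. *)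
Definition source z := forall a b, drep_tens H (psi a) (psi b) z
  = (1%:M *t psi b z) *m drep_tens H (psi a) (psi b) one.

Lemma source_epss x : source (epss x).
Proof.
move=> a b; rewrite !drep_tensE (sw_epss_l dwh); last by pbilin.
rewrite (sw_app _ (F := fun M => (1%:M *t psi b (epss x)) *m M)); last by linear.
by apply: eq_sw => p q; rewrite psiM tensmx_mul mul1mx.
Qed.

Lemma source_S_epst x : source (S (epst x)).
Proof.
move=> a b; rewrite !drep_tensE (dual_sw_S wh); last by pbilin.
rewrite (sw_epst_r dwh); last by pbilin.
rewrite (sw_app _ (F := fun M => (1%:M *t psi b (S (epst x))) *m M)); last by linear.
rewrite -{2}(S_one dwh) (dual_sw_S wh); last by pbilin.
by apply: eq_sw => p q; rewrite (S_mul dwh) psiM tensmx_mul mul1mx.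
Qed.

Lemma source_V a b c (mu : 'I_(N a b c)) z : source z ->
  (1%:M *t psi b z) *m V mu = V mu *m psi c z.
Proof. by move=> sz; rewrite -drep_tens_V sz -mulmxA drep_tens1_V. Qed.

Lemma r_bar a : r (bar a) = l a.
Proof.
have [mu _] := conj_fusion (bb a) erefl.
by rewrite -(fusion_l mu) vac_l // r_vac.
Qed.

Lemma tr_vac e p (A : 'M[CC]_(p, dim e)) (B : 'M[CC]_(dim e, p)) (X : 'M_p) f :
  bv e != 0 -> X *m A = A *m psi e f -> B *m A = 1%:M ->
  \tr (X *m ((A *m v e) *m (u e *m B))) = beta e f.
Proof.
move=> be XA BA; rewrite /beta (Huv be).
have -> : X *m (A *m v e *m (u e *m B)) = A *m (psi e f *m (v e *m u e) *m B).
  by rewrite !mulmxA XA.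
by rewrite mxtrace_mulC -(mulmxA _ B A) BA mulmx1 mxtrace_mulC.
Qed.

(** The theta-zeta relation for the product a (x) bar a turns the loop of Z matrices into w_{bar a}
    times a vacuum trace; the denominator in g cancels w_{bar a} and leaves d_a. *)
Lemma tr_g_epst a x : \tr (psi a g *m psi a (epst x)) = d a * beta (l a) (epst x).
Proof.
have [mu eq] := conj_fusion (bb a) erefl.
have := tr_theta_zeta (Zic (erefl (bar a))) (Zc (bb a)) (psi a (epst x)) 1%:M.
rewrite eq trmx1 mulmx1 -scalemxAr mxtraceZ.
rewrite (tr_vac (r_vac _) (epst_V mu x) (HVW2 mu)) r_bar => E.
rewrite Hg -scalemxAl mxtraceZ -mulmxA mxtrace_mulC -mulmxA.
have -> : (Zi a)^T = (Zic (erefl (bar a)))^T by rewrite /Zic castmx_id.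
by rewrite -/(Zc (bb a)) -E mulrA divfK // w_neq0.
Qed.

(** The inverse of psi_a(g): the scalars cancel because d_a^2 = w_a w_{bar a}. *)
Definition gi a := (d a / w a) *: (Zic (bb a) *m (Z a)^T).

Lemma tr_gi_source a z : source z -> \tr (gi a *m psi a z) = d a * beta (r a) z.
Proof.
move=> sz; have [mu eq] := conj_fusion (erefl (bar a)) (bb a).
have := tr_theta_zeta (Zic (bb a)) (Zc (erefl (bar a))) 1%:M (psi a z).
rewrite eq mul1mx -scalemxAr mxtraceZ.
rewrite (tr_vac (r_vac _) (source_V mu sz) (HVW2 mu)) => E.
rewrite /gi -scalemxAl mxtraceZ.
have -> : \tr (Zic (bb a) *m (Z a)^T *m psi a z) = w a * beta (r a) z.
  by rewrite E -[RHS]mxtrace_tr !trmx_mul !trmxK /Zc castmx_id [LHS]mxtrace_mulC mulmxA.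
by rewrite mulrA divfK // w_neq0.
Qed.

Lemma g_gi a : psi a g *m gi a = 1%:M.
Proof.
rewrite Hg /gi -scalemxAl -scalemxAr scalerA.
have -> : d a / w (bar a) * (d a / w a) = 1.
  have [d2 _] := Hd a.
  rewrite mulrACA -expr2 d2 -invfM [w (bar a) * _]mulrC divff //.
  by rewrite mulf_neq0 // w_neq0.
rewrite scale1r mulmxA -(mulmxA (Zi a)^T) -/(Zc (bb a)) ZcK mulmx1 -trmx_mul.
by case: (HZ a) => -> _; rewrite trmx1.
Qed.

Lemma gi_g a : gi a *m psi a g = 1%:M.
Proof. exact: mulmx1C (g_gi a). Qed.

(** Using the conjugation relation at a and then at bar a conjugates psi_a(f) by the matrix that g
    is a multiple of. *)
Lemma psi_SS a f : psi a (S (S f)) *m psi a g = psi a g *m psi a f.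
Proof.
have -> : psi a (S (S f)) = (Zi a)^T *m Zc (bb a) *m psi a f *m (Zic (bb a) *m (Z a)^T).
  apply: trmx_inj; rewrite (psi_S (erefl (bar a))) /Zc castmx_id /Zic castmx_id.
  rewrite -[psi (bar a) (S f)]trmxK (psi_S (bb a)) !trmx_mul !trmxK.
  by rewrite /Zc /Zic !mulmxA.
have gM : psi a g = (d a / w (bar a)) *: ((Zi a)^T *m Zc (bb a)) by rewrite Hg.
have GK : Zic (bb a) *m (Z a)^T *m ((Zi a)^T *m Zc (bb a)) = 1%:M.
  rewrite -mulmxA (mulmxA (Z a)^T) -trmx_mul.
  by case: (HZ a) => _ [-> _]; rewrite trmx1 mul1mx ZicK.
by rewrite gM -scalemxAr -scalemxAl -(mulmxA (_ *m psi a f)) GK mulmx1.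
Qed.

Lemma gi_SS a f : gi a *m psi a (S (S f)) = psi a f *m gi a.
Proof.
by rewrite -[psi a (S (S f))]mulmx1 -(g_gi a) (mulmxA _ (psi a g)) psi_SS !mulmxA gi_g mul1mx.
Qed.

Lemma S_SS_one : S (S one) = one.
Proof. by rewrite !(S_one dwh). Qed.

Lemma sw_SS (U : lmodType CC) f (phi : _ -> _ -> U) : bilin phi ->
  sw D (S (S f)) phi = \sw_(x, y <- f) phi (S (S x)) (S (S y)).
Proof.
move=> bp; rewrite (dual_sw_S wh) // (dual_sw_S wh _ (phi := fun x y => phi (S y) (S x))) //.
by bilinear.
Qed.

Definition gg a b := psi a g *t psi b g.
Definition gigi a b := gi a *t gi b.

Lemma drep_tens_gg a b f : drep_tens H (psi a) (psi b) (S (S f)) *m gg a b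
  = gg a b *m drep_tens H (psi a) (psi b) f.
Proof.
rewrite !drep_tensE sw_SS; last by pbilin.
rewrite (sw_app _ (F := fun M => M *m gg a b)); last by linear.
rewrite (sw_app _ (F := fun M => gg a b *m M)); last by linear.
by apply: eq_sw => x y; rewrite /gg !tensmx_mul !psi_SS.
Qed.

Lemma gg_gigi a b : gg a b *m gigi a b = 1%:M.
Proof. by rewrite /gg /gigi tensmx_mul !g_gi tensmx1. Qed.

Lemma gigi_gg a b : gigi a b *m gg a b = 1%:M.
Proof. exact: mulmx1C (gg_gigi a b). Qed.

Lemma gigi_drep_tens a b f : gigi a b *m drep_tens H (psi a) (psi b) (S (S f))
  = drep_tens H (psi a) (psi b) f *m gigi a b.
Proof.
rewrite -[drep_tens _ _ _ (S _)]mulmx1 -(gg_gigi a b) (mulmxA _ (gg a b)) drep_tens_gg.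
by rewrite !mulmxA gigi_gg mul1mx.
Qed.

Lemma psi_intertwiner_eq0 a b (T : 'M[CC]_(dim a, dim b)) :
  a != b -> (forall f, psi a f *m T = T *m psi b f) -> T = 0.
Proof.
move=> ab comm; have [_ ia] := Hpsi a; have [_ ib] := Hpsi b.
have [//|[T' TT' T'T]] := schur ia ib comm.
by case/eqP: ab; apply: Hinj; exists T, T'.
Qed.

Definition i0 a : 'I_(dim a) := Ordinal (dim_gt0 a).

Lemma psi_endo a (T : 'M[CC]_(dim a)) :
  (forall f, psi a f *m T = T *m psi a f) -> T = (T (i0 a) (i0 a))%:M.
Proof.
by move=> comm; have [_ ia] := Hpsi a; have [k ->] := schur_scalar ia comm; rewrite !mxE eqxx.
Qed.

(* Matrix of V |-> (g (x) g) V g^-1 on the fusion space Hom(c, a (x) b): by Schur's lemma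
   the operators below are scalar, and the scalar is read off their [i0, i0] entry. *)
Definition alpha a b c (mu nu : 'I_(N a b c)) : CC :=
  (gi c *m (W mu *m gg a b *m V nu)) (i0 c) (i0 c).
Definition alpha' a b c (mu nu : 'I_(N a b c)) : CC :=
  (psi c g *m (W mu *m gigi a b *m V nu)) (i0 c) (i0 c).

(** [gg a b] introduces S^2 and [gi c] removes it, so the composite is a genuine intertwiner W_c' ->
    W_c, to which Schur's lemma applies. *)
Lemma gi_W_gg_V a b c c' (mu : 'I_(N a b c)) (nu : 'I_(N a b c')) f :
  psi c f *m (gi c *m (W mu *m gg a b *m V nu))
  = gi c *m (W mu *m gg a b *m V nu) *m psi c' f.
Proof.
rewrite mulmxA -gi_SS -!mulmxA; congr (_ *m _).
by rewrite mulmxA -W_drep_tens -drep_tens_V -!mulmxA (mulmxA _ (gg a b)) drep_tens_gg !mulmxA.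
Qed.

Lemma g_W_gigi_V a b c c' (mu : 'I_(N a b c)) (nu : 'I_(N a b c')) f :
  psi c (S (S f)) *m (psi c g *m (W mu *m gigi a b *m V nu))
  = psi c g *m (W mu *m gigi a b *m V nu) *m psi c' (S (S f)).
Proof.
rewrite mulmxA psi_SS -!mulmxA; congr (_ *m _).
by rewrite -drep_tens_V (mulmxA (gigi a b)) gigi_drep_tens !mulmxA W_drep_tens.
Qed.

Lemma SS_surj f : exists h, S (S h) = f.
Proof. by exists (Sinv D (Sinv D f)); rewrite !(SinvK dwh). Qed.

Lemma W_gg_V a b c (mu nu : 'I_(N a b c)) :
  W mu *m gg a b *m V nu = alpha mu nu *: psi c g.
Proof.
have := psi_endo (gi_W_gg_V mu nu); rewrite -/(alpha mu nu) => E.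
by rewrite -mul_mx_scalar -E (mulmxA (psi c g)) g_gi mul1mx.
Qed.

Lemma W_gigi_V a b c (mu nu : 'I_(N a b c)) :
  W mu *m gigi a b *m V nu = alpha' mu nu *: gi c.
Proof.
have comm f : psi c f *m (psi c g *m (W mu *m gigi a b *m V nu))
  = psi c g *m (W mu *m gigi a b *m V nu) *m psi c f.
  by have [h <-] := SS_surj f; apply: g_W_gigi_V.
have := psi_endo comm; rewrite -/(alpha' mu nu) => E.
by rewrite -mul_mx_scalar -E (mulmxA (gi c)) gi_g mul1mx.
Qed.

Lemma W_gg_V0 a b c c' (mu : 'I_(N a b c)) (nu : 'I_(N a b c')) :
  c != c' -> W mu *m gg a b *m V nu = 0.
Proof.
move=> cc; have E := psi_intertwiner_eq0 cc (gi_W_gg_V mu nu).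
by rewrite -[LHS]mul1mx -(g_gi c) -mulmxA E mulmx0.
Qed.

Lemma W_gigi_V0 a b c c' (mu : 'I_(N a b c)) (nu : 'I_(N a b c')) :
  c != c' -> W mu *m gigi a b *m V nu = 0.
Proof.
have comm f : psi c f *m (psi c g *m (W mu *m gigi a b *m V nu))
  = psi c g *m (W mu *m gigi a b *m V nu) *m psi c' f.
  by have [h <-] := SS_surj f; apply: g_W_gigi_V.
move=> cc; have E := psi_intertwiner_eq0 cc comm.
by rewrite -[LHS]mul1mx -(gi_g c) -mulmxA E mulmx0.
Qed.

Local Opaque alpha alpha' gi.

Lemma drep_tens1_sum a b :
  drep_tens H (psi a) (psi b) one = \sum_c \sum_(mu < N a b c) V mu *m W mu.
Proof.
by rewrite HVW1; apply: eq_bigr => c _; apply: eq_bigr => mu _; rewrite psi1 mulmx1.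
Qed.

(** Since S^2(1) = 1, g (x) g preserves the range of Delta(1), where the V W form a resolution of
    the identity; Schur leaves only the channel c. *)
Lemma gg_V a b c (nu : 'I_(N a b c)) :
  gg a b *m V nu = \sum_mu alpha mu nu *: (V mu *m psi c g).
Proof.
rewrite -{1}(drep_tens1_V nu) mulmxA -drep_tens_gg S_SS_one drep_tens1_sum !mulmx_suml.
rewrite (bigD1 c) //= [X in _ + X]big1 => [|c' c'c].
  by rewrite addr0 !mulmx_suml; apply: eq_bigr => mu _; rewrite -!mulmxA (mulmxA (W mu)) W_gg_V scalemxAr.
by rewrite !mulmx_suml big1 // => mu _; rewrite -!mulmxA (mulmxA (W mu)) W_gg_V0 ?mulmx0.
Qed.

Lemma gigi_V a b c (nu : 'I_(N a b c)) :
  gigi a b *m V nu = \sum_mu alpha' mu nu *: (V mu *m gi c).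
Proof.
rewrite -{1}(drep_tens1_V nu) mulmxA -{1}S_SS_one gigi_drep_tens drep_tens1_sum !mulmx_suml.
rewrite (bigD1 c) //= [X in _ + X]big1 => [|c' c'c].
  by rewrite addr0 !mulmx_suml; apply: eq_bigr => mu _; rewrite -!mulmxA (mulmxA (W mu)) W_gigi_V scalemxAr.
by rewrite !mulmx_suml big1 // => mu _; rewrite -!mulmxA (mulmxA (W mu)) W_gigi_V0 ?mulmx0.
Qed.

Lemma W_V a b c (mu nu : 'I_(N a b c)) : W mu *m V nu = ((mu == nu)%:R)%:M.
Proof.
have [->|mn] := eqVneq mu nu; first by rewrite HVW2.
by rewrite HVW3 ?raddf0 // xpair_eqE eqxx.
Qed.

(** * Partial traces of twisted fusion operators *)

Lemma lin_trace_repr p q (L : 'M[CC]_(p, q) -> CC^o) : lin L ->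
  exists Y : 'M_(q, p), forall M, L M = \tr (M *m Y).
Proof.
move=> lL; exists (\matrix_(i, j) L (delta_mx j i)) => M.
rewrite {1}[M]matrix_sum_delta (lin_sum _ _ _ lL) /mxtrace; apply: eq_bigr => i _.
rewrite (lin_sum _ _ _ lL) mxE; apply: eq_bigr => j _.
by rewrite (linZ _ _ lL) mxE.
Qed.

(** 1_(1) f (x) 1_(2) = f_(1) (x) eps_t(f_(2)) = f_(1) (x) f_(2) S(f_(3)): an operator on one strand
    is traded for one on the pair and one on the other strand. *)
Lemma P_psi1 a b f : drep_tens H (psi a) (psi b) one *m (psi a f *t 1%:M)
  = \sw_(p, q <- f) (drep_tens H (psi a) (psi b) p *m (1%:M *t psi b (S q))).
Proof.
transitivity (\sw_(p, q <- one) (psi a (p ** f) *t psi b q)).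
  rewrite drep_tensE (sw_app _ (F := fun M => M *m (psi a f *t 1%:M))); last by linear.
  by apply: eq_sw => p q; rewrite psiM tensmx_mul mulmx1.
rewrite -(sw_epstr dwh _ (phi := fun p q => psi a p *t psi b q)); last by pbilin.
transitivity (\sw_(p, q <- f) \sw_(x, y <- q) (psi a p *t psi b (x ** S y))).
  apply: eq_sw => p q; rewrite (epstE dwh).
  by rewrite (sw_app _ (F := fun X => psi a p *t psi b X)) //; plin.
rewrite -(sw_coassoc dwh _ (fun p x y => psi a p *t psi b (x ** S y))).
apply: eq_sw => p q; rewrite drep_tensE.
rewrite (sw_app _ (F := fun M => M *m (1%:M *t psi b (S q)))); last by linear.
by apply: eq_sw => x y; rewrite psiM tensmx_mul mulmx1.
Qed.

Lemma psi_S_SS1 a b f :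
  \sw_(p, q <- f) ((1%:M *t psi b (S q)) *m drep_tens H (psi a) (psi b) (S (S p)))
  = (psi a (S (S f)) *t 1%:M) *m drep_tens H (psi a) (psi b) one.
Proof.
transitivity (\sw_(p, q <- f) \sw_(x, y <- q) (psi a (S (S p)) *t psi b (S (S x ** y)))).
  rewrite -(sw_coassoc dwh _ (fun p x y => psi a (S (S p)) *t psi b (S (S x ** y)))).
  apply: eq_sw => p q; rewrite drep_tensE sw_SS; last by pbilin.
  rewrite (sw_app _ (F := fun M => (1%:M *t psi b (S q)) *m M)); last by linear.
  by apply: eq_sw => x y; rewrite tensmx_mul mul1mx (S_mul dwh) psiM.
transitivity (\sw_(p, q <- f) (psi a (S (S p)) *t psi b (S (epss q)))).
  apply: eq_sw => p q; rewrite (epssE dwh).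
  by rewrite [RHS](sw_app _ (F := fun X => psi a (S (S p)) *t psi b (S X))) //; plin.
rewrite (sw_epssr dwh _ (phi := fun p q => psi a (S (S p)) *t psi b (S q))); last by pbilin.
rewrite -{2}S_SS_one drep_tensE sw_SS; last by pbilin.
rewrite (sw_app _ (F := fun M => (psi a (S (S f)) *t 1%:M) *m M)); last by linear.
by apply: eq_sw => x y; rewrite tensmx_mul mul1mx !(S_mul dwh) psiM.
Qed.

Lemma psi2_P a b f : (1%:M *t psi b f) *m drep_tens H (psi a) (psi b) one
  = \sw_(p, q <- f) ((psi a (S p) *t 1%:M) *m drep_tens H (psi a) (psi b) q).
Proof.
transitivity (\sw_(p, q <- one) (psi a p *t psi b (f ** q))).
  rewrite drep_tensE (sw_app _ (F := fun M => (1%:M *t psi b f) *m M)); last by linear.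
  by apply: eq_sw => p q; rewrite psiM tensmx_mul mul1mx.
rewrite -(sw_epssl dwh _ (phi := fun p q => psi a p *t psi b q)); last by pbilin.
transitivity (\sw_(p, q <- f) \sw_(x, y <- p) (psi a (S x ** y) *t psi b q)).
  apply: eq_sw => p q; rewrite (epssE dwh).
  by rewrite (sw_app _ (F := fun X => psi a X *t psi b q)) //; plin.
rewrite (sw_coassoc dwh _ (fun x y q => psi a (S x ** y) *t psi b q)).
apply: eq_sw => p q; rewrite drep_tensE.
rewrite (sw_app _ (F := fun M => (psi a (S p) *t 1%:M) *m M)); last by linear.
by apply: eq_sw => x y; rewrite psiM tensmx_mul mul1mx.
Qed.

Lemma psi_S_SS2 a b f :
  \sw_(p, q <- f) (drep_tens H (psi a) (psi b) (S (S q)) *m (psi a (S p) *t 1%:M))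
  = drep_tens H (psi a) (psi b) one *m (1%:M *t psi b (S (S f))).
Proof.
transitivity (\sw_(p, q <- f) \sw_(x, y <- p) (psi a (S (x ** S y)) *t psi b (S (S q)))).
  rewrite (sw_coassoc dwh _ (fun x y q => psi a (S (x ** S y)) *t psi b (S (S q)))).
  apply: eq_sw => p q; rewrite drep_tensE sw_SS; last by pbilin.
  rewrite (sw_app _ (F := fun M => M *m (psi a (S p) *t 1%:M))); last by linear.
  by apply: eq_sw => x y; rewrite tensmx_mul mulmx1 (S_mul dwh) psiM.
transitivity (\sw_(p, q <- f) (psi a (S (epst p)) *t psi b (S (S q)))).
  apply: eq_sw => p q; rewrite (epstE dwh).
  by rewrite [RHS](sw_app _ (F := fun X => psi a (S X) *t psi b (S (S q)))) //; plin.
rewrite (sw_epstl dwh _ (phi := fun p q => psi a (S p) *t psi b (S (S q)))); last by pbilin.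
rewrite -{2}S_SS_one drep_tensE sw_SS; last by pbilin.
rewrite (sw_app _ (F := fun M => M *m (1%:M *t psi b (S (S f))))); last by linear.
by apply: eq_sw => x y; rewrite tensmx_mul mulmx1 !(S_mul dwh) psiM.
Qed.

Lemma tens1M p q (A B : 'M[CC]_p) : (A *m B) *t (1%:M : 'M_q) = (A *t 1%:M) *m (B *t 1%:M).
Proof. by rewrite tensmx_mul mul1mx. Qed.

Lemma tensM1 p q (A B : 'M[CC]_p) : (1%:M : 'M_q) *t (A *m B) = (1%:M *t A) *m (1%:M *t B).
Proof. by rewrite tensmx_mul mul1mx. Qed.

Lemma tens_comm p q (A : 'M[CC]_p) (B : 'M_q) : (A *t 1%:M) *m (1%:M *t B) = (1%:M *t B) *m (A *t 1%:M).
Proof. by rewrite !tensmx_mul !mul1mx !mulmx1. Qed.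

Section PartialTraces.
Variables (a b c : I) (mu nu : 'I_(N a b c)).
Let X := V nu *m psi c g *m W mu.
Let X' := V nu *m gi c *m W mu.
Let P f := drep_tens H (psi a) (psi b) f.

Let X_P f : X *m P f = P (S (S f)) *m X.
Proof. by rewrite /X /P -!mulmxA W_drep_tens (mulmxA (psi c g)) -psi_SS !mulmxA drep_tens_V. Qed.

Let X'_P f : X' *m P (S (S f)) = P f *m X'.
Proof. by rewrite /X' /P -!mulmxA W_drep_tens (mulmxA (gi c)) gi_SS !mulmxA drep_tens_V. Qed.

Let XP1 : X *m P one = X. Proof. by rewrite /X -mulmxA W_drep_tens1. Qed.
Let P1X : P one *m X = X. Proof. by rewrite /X !mulmxA drep_tens1_V. Qed.
Let X'P1 : X' *m P one = X'. Proof. by rewrite /X' -mulmxA W_drep_tens1. Qed.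
Let P1X' : P one *m X' = X'. Proof. by rewrite /X' !mulmxA drep_tens1_V. Qed.

(** The traded factor 1 (x) S(f_(2)) commutes with M (x) 1 and travels around the trace, while f_(1)
    passes through X as S^2(f_(1)); the pieces reassemble to S^2(f) on the first strand. *)
Let shift1 (M : 'M_(dim a)) f :
  \tr ((M *t 1%:M) *m (X *m (psi a f *t 1%:M))) = \tr ((M *t 1%:M) *m ((psi a (S (S f)) *t 1%:M) *m X)).
Proof.
rewrite -{1}XP1 -(mulmxA X) P_psi1 -{2}P1X (mulmxA _ (P one)) -psi_S_SS1.
rewrite (sw_app _ (F := fun Y => \tr ((M *t 1%:M) *m (X *m Y)) : CC^o)); last by linear.
rewrite [RHS](sw_app _ (F := fun Y => \tr ((M *t 1%:M) *m (Y *m X)) : CC^o)); last by linear.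
apply: eq_sw => p q; rewrite (mulmxA X) X_P.
rewrite -[in RHS](mulmxA _ (P _)) [in RHS](mulmxA (M *t 1%:M)) tens_comm.
by rewrite (mulmxA (M *t 1%:M) (_ *m X)) [LHS]mxtrace_mulC !mulmxA.
Qed.

Let shift2 (M : 'M_(dim b)) f :
  \tr ((1%:M *t M) *m ((1%:M *t psi b f) *m X')) = \tr ((1%:M *t M) *m (X' *m (1%:M *t psi b (S (S f))))).
Proof.
rewrite -{1}P1X' (mulmxA _ (P one)) psi2_P -{2}X'P1 -(mulmxA X') -psi_S_SS2.
rewrite (sw_app _ (F := fun Y => \tr ((1%:M *t M) *m (Y *m X')) : CC^o)); last by linear.
rewrite [RHS](sw_app _ (F := fun Y => \tr ((1%:M *t M) *m (X' *m Y)) : CC^o)); last by linear.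
apply: eq_sw => p q; rewrite (mulmxA X') X'_P.
rewrite -(mulmxA _ (P _)) (mulmxA (1%:M *t M)) -tens_comm.
by rewrite -(mulmxA (_ *t 1%:M)) [LHS]mxtrace_mulC !mulmxA.
Qed.

(** The partial trace Y over the second strand satisfies Y psi_a(f) = psi_a(S^2 f) Y, so g^-1 Y is a
    scalar k by Schur. The target probe for l_a fixes it: d_c (for mu = nu) on one side, k d_a on
    the other. *)
Lemma ptrace_right (M : 'M_(dim a)) :
  \tr ((M *t 1%:M) *m (V nu *m psi c g *m W mu))
  = (mu == nu)%:R * (d c / d a) * \tr (M *m psi a g).
Proof.
have [|Y YE] := @lin_trace_repr _ _ (fun M : 'M_(dim a) => \tr ((M *t 1%:M) *m X)); first by linear.
have YSS f : Y *m psi a f = psi a (S (S f)) *m Y.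
  apply: mxtrace_inj => M0.
  transitivity (\tr ((M0 *t 1%:M) *m (X *m (psi a f *t 1%:M)))).
    rewrite mulmxA [LHS]mxtrace_mulC mulmxA -YE tens1M -(mulmxA (psi a f *t _)).
    by rewrite [LHS]mxtrace_mulC -(mulmxA (M0 *t _)).
  by rewrite shift1 mulmxA -tens1M YE mulmxA.
have [k Yk] : exists k, Y = k *: psi a g.
  have comm f : psi a f *m (gi a *m Y) = gi a *m Y *m psi a f.
    by rewrite mulmxA -gi_SS -!mulmxA YSS.
  exists ((gi a *m Y) (i0 a) (i0 a)).
  by rewrite -mul_mx_scalar -(psi_endo comm) mulmxA g_gi mul1mx.
have [x bx] := target_dual (l_vac a).
have := YE (psi a (epst x)).
rewrite /X !mulmxA epst_V mxtrace_mulC !mulmxA W_V mul_scalar_mx -scalemxAl mxtraceZ.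
rewrite mxtrace_mulC tr_g_epst (fusion_l mu) Yk -scalemxAr mxtraceZ [\tr (psi a (epst x) *m _)]mxtrace_mulC tr_g_epst bx eqxx !mulr1.
move=> E; rewrite -!mulmxA (mulmxA (V nu)) YE Yk -scalemxAr mxtraceZ; congr (_ * _).
by rewrite mulrA E mulfK // d_neq0.
Qed.

(** Mirror argument, where tracing out the first strand calls for g^-1 and a probe in the source
    subalgebra. *)
Lemma ptrace_left (M : 'M_(dim b)) :
  \tr ((1%:M *t M) *m (V nu *m gi c *m W mu))
  = (mu == nu)%:R * (d c / d b) * \tr (M *m gi b).
Proof.
have [|Y YE] := @lin_trace_repr _ _ (fun M : 'M_(dim b) => \tr ((1%:M *t M) *m X')); first by linear.
have YSS f : psi b f *m Y = Y *m psi b (S (S f)).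
  apply: mxtrace_inj => M0.
  transitivity (\tr ((1%:M *t M0) *m (X' *m (1%:M *t psi b (S (S f)))))).
    by rewrite mulmxA -YE tensM1 -(mulmxA (_ *t M0)) shift2.
  rewrite (mulmxA _ X') [LHS]mxtrace_mulC (mulmxA _ _ X') -tensM1 YE -(mulmxA (psi b _)).
  by rewrite [LHS]mxtrace_mulC -(mulmxA M0).
have [k Yk] : exists k, Y = k *: gi b.
  have comm f : psi b f *m (psi b g *m Y) = psi b g *m Y *m psi b f.
    have [h <-] := SS_surj f.
    by rewrite mulmxA psi_SS -!mulmxA YSS.
  exists ((psi b g *m Y) (i0 b) (i0 b)).
  by rewrite -mul_mx_scalar -(psi_endo comm) mulmxA gi_g mul1mx.
have [x bx] := source_dual (r_vac b).
have sx := @source_epss x.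
have := YE (psi b (epss x)).
rewrite /X' !mulmxA source_V // mxtrace_mulC !mulmxA W_V mul_scalar_mx -scalemxAl mxtraceZ.
rewrite mxtrace_mulC tr_gi_source // (fusion_r mu) Yk -scalemxAr mxtraceZ [\tr (psi b (epss x) *m _)]mxtrace_mulC tr_gi_source // bx eqxx !mulr1.
move=> E; rewrite -!mulmxA (mulmxA (V nu)) YE Yk -scalemxAr mxtraceZ; congr (_ * _).
by rewrite mulrA E mulfK // d_neq0.
Qed.

End PartialTraces.

Lemma target_swap a b x :
  (1%:M *t psi b (epst x)) *m drep_tens H (psi a) (psi b) one
  = (psi a (S (epst x)) *t 1%:M) *m drep_tens H (psi a) (psi b) one.
Proof.
rewrite !drep_tensE (sw_app _ (F := fun Y => (1%:M *t psi b (epst x)) *m Y)); last by linear.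
rewrite (sw_app _ (F := fun Y => (psi a (S (epst x)) *t 1%:M) *m Y)); last by linear.
transitivity (\sw_(p, q <- one) (psi a p *t psi b (epst x ** q))).
  by apply: eq_sw => p q; rewrite tensmx_mul psiM mul1mx.
rewrite (sw_one_target dwh x (phi := fun p q => psi a p *t psi b q)); last by pbilin.
by apply: eq_sw => p q; rewrite tensmx_mul psiM mul1mx.
Qed.

Lemma target_swap_V a b c (mu : 'I_(N a b c)) x :
  (1%:M *t psi b (epst x)) *m V mu = (psi a (S (epst x)) *t 1%:M) *m V mu.
Proof. by rewrite -(drep_tens1_V mu) !mulmxA target_swap. Qed.

(* Evaluates the theta graph by contracting either of its two outer strands first. *)
Lemma alpha_alpha' a b c (mu nu : 'I_(N a b c)) : alpha mu nu = alpha' mu nu.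
Proof.
have [x bx] := target_dual (l_vac b).
have rl := fusion_rl mu.
(* Factor out g (x) g on the right: it acts on V by [alpha], the probe is swapped to the first
   strand through its antipode, and the right partial trace yields d_c. *)
have E1 : \tr ((gi a *t (psi b (epst x) *m psi b g)) *m V nu *m W mu) = alpha mu nu * d c.
  have E : (gi a *t (psi b (epst x) *m psi b g)) *m V nu
     = \sum_k alpha k nu *: (((gi a *m gi a *m psi a (S (epst x))) *t 1%:M) *m (V k *m psi c g)).
    have -> : gi a *t (psi b (epst x) *m psi b g) = ((gi a *m gi a) *t 1%:M) *m (1%:M *t psi b (epst x)) *m gg a b.
      by rewrite /gg !tensmx_mul mulmx1 mul1mx -mulmxA gi_g mulmx1.
    rewrite -(mulmxA _ (gg a b)) gg_V mulmx_sumr; apply: eq_bigr => k' _.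
    by rewrite -scalemxAr -!mulmxA (mulmxA (1%:M *t _)) target_swap_V !mulmxA tensmx_mul mul1mx.
  rewrite E mulmx_suml.
  rewrite mxtrace_sum.
  rewrite (sum_single (j := mu)) => [|k km].
    rewrite -scalemxAl mxtraceZ -!mulmxA (mulmxA (V mu)) ptrace_right eqxx mul1r.
    rewrite mxtrace_mulC !mulmxA g_gi mul1mx tr_gi_source; last exact: source_S_epst.
    by rewrite rl beta_S_epst bx eqxx mulr1 d_divK.
  rewrite -scalemxAl mxtraceZ -!mulmxA (mulmxA (V k)) ptrace_right.
  by rewrite eq_sym (negPf km) !mul0r mulr0.
(* Factor out g^-1 (x) g^-1 instead: it acts by [alpha'], the second strand keeps eps_t(x) g^2, and
   the left partial trace yields the same d_c. *)
have E2 : \tr ((gi a *t (psi b (epst x) *m psi b g)) *m V nu *m W mu) = alpha' mu nu * d c.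
  have E : (gi a *t (psi b (epst x) *m psi b g)) *m V nu
     = \sum_k alpha' k nu *: ((1%:M *t (psi b (epst x) *m psi b g *m psi b g)) *m (V k *m gi c)).
    have -> : gi a *t (psi b (epst x) *m psi b g) = (1%:M *t (psi b (epst x) *m psi b g *m psi b g)) *m gigi a b.
      by rewrite /gigi tensmx_mul mul1mx -(mulmxA _ _ (gi b)) g_gi mulmx1.
    rewrite -(mulmxA _ (gigi a b)) gigi_V mulmx_sumr; apply: eq_bigr => k' _.
    by rewrite -scalemxAr.
  rewrite E mulmx_suml.
  rewrite mxtrace_sum.
  rewrite (sum_single (j := mu)) => [|k km].
    rewrite -scalemxAl mxtraceZ -(mulmxA _ (V mu *m _)) ptrace_left eqxx mul1r.
    rewrite -(mulmxA _ _ (gi b)) g_gi mulmx1 mxtrace_mulC tr_g_epst bx eqxx mulr1.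
    by rewrite d_divK.
  rewrite -scalemxAl mxtraceZ -(mulmxA _ (V k *m _)) ptrace_left.
  by rewrite eq_sym (negPf km) !mul0r mulr0.
by apply: (@mulIf CC (d c)); [exact: d_neq0 | rewrite -E1 -E2].
Qed.

(** * Signed fusion multiplicities and their sum rules *)

Definition alpha_mx a b c : 'M[CC]_(N a b c) := \matrix_(mu, nu) alpha mu nu.

(** Undoing g (x) g by its inverse shows that [alpha'] is inverse to [alpha], and the two
    coincide. *)
Lemma alpha_mx_sq a b c : alpha_mx a b c *m alpha_mx a b c = 1%:M.
Proof.
apply/matrixP=> mu nu.
have E : V nu = \sum_k alpha k nu *: (gigi a b *m V k *m psi c g).
  rewrite -[LHS]mul1mx -(gigi_gg a b) -mulmxA gg_V mulmx_sumr; apply: eq_bigr => k _.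
  by rewrite -scalemxAr mulmxA.
have := W_V mu nu; rewrite {1}E mulmx_sumr => /matrixP/(_ (i0 c) (i0 c)).
rewrite summxE [(_)%:M _ _]mxE eqxx mulr1n => e; rewrite [RHS]mxE -e mxE; apply: eq_bigr => k _.
rewrite -scalemxAr !mulmxA W_gigi_V -scalemxAl gi_g scalerA scale_scalar_mx mulr1.
by rewrite [RHS]mxE eqxx mulr1n !mxE alpha_alpha' [LHS]mulrC.
Qed.

Definition T a b c : CC := \tr (alpha_mx a b c).

Lemma T_neq0 a b c : T a b c != 0 -> [/\ l c = l a, r c = r b & r a = l b].
Proof.
move=> Tn; have [N0|Npos] := posnP (N a b c).
  case/eqP: Tn; rewrite /T /mxtrace big1 // => mu; by move: (ltn_ord mu); rewrite {2}N0.
pose mu := Ordinal Npos.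
by split; [apply: fusion_l mu | apply: fusion_r mu | apply: fusion_rl mu].
Qed.

Lemma chi_mul a b f : \tr (gg a b *m drep_tens H (psi a) (psi b) f)
  = \sum_c T a b c * \tr (psi c g *m psi c f).
Proof.
rewrite HVW1 mulmx_sumr mxtrace_sum; apply: eq_bigr => c _.
rewrite mulmx_sumr mxtrace_sum /T /mxtrace mulr_suml; apply: eq_bigr => mu _.
rewrite mxE -mxtraceZ scalemxAl -W_gg_V.
by rewrite (mulmxA (gg a b)) [LHS]mxtrace_mulC !mulmxA.
Qed.

(** Evaluate [chi_mul] at the target probe for l_a: each surviving c has l_c = l_a and contributes
    d_c. On the product side the second leg of Delta(1) contributes d_b beta_{l_b}, which selects
    l_b = r_a. *)
Lemma T_sum_target a b : \sum_c T a b c * d c = (r a == l b)%:R * (d a * d b).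
Proof.
have [x bx] := target_dual (l_vac a).
have := chi_mul a b (epst x).
have -> : \sum_c T a b c * \tr (psi c g *m psi c (epst x)) = \sum_c T a b c * d c.
  apply: eq_bigr => c _; have [->|/T_neq0[lc _ _]] := eqVneq (T a b c) 0; first by rewrite !mul0r.
  by rewrite tr_g_epst lc bx eqxx mulr1.
move=> <-; rewrite drep_tens_epst mulmxA /gg tensmx_mul mulmx1 drep_tens_tr.
rewrite -(sw_one_epst dwh (phi := fun p q =>
   \tr (psi a g *m psi a (epst x) *m psi a p) * \tr (psi b g *m psi b q) : CC^o)); last by pbilin.
transitivity (\sw_(p, q <- one) (d b * (beta (l b) q * \tr (psi a g *m psi a (epst x) *m psi a p)) : CC^o)).
  rewrite -(sw_one_epst dwh (phi := fun p q =>
     d b * (beta (l b) q * \tr (psi a g *m psi a (epst x) *m psi a p)) : CC^o)); last by pbilin.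
  by apply: eq_sw => p q; rewrite tr_g_epst mulrC mulrA.
rewrite -sw_mulCl.
have := sw_beta_r_app (l b) (F := fun M => \tr (psi a g *m psi a (epst x) *m M) : CC^o).
rewrite mulmx1 tr_g_epst bx eqxx mulr1 => -> //; last by linear.
by rewrite eq_sym scaleCC mulrCA (mulrC (d b)).
Qed.

(** * Integrals *)

Hypothesis Hcompl : forall (k : nat) (rho : 'rV[CC]_n -> 'M[CC]_k),
  is_drep H rho -> dirreducible rho -> exists a, drep_equiv (psi a) rho.

Lemma beta_epst e x : beta e (epst x) = beta e x.
Proof.
have [be|be] := eqVneq (bv e) 0; first by rewrite !beta0.
rewrite {1}/epst (sw_app _ (F := beta e : _ -> CC^o)); last exact: beta_lin.
transitivity (\sum_e' \sw_(p, q <- one) (beta e q *: (\tr (bv e' *m (psi e' p *m psi e' x)) : CC^o))).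
  rewrite -sw_sum; apply: eq_sw => p q; rewrite (linZ _ _ (beta_lin e)) epsE !scaleCC mulr_suml.
  by apply: eq_bigr => e' _; rewrite {1}/beta psiM scaleCC mulrC.
rewrite (sum_single (j := e)) => [|e' ee'].
  rewrite (sw_beta_r_app _ (F := fun M => \tr (bv e *m (M *m psi e x)) : CC^o)); last by linear.
  by rewrite vac_r // eqxx scale1r mul1mx.
rewrite (sw_beta_r_app _ (F := fun M => \tr (bv e' *m (M *m psi e' x)) : CC^o)); last by linear.
have [be'|be'] := eqVneq (bv e') 0; first by rewrite be' mul0mx mxtrace0 scaler0.
by rewrite vac_r // eq_sym (negPf ee') scale0r.
Qed.

Definition lam z k : CC := \sum_i (k ** S (S (Abas i)) ** z) 0 i.

(** On the block of a, S^2 = Ad g makes the map a left multiplication by psi_a(k) psi_a(g) followed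
    by a right one by g^-1 psi_a(z); its trace is the product of the two traces. *)
Lemma lamE z k : source z ->
  lam z k = \sum_a d a * beta (r a) z * \tr (psi a g *m psi a k).
Proof.
move=> sz; have [E EE] := matrix_units wh Hss Hpsi Hinj.
rewrite /lam (trace_coef wh Hss Hpsi Hcompl (O := fun h => k ** S (S h) ** z) EE); last by linear.
rewrite sum_coef_idx; apply: eq_bigr => a _.
have psiE i j : psi a (E (mk_idx (a := a) (i, j))) = delta_mx i j.
  apply/matrixP=> p q; rewrite mxE -[LHS]/(coef psi (mk_idx (a := a) (p, q)) _) EE.
  by rewrite -tag_eqE /tag_eq eqxx tagged_asE xpair_eqE (eq_sym i) (eq_sym j).
have entry (A B : 'M[CC]_(dim a)) i j : (A *m delta_mx i j *m B) i j = A i i * B j j.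
  rewrite -(mul_delta_mx (n := 1) 0) !mulmxA -mulmxA -colE -rowE mxE big_ord1.
  by rewrite !mxE.
have termE i j : coef psi (mk_idx (a := a) (i, j)) (k ** S (S (E (mk_idx (a := a) (i, j)))) ** z)
   = (psi a k *m psi a g) i i * (gi a *m psi a z) j j.
  rewrite /coef /= !psiM -[psi a (S _)]mulmx1 -(g_gi a) (mulmxA _ (psi a g)) psi_SS psiE.
  by rewrite -entry !mulmxA.
under eq_bigr do under eq_bigr do rewrite termE.
under eq_bigr do rewrite -mulr_sumr.
rewrite -mulr_suml -/(\tr _) -/(\tr _) tr_gi_source // mulrC [\tr (psi a k *m _)]mxtrace_mulC.
by [].
Qed.

Lemma lam_lin z : lin (lam z : _ -> CC^o).
Proof. rewrite /lam; linear. Qed.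

(* The functional [k |-> Tr(h |-> k S^2(h) z)] is a left integral: insert
   S(h_(1)) to turn k_(1) into (k S^2(h_(2)) z)_(1) S(h_(1)), then use the cyclicity of
   the trace. *)
Lemma lam_integral k y :
  \sw_(a, b <- k) (lam (epss y) b *: a) = \sw_(a, b <- one) (lam (epss y) (b ** k) *: S a).
Proof.
set z := epss y; pose F h := k ** S (S h) ** z.
(* Invariance before taking traces: h_(1) is spent on moving the coproduct from k to F(h_(2)). *)
have claim h (G : 'rV[CC]_n -> 'rV[CC]_n -> 'rV[CC]_n) : bilin G ->
    \sw_(a, b <- k) G a (b ** S (S h) ** z)
    = \sw_(p, q <- h) \sw_(s, t <- F q) G (s ** S p) t.
  move=> bG; symmetry.
  have Fsw q p : \sw_(s, t <- F q) G (s ** S p) t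
     = \sw_(a, b <- k) \sw_(c, e <- q) G (a ** (S (S c) ** S p)) (b ** S (S e) ** z).
    rewrite /F mulA (sw_mul dwh); last by bilinear.
    apply: eq_sw => a b; rewrite (sw_mul dwh); last by bilinear.
    transitivity (\sw_(c, e <- S (S q)) \sw_(c', e' <- one) G (a ** (c ** c') ** S p) (b ** (e ** e' ** z))).
      apply: eq_sw => c e; rewrite (sw_epss_r dwh); last by bilinear.
      by apply: eq_sw => c' e'; rewrite (mulA e).
    rewrite (sw_mul1r dwh _ (phi := fun c e => G (a ** c ** S p) (b ** (e ** z)))); last by bilinear.
    rewrite sw_SS; last by bilinear.
    by apply: eq_sw => c e; rewrite !mulA.
  under eq_sw do rewrite Fsw.
  rewrite sw_exch.
  (* S^2(h_(2)) S(h_(1)) = S(h_(1) S(h_(2))) is S of a target value, which turns into a copy of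
     Delta(1) and is absorbed by Delta(k). *)
  transitivity (\sw_(a, b <- k) \sw_(x, x' <- one) G (a ** x) (b ** x' ** S (S h) ** z)).
    apply: eq_sw => a b.
    rewrite -(sw_coassoc dwh _ (fun p c e => G (a ** (S (S c) ** S p)) (b ** S (S e) ** z))).
    transitivity (\sw_(x, e <- h) G (a ** S (epst x)) (b ** S (S e) ** z)).
      apply: eq_sw => x e; rewrite (epstE dwh).
      rewrite (sw_app _ (F := fun X => G (a ** S X) (b ** S (S e) ** z))); last by linear.
      by apply: eq_sw => p c; rewrite (S_mul dwh).
    rewrite (sw_epstl dwh _ (phi := fun u e => G (a ** S u) (b ** S (S e) ** z))); last by bilinear.
    rewrite -{2}S_SS_one sw_SS; last by bilinear.
    by apply: eq_sw => x e; rewrite !(S_mul dwh) !mulA.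
  by rewrite (sw_mul1r dwh _ (phi := fun a b => G a (b ** S (S h) ** z))) //; bilinear.
transitivity (\sum_i \sw_(a, b <- k) ((b ** S (S (Abas i)) ** z) 0 i *: a)).
  by rewrite -sw_sum; apply: eq_sw => a b; rewrite /lam scaler_suml.
(* Cyclicity: summing t_i Delta(e_i) over i rebuilds Delta(t), and the trace now runs over its
   second leg. *)
transitivity (\sum_i \sw_(s, t <- F (Abas i)) \sum_p ADelta D t p i *: (s ** S (Abas p))).
  transitivity (\sum_i \sum_p \sum_q ADelta D (Abas i) p q *:
      \sw_(s, t <- F (Abas q)) (t 0 i *: (s ** S (Abas p)))).
    apply: eq_bigr => i _; rewrite (claim _ (fun a m => m 0 i *: a)) //.
    by split=> ?; linear.
  rewrite exchange_big; under eq_bigr do rewrite exchange_big.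
  rewrite exchange_big; apply: eq_bigr => q _; rewrite sw_sum; apply: eq_bigr => p _.
  under eq_bigr do rewrite -sw_scaler.
  rewrite -sw_sum; apply: eq_sw => s t.
  rewrite [in RHS](@lin_basis _ CC^o (fun t => ADelta D t p q)); last by linear.
  by rewrite scaler_suml; apply: eq_bigr => i _; rewrite scalerA scaleCC mulrC.
transitivity (\sum_i \sw_(a, b <- one) ((b ** F (Abas i)) 0 i *: S a)).
  apply: eq_bigr => i _.
  rewrite -(sw_epstl dwh _ (phi := fun u v => v 0 i *: u)); last by split=> ?; linear.
  transitivity (\sw_(s, t <- F (Abas i)) \sw_(p, q <- s) (t 0 i *: (p ** S q))).
    rewrite (sw_coassoc dwh _ (fun p q t => t 0 i *: (p ** S q))).
    apply: eq_sw => s t; rewrite /sw; apply: eq_bigr => p _.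
    rewrite -(sum_Abasl i (fun q => ADelta D t p q *: (s ** S (Abas p)))).
    by apply: eq_bigr => q _; rewrite !scalerA mulrC !AbasE eq_sym.
  by apply: eq_sw => s t; rewrite sw_scaler (epstE dwh).
rewrite -sw_sum; apply: eq_sw => a b; rewrite /lam scaler_suml.
by apply: eq_bigr => i _; rewrite /F !mulA.
Qed.

Lemma psi_g_neq0 a : psi a g != 0.
Proof. by apply: contraNneq (mx1_neq0 a) => g0; rewrite -(g_gi a) g0 mul0mx. Qed.

Lemma g_coef_inj (x y : I -> CC) :
  (forall k, \sum_c x c * \tr (psi c g *m psi c k) = \sum_c y c * \tr (psi c g *m psi c k)) ->
  x =1 y.
Proof.
move=> e c; apply/eqP; rewrite -subr_eq0.
have := coef_indep wh Hss Hpsi Hinj (X := fun c => (x c - y c) *: psi c g) _ c.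
move=> /(_ _)/eqP; rewrite scaler_eq0 (negPf (psi_g_neq0 c)) orbF; apply.
move=> f; apply/eqP; rewrite -subr_eq0 subr0 -{2}(subrr (\sum_c x c * \tr (psi c g *m psi c f))) {2}e -sumrB.
by apply/eqP; apply: eq_bigr => a _; rewrite -scalemxAl mxtraceZ mulrBl.
Qed.

(** Apply the twisted character of a to [lam_integral]. The left side expands through T; on the
    right S(1_(1)) gives d_a beta_{l_a}(1_(1)), and Delta(1) selects the c with l_c = l_a. Twisted
    characters are independent, so coefficients may be compared. *)
Lemma T_sum_lam a c y :
  \sum_b d b * beta (r b) (epss y) * T a b c = (l a == l c)%:R * (d a * d c * beta (r c) (epss y)).
Proof.
move: c; apply: g_coef_inj => k; have sy := @source_epss y.
transitivity (\sw_(p, q <- k) (lam (epss y) q * \tr (psi a g *m psi a p) : CC^o)).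
  under eq_bigr do rewrite mulr_suml.
  rewrite exchange_big.
  transitivity (\sum_b d b * beta (r b) (epss y) * \tr (gg a b *m drep_tens H (psi a) (psi b) k)).
    by apply: eq_bigr => b _; rewrite chi_mul mulr_sumr; apply: eq_bigr => c _; rewrite mulrA.
  under eq_bigr do rewrite drep_tens_tr sw_mulCl.
  rewrite -sw_sum; apply: eq_sw => p q; rewrite lamE // mulr_suml.
  by apply: eq_bigr => b _; rewrite [LHS]mulrA [RHS]mulrAC.
transitivity (\tr (psi a g *m psi a (\sw_(p, q <- k) (lam (epss y) q *: p)))).
  rewrite (sw_app _ (F := fun X => \tr (psi a g *m psi a X) : CC^o)); last by plin.
  by apply: eq_sw => p q; rewrite (linZ _ _ (psi_lin a)) -scalemxAr mxtraceZ.
rewrite lam_integral (sw_app _ (F := fun X => \tr (psi a g *m psi a X) : CC^o)); last by plin.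
have ll := lam_lin (epss y).
transitivity (\sw_(p, q <- one) (lam (epss y) (q ** k) * \tr (psi a g *m psi a (S p)) : CC^o)).
  by apply: eq_sw => p q; rewrite (linZ _ _ (psi_lin a)) -scalemxAr mxtraceZ.
rewrite (sw_one_S1 dwh (phi := fun p q => lam (epss y) (q ** k) * \tr (psi a g *m psi a p) : CC^o)); last first.
  by split=> ?; [plin | apply: lin_mull; apply: lin_comp ll _; plin].
transitivity (\sum_c \sw_(p, q <- one) (beta (l a) p *:
    (d a * (d c * beta (r c) (epss y)) * \tr (psi c g *m (psi c q *m psi c k)) : CC^o))).
  rewrite -sw_sum; apply: eq_sw => p q; rewrite lamE // tr_g_epst beta_epst mulr_suml.
  apply: eq_bigr => c _; rewrite psiM scaleCC [LHS]mulrC -!mulrA [LHS]mulrCA.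
  by [].
apply: eq_bigr => c _.
rewrite (sw_beta_l_app _ (F := fun M =>
   d a * (d c * beta (r c) (epss y)) * \tr (psi c g *m (M *m psi c k)) : CC^o)); last by linear.
by rewrite mul1mx scaleCC !mulrA.
Qed.

(** The source probe for r_c removes the weights, since a nonzero T_ab^c forces r_b = r_c. *)
Lemma T_sum_source a c : \sum_b T a b c * d b = (l a == l c)%:R * (d a * d c).
Proof.
have [y by1] := source_dual (r_vac c).
have := T_sum_lam a c y; rewrite by1 eqxx mulr1 => <-.
apply: eq_bigr => b _; have [->|/T_neq0[_ rc _]] := eqVneq (T a b c) 0.
  by rewrite mul0r mulr0.
by rewrite by1 rc eqxx mulr1 mulrC.
Qed.

(** * Positivity of the squares of the d_a *)

Lemma mxtrace_idem p (P : 'M[CC]_p) : P *m P = P -> \tr P = (\rank P)%:R.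
Proof.
move=> PP; rewrite -{1}(mulmx_base P) mxtrace_mulC.
have E : row_base P *m col_base P = 1%:M.
  apply: (row_full_inj (col_base_full P)); apply: (row_free_inj (row_base_free P)).
  by rewrite mulmx1 mulmxA mulmx_base -mulmxA mulmx_base PP.
by rewrite E mxtrace1.
Qed.

Lemma mxtrace_invol_real p (M : 'M[CC]_p) : M *m M = 1%:M -> (\tr M)^* = \tr M.
Proof.
move=> MM; pose P := 2^-1 *: (1%:M + M).
have n2 : (2 : CC) != 0 by rewrite pnatr_eq0.
have PP : P *m P = P.
  rewrite /P -scalemxAl -scalemxAr scalerA mulmxDl !mulmxDr MM mul1mx mulmx1 mul1mx.
  rewrite [M + _]addrC -mulr2n -(scaler_nat 2 (_ + _)) scalerA -mulrA mulVf ?mulr1 //.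
have trM : \tr M = 2 * \tr P - p%:R.
  by rewrite /P mxtraceZ mulrA mulfV // mul1r mxtraceD mxtrace1 addrC addKr.
by rewrite trM mxtrace_idem // rmorphB rmorphM !rmorph_nat.
Qed.

Lemma T_real a b c : (T a b c)^* = T a b c.
Proof. exact: mxtrace_invol_real (alpha_mx_sq a b c). Qed.

Definition D2 e : CC := \sum_(x | l x == e) d x ^+ 2.

Lemma sum_cond (x : I -> bool) (F : I -> CC) : \sum_i (x i)%:R * F i = \sum_(i | x i) F i.
Proof.
by rewrite [RHS]big_mkcond; apply: eq_bigr => i _; case: (x i); rewrite (mul1r, mul0r).
Qed.

(** Sum T_ab^c d_c conj(d_b) in both orders: over c first by the target rule, over b first by the
    conjugate of the source rule, T being real. *)
Lemma norm_balance a :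
  d a * (\sum_(x | l x == r a) `|d x| ^+ 2) = (d a)^* * (\sum_(x | l x == l a) `|d x| ^+ 2).
Proof.
transitivity (\sum_b \sum_c T a b c * d c * (d b)^*).
  under [RHS]eq_bigr do rewrite -mulr_suml T_sum_target -mulrA.
  rewrite -sum_cond mulr_sumr; apply: eq_bigr => b _.
  by rewrite eq_sym mulrCA normCK -!mulrA.
rewrite exchange_big -(sum_cond (fun x => l x == l a)) [RHS]mulr_sumr; apply: eq_bigr => c _ /=.
transitivity (d c * (\sum_b T a b c * d b)^*).
  rewrite rmorph_sum mulr_sumr; apply: eq_bigr => b _.
  by rewrite rmorphM /= T_real [RHS]mulrCA [RHS]mulrA.
rewrite T_sum_source !rmorphM rmorph_nat eq_sym normCK.
by rewrite mulrCA [RHS]mulrCA; congr (_ * _); rewrite mulrCA.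
Qed.

Lemma norm_sum_gt0 a e : l a = e -> 0 < \sum_(x | l x == e) `|d x| ^+ 2.
Proof.
move=> la; rewrite (bigD1 a) ?la //=; apply: ltr_wpDr.
  by apply: sumr_ge0 => x _; rewrite exprn_ge0.
by rewrite exprn_gt0 // normr_gt0 d_neq0.
Qed.

(** Multiplying the balance by d_a turns its right side into |d_a|^2 times a positive sum;
    positivity in [CC] includes being real. *)
Lemma d2_gt0 a : 0 < d a ^+ 2.
Proof.
have Kr : 0 < \sum_(x | l x == r a) `|d x| ^+ 2 by apply: (norm_sum_gt0 (a := r a)); rewrite vac_l ?r_vac.
have Kl : 0 < \sum_(x | l x == l a) `|d x| ^+ 2 by apply: (norm_sum_gt0 (a := a)).
rewrite -(pmulr_lgt0 _ Kr) expr2 -mulrA norm_balance mulrA -normCK.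
by rewrite mulr_gt0 // exprn_gt0 // normr_gt0 d_neq0.
Qed.

Lemma D2_neq0 a : D2 (l a) != 0.
Proof.
apply: lt0r_neq0; rewrite /D2 (bigD1 a) //=; apply: ltr_wpDr (d2_gt0 a).
by apply: sumr_ge0 => x _; have := d2_gt0 x; rewrite lt0r => /andP[].
Qed.

Lemma D2_lr a : D2 (r a) = D2 (l a).
Proof.
apply: (@mulfI CC (d a)); first exact: d_neq0.
transitivity (\sum_b \sum_c T a b c * d c * d b).
  under [RHS]eq_bigr do rewrite -mulr_suml T_sum_target -mulrA.
  rewrite /D2 -sum_cond mulr_sumr; apply: eq_bigr => b _.
  by rewrite eq_sym mulrCA expr2 -!mulrA.
rewrite exchange_big /D2 -(sum_cond (fun x => l x == l a)) [RHS]mulr_sumr; apply: eq_bigr => c _ /=.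
transitivity (d c * (\sum_b T a b c * d b)).
  by rewrite mulr_sumr; apply: eq_bigr => b _; rewrite [RHS]mulrCA [RHS]mulrA.
by rewrite T_sum_source eq_sym mulrCA [RHS]mulrCA expr2; congr (_ * _); rewrite mulrCA.
Qed.

(** * The integral Lambda *)

Variable Lam : 'rV[CC]_n.
Hypothesis HLam : forall f, Aev f Lam =
     \sum_a (d a / \sum_(x | l x == l a) d x ^+ 2) * \tr (psi a g *m psi a f).

(** Take the source element on which every vacuum beta_e equals 1/D_e. [lam] weighs a by beta_{r_a},
    whereas Lambda carries 1/D_{l_a}; [D2_lr] reconciles the two. *)
Lemma Lam_lam : exists y, forall k, Aev k Lam = lam (epss y) k.
Proof.
have [Y YE] : exists Y : I -> 'rV[CC]_n, forall e, bv e != 0 ->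
    forall e', beta e' (epss (Y e)) = (e' == e)%:R.
  apply: (@fin_all_exists _ (fun _ => 'rV[CC]_n) (fun e y => bv e != 0 ->
    forall e', beta e' (epss y) = (e' == e)%:R)) => e.
  have [be|be] := eqVneq (bv e) 0; first by exists 0.
  by have [y yE] := source_dual be; exists y.
exists (\sum_(e | bv e != 0) (D2 e)^-1 *: Y e) => k.
rewrite HLam lamE; last exact: source_epss.
apply: eq_bigr => a _; congr (_ * _); congr (_ * _).
rewrite -/(D2 (l a)) -D2_lr big_mkcond (lin_sum _ _ _ (epss_lin D)) (lin_sum _ _ _ (beta_lin (r a))).
rewrite (sum_single (j := r a)) => [|e er].
  by rewrite r_vac (linZ _ _ (epss_lin D)) (linZ _ _ (beta_lin _)) YE ?r_vac // eqxx scaleCC mulr1.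
have [be|be] := eqVneq (bv e) 0; first by rewrite (lin0 (epss_lin D)) (lin0 (beta_lin _)).
by rewrite (linZ _ _ (epss_lin D)) (linZ _ _ (beta_lin _)) YE // eq_sym (negPf er) scaler0.
Qed.

Lemma Lam_integral k :
  \sw_(a, b <- k) (Aev b Lam *: a) = \sw_(a, b <- one) (Aev (b ** k) Lam *: S a).
Proof.
have [y yE] := Lam_lam.
under eq_sw do rewrite yE.
by under [RHS]eq_sw do rewrite yE; exact: lam_integral.
Qed.

(** Insert S(f_(1)) f_(2), a source value that Delta(1) supplies, in front of h_(1), then apply
    [Lam_integral] to the product of the remaining part of f with h. *)
Lemma Lam_integral2 f h :
  \sw_(a, b <- h) (Aev (f ** b) Lam *: a) = \sw_(a, b <- f) (Aev (b ** h) Lam *: S a).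
Proof.
transitivity (\sw_(p, q <- f) \sw_(x, y <- q) \sw_(s, t <- h) (Aev (y ** t) Lam *: (S p ** (x ** s)))).
  rewrite -(sw_coassoc dwh _ (fun p x y => \sw_(s, t <- h) (Aev (y ** t) Lam *: (S p ** (x ** s))))).
  transitivity (\sw_(x, y <- f) \sw_(s, t <- h) (Aev (y ** t) Lam *: (epss x ** s))).
    rewrite (sw_epssl dwh _ (phi := fun x y => \sw_(s, t <- h) (Aev (y ** t) Lam *: (x ** s)))); last by bilinear.
    rewrite -(sw_mul1l dwh h (phi := fun s t => Aev (f ** t) Lam *: s)); last by bilinear.
    by rewrite sw_exch; apply: eq_sw => c e; apply: eq_sw => s t; rewrite mulA.
  apply: eq_sw => x y; rewrite (epssE dwh).
  rewrite (sw_app _ (F := fun X => \sw_(s, t <- h) (Aev (y ** t) Lam *: (X ** s)))); last by linear.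
  by apply: eq_sw => p q; apply: eq_sw => s t; rewrite mulA.
transitivity (\sw_(p, q <- f) (S p ** \sw_(a, b <- one) (Aev (b ** (q ** h)) Lam *: S a))).
  apply: eq_sw => p q; rewrite -Lam_integral (sw_mul dwh); last by bilinear.
  rewrite (sw_app _ (F := fun X => S p ** X)); last by linear.
  apply: eq_sw => x y; rewrite (sw_app _ (F := fun X => S p ** X)); last by linear.
  by apply: eq_sw => s t; rewrite (linZ _ _ ((Amul_bilin D).2 (S p))).
rewrite -(sw_mul1l dwh f (phi := fun p q => Aev (q ** h) Lam *: S p)); last by bilinear.
apply: eq_sw => p q; rewrite (sw_app _ (F := fun X => S p ** X)); last by linear.
by apply: eq_sw => a b; rewrite (linZ _ _ ((Amul_bilin D).2 (S p))) (S_mul dwh) mulA.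
Qed.

(** Integrality gives f(Lambda^2) = Lambda(eps_t(1_(1))) Lambda(1_(2) f). The normalization says
    Lambda(eps_t(x)) = eps(x), and the counit axiom then leaves Lambda(f). *)
Lemma Lam_idem : Amul H Lam Lam = Lam.
Proof.
apply: Aev_inj => f; rewrite !(AevC _ f) -Aev_dual_sw.
have La : lin (fun p => Aev p Lam : CC^o) by linear.
transitivity (Aev (\sw_(p, q <- f) (Aev q Lam *: p)) Lam).
  rewrite (sw_app _ (F := fun X => Aev X Lam : CC^o)) //.
  by apply: eq_sw => p q; rewrite (linZ _ _ La) scaleCC mulrC.
rewrite Lam_integral (sw_app _ (F := fun X => Aev X Lam : CC^o)) //.
transitivity (\sw_(a, b <- one) (Aev (b ** f) Lam * Aev (S a) Lam : CC^o)).
  by apply: eq_sw => a b; rewrite (linZ _ _ La).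
rewrite (sw_one_S1 dwh (phi := fun a b => Aev (b ** f) Lam * Aev a Lam : CC^o)); last by bilinear.
rewrite -{2}(wh_mul1l dwh f) -(sw_counitl dwh one (phi := fun u => Aev (u ** f) Lam : CC^o)); last by linear.
apply: eq_sw => a b; rewrite [LHS]mulrC scaleCC; congr (_ * _).
rewrite HLam epsE.
transitivity (\sum_x (d x ^+ 2 / D2 (l x)) * beta (l x) a).
  by apply: eq_bigr => x _; rewrite tr_g_epst beta_epst expr2 mulrA [d x / _ * _]mulrAC.
(* For a vacuum e the d_x^2 with l_x = e add up to the denominator D_e; for any other e both sides
   are 0 because beta_e is. *)
rewrite (partition_big l predT) //=; apply: eq_bigr => e _.
transitivity (\sum_(x | l x == e) d x ^+ 2 * ((D2 e)^-1 * beta e a)).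
  by apply: eq_bigr => x /eqP <-; rewrite mulrA.
rewrite -mulr_suml -/(D2 e); have [be|be] := eqVneq (bv e) 0; first by rewrite beta0 // !mulr0.
by rewrite mulrA mulfV ?mul1r // -(vac_l be) D2_neq0.
Qed.

Lemma ADelta_Lam i j : ADelta H Lam i j = Aev (Abas i ** Abas j) Lam.
Proof. by rewrite Aev_dual_mul ADelta_sw; apply: eq_sw => a b; rewrite !Aev_basl. Qed.

(** If f is in the left kernel, Lambda(f h) = 0 for all h, so independence of matrix coefficients
    gives psi_a(g) psi_a(f) = 0 for every a; g is invertible and the irreps are jointly faithful. *)
Lemma ADelta_Lam_unit : ADelta H Lam \in unitmx.
Proof.
rewrite -row_free_unit -kermx_eq0; apply/eqP/row_matrixP=> i; rewrite row0.
set f := row i _.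
have fM : f *m ADelta H Lam = 0 by apply/sub_kermxP; rewrite row_sub.
have fe j : Aev (f ** Abas j) Lam = 0.
  rewrite (@lin_basis _ CC^o (fun f => Aev (f ** Abas j) Lam)); last by linear.
  have /rowP/(_ j) := fM; rewrite mxE [in X in _ = X -> _]mxE => e0; rewrite -[RHS]e0.
  by apply: eq_bigr => k _; rewrite ADelta_Lam.
have fh h : Aev (f ** h) Lam = 0.
  rewrite (@lin_basis _ CC^o (fun h => Aev (f ** h) Lam)); last by linear.
  by rewrite big1 // => j _; rewrite fe scaler0.
apply: (psi_faithful wh Hss Hpsi Hcompl) => a.
have X0 := coef_indep wh Hss Hpsi Hinj (X := fun a => (d a / D2 (l a)) *: (psi a g *m psi a f)).
have : (d a / D2 (l a)) *: (psi a g *m psi a f) = 0.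
  apply: X0 => h; rewrite -[RHS](fh h) HLam; apply: eq_bigr => b _.
  by rewrite psiM -scalemxAl mxtraceZ mulmxA.
move/eqP; rewrite scaler_eq0 mulf_eq0 invr_eq0 (negPf (d_neq0 a)) (negPf (D2_neq0 a)) /= => /eqP gf0.
by rewrite -[LHS]mul1mx -(gi_g a) -mulmxA gf0 mulmx0.
Qed.

Lemma Atmul_tens_Delta (x y z : 'rV[CC]_n) i j :
  Atmul H (Atens x y) (ADelta H z) i j
  = sw H z (fun a b => Amul H x a 0 i * Amul H y b 0 j : CC^o).
Proof.
have coordl (x' : 'rV[CC]_n) k i' : \sum_p x' 0 p * Amul H (Abas p) (Abas k) 0 i' = Amul H x' (Abas k) 0 i'.
  rewrite [RHS](@lin_basis _ CC^o (fun x => Amul H x (Abas k) 0 i')) //; by linear.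
transitivity (\sum_p \sum_q \sum_k \sum_l0 (Atens x y p q * ADelta H z k l0) *
    (Amul H (Abas p) (Abas k) 0 i * Amul H (Abas q) (Abas l0) 0 j)).
  rewrite /Atmul summxE; apply: eq_bigr => p _; rewrite summxE; apply: eq_bigr => q _.
  rewrite summxE; apply: eq_bigr => k _; rewrite summxE; apply: eq_bigr => l0 _.
  by rewrite [LHS]mxE; congr (_ * _); apply: AtensE.
rewrite exchange_big4 /sw; apply: eq_bigr => k _; apply: eq_bigr => l0 _.
rewrite -(coordl x) -(coordl y) exchange_big mulr_suml scaler_sumr; apply: eq_bigr => p _.
rewrite mulr_sumr scaler_sumr; apply: eq_bigr => q _.
rewrite AtensE !scaleCC; exact: (@mulr6_rearrange CC).
Qed.

(** Paired with f (x) h, this is [Lam_integral2] evaluated at x. *)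
Lemma Lam_left_integral x :
  Atmul H (Atens (wone H) x) (ADelta H Lam) = Atmul H (Atens (Aanti H x) (wone H)) (ADelta H Lam).
Proof.
apply/matrixP=> i j; rewrite !Atmul_tens_Delta.
pose f : 'rV[CC]_n := Abas i; pose h : 'rV[CC]_n := Abas j.
transitivity (Aev (\sw_(p, q <- h) (Aev (f ** q) Lam *: p)) x).
  rewrite (sw_app _ (F := fun X => Aev X x : CC^o)); last by linear.
  transitivity (\sw_(p, q <- h) sw H Lam (fun a b => Aev f a * (Aev p x * Aev q b) : CC^o)).
    rewrite sw_exch; apply: eq_sw => a b; rewrite (wh_mul1l wh) -Aev_basl -/f.
    by rewrite -(Aev_basl j) -/h -Aev_dual_sw sw_mulCl.
  apply: eq_sw => p q; rewrite (linZ (f := fun X => Aev X x : CC^o)); last by linear.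
  rewrite Aev_dual_mul -sw_scale; apply: eq_sw => a b; rewrite scaleCC.
  by rewrite mulrCA mulrC.
rewrite Lam_integral2 (sw_app _ (F := fun X => Aev X x : CC^o)); last by linear.
transitivity (\sw_(p, q <- f) sw H Lam (fun a b => Aev p (Aanti H x) * Aev q a * Aev h b : CC^o)).
  apply: eq_sw => p q; rewrite (linZ (f := fun X => Aev X x : CC^o)); last by linear.
  rewrite Aev_dual_mul Aev_dual_S -sw_scale; apply: eq_sw => a b; rewrite scaleCC.
  by rewrite mulrC mulrA.
rewrite sw_exch; apply: eq_sw => a b; rewrite (wh_mul1l wh) -Aev_basl -/f.
by rewrite -(Aev_basl j) -/h -Aev_dual_sw sw_mulCr.
Qed.

Lemma Lam_SS f h : Aev (f ** S (S h)) Lam = Aev (h ** f) Lam.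
Proof.
rewrite !HLam; apply: eq_bigr => a _; congr (_ * _).
by rewrite !psiM [LHS]mxtrace_mulC -mulmxA psi_SS mxtrace_mulC [in RHS]mulmxA -mulmxA mxtrace_mulC.
Qed.

(** Elements are rows, so S^2 on the first leg is left multiplication by the transpose of
    [wS H *m wS H]; moved to the other side, the claim is [Lam_SS] in coordinates. *)
Lemma Lam_q_trace : (ADelta H Lam)^T = (invmx (wS H *m wS H))^T *m ADelta H Lam.
Proof.
have uS : wS H *m wS H \in unitmx by rewrite unitmx_mul (wh_Sunit wh).
rewrite trmx_inv; apply: (canRL (mulKmx _)); first by rewrite unitmx_tr.
apply/matrixP=> i j; rewrite ADelta_Lam -Lam_SS mxE.
rewrite (_ : S (S (Abas i)) = Abas i *m (wS H *m wS H)^T); last by rewrite trmx_mul mulmxA.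
rewrite (@lin_basis _ CC^o (fun h => Aev (Abas j ** h) Lam)); last by linear.
apply: eq_bigr => k _; rewrite [(ADelta H Lam)^T _ _]mxE ADelta_Lam scaleCC; congr (_ * _).
by rewrite -rowE [RHS]mxE.
Qed.

Lemma q_trace_integral :
  (forall a, \sum_(x | l x == l a) d x ^+ 2 != 0) /\
  Amul H Lam Lam = Lam /\
  (forall x : 'rV[CC]_n, exists f : 'rV[CC]_n, f *m ADelta H Lam = x) /\
  (forall x : 'rV[CC]_n, exists f : 'rV[CC]_n, (ADelta H Lam *m f^T)^T = x) /\
  (forall x, Atmul H (Atens (wone H) x) (ADelta H Lam)
             = Atmul H (Atens (Aanti H x) (wone H)) (ADelta H Lam)) /\
  (ADelta H Lam)^T = (invmx (wS H *m wS H))^T *m ADelta H Lam.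
Proof.
split; first exact: D2_neq0.
split; first exact: Lam_idem.
have uM := ADelta_Lam_unit.
split; first by move=> x; exists (x *m invmx (ADelta H Lam)); rewrite mulmxKV.
split.
  move=> x; exists (x *m invmx (ADelta H Lam)^T).
  by rewrite trmx_mul trmxK mulmxKV // unitmx_tr.
by split; [exact: Lam_left_integral | exact: Lam_q_trace].
Qed.

End Vacuum.

Theorem theorem5p8
  (* the weak Hopf algebra A (dimension n, over CC) with A* semisimple *)
  (n : nat) (H : WHAdata n)
  (HH : is_weak_hopf H) (Hss : dual_semisimple H)
  (* Irr of the dual : a complete family of pairwise inequivalent irreps psi_a *)
  (I : finType) (dim : I -> nat)
  (psi : forall a : I, 'rV[CC]_n -> 'M[CC]_(dim a))
  (Hpsi : forall a, is_drep H (psi a) /\ dirreducible (psi a))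
  (Hinj : forall a b, drep_equiv (psi a) (psi b) -> a = b)
  (Hcompl : forall (k : nat) (rho : 'rV[CC]_n -> 'M[CC]_k),
      is_drep H rho -> dirreducible rho -> exists a, drep_equiv (psi a) rho)
  (* fusion multiplicities and fusion tensors *)
  (N : I -> I -> I -> nat)
  (V : forall a b c, 'I_(N a b c) -> 'M[CC]_(dim a * dim b, dim c))
  (W : forall a b c, 'I_(N a b c) -> 'M[CC]_(dim c, dim a * dim b))
  (HVW1 : forall a b f, drep_tens H (psi a) (psi b) f
            = \sum_c \sum_(mu < N a b c) V a b c mu *m psi c f *m W a b c mu)
  (HVW2 : forall a b c (mu : 'I_(N a b c)), W a b c mu *m V a b c mu = 1%:M)
  (HVW3 : forall a b c c' (mu : 'I_(N a b c)) (mu' : 'I_(N a b c')),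
            (c, nat_of_ord mu) != (c', nat_of_ord mu') ->
            W a b c mu *m V a b c' mu' = 0)
  (* vacuum: f(1) = sum_a Tr(b_a psi_a(f)), E = {a | b_a <> 0}, b_e = v_e u_e *)
  (bv : forall a, 'M[CC]_(dim a))
  (Hb : forall f, Aev f (wone H) = \sum_a \tr (bv a *m psi a f))
  (u : forall a, 'rV[CC]_(dim a)) (v : forall a, 'cV[CC]_(dim a))
  (Huv : forall e, bv e != 0 -> bv e = v e *m u e)
  (l r : I -> I)
  (Hl : forall a, bv (l a) != 0 /\
          forall e c, bv e != 0 -> N e a c = ((e == l a) && (a == c)) :> nat)
  (Hr : forall a, bv (r a) != 0 /\
          forall e c, bv e != 0 -> N a e c = ((e == r a) && (a == c)) :> nat)
  (* conjugation *)
  (bar : I -> I) (bb : forall a, bar (bar a) = a)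
  (Z : forall a, 'M[CC]_(dim a, dim (bar a)))
  (Zi : forall a, 'M[CC]_(dim (bar a), dim a))
  (HZ : forall a, Z a *m Zi a = 1%:M /\ Zi a *m Z a = 1%:M /\
          forall f, (psi a (Danti H f))^T = Z a *m psi (bar a) f *m Zi a)
  (* w_c *)
  (w : I -> CC)
  (Hw : forall c, N (bar c) c (r c) = 1%N /\ w c != 0 /\
          forall mu : 'I_(N (bar c) c (r c)),
            theta_of (castmx (congr1 dim (bb c), erefl) (Zi (bar c)))
              *m zeta_of (Z c)
            = w c *: ((V (bar c) c (r c) mu *m v (r c))
                        *m (u (r c) *m W (bar c) c (r c) mu)))
  (* d_a *)
  (d : I -> CC)
  (Hd : forall a, d a ^+ 2 = w a * w (bar a) /\ d a = d (bar a))
  (* g *)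
  (g : 'rV[CC]_n)
  (Hg : forall a, psi a g = (d a / w (bar a)) *:
          ((Zi a)^T *m castmx (erefl, congr1 dim (bb a)) (Z (bar a))))
  (* Lambda *)
  (Lam : 'rV[CC]_n)
  (HLam : forall f, Aev f Lam =
     \sum_a (d a / \sum_(x | l x == l a) d x ^+ 2) * \tr (psi a g *m psi a f)) :
  (forall a, \sum_(x | l x == l a) d x ^+ 2 != 0) /\
  Amul H Lam Lam = Lam /\
  (forall x : 'rV[CC]_n, exists f : 'rV[CC]_n, f *m ADelta H Lam = x) /\
  (forall x : 'rV[CC]_n, exists f : 'rV[CC]_n, (ADelta H Lam *m f^T)^T = x) /\
  (forall x, Atmul H (Atens (wone H) x) (ADelta H Lam)
             = Atmul H (Atens (Aanti H x) (wone H)) (ADelta H Lam)) /\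
  (ADelta H Lam)^T = (invmx (wS H *m wS H))^T *m ADelta H Lam.
Proof.
exact: (q_trace_integral (is_weak_hopf_whopf HH) Hss (fun a => Hpsi a) Hinj HVW1 HVW2 HVW3 Hb Hl Hr
  Huv HZ Hw Hd Hg Hcompl HLam).
Qed.
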